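(* Let $f\colon M^n \to \mathbb{R}^{n+1}$, $n\geq 4$, be an isometric immersion with constant mean curvature. If $M^n$ is K\''ahler, then either $f$ is minimal or $f(M)$ is an open subset of the image of a cylinder over a surface in $\mathbb{R}^3$ with constant mean curvature.
   Context: Here $n$ is the real dimension of $M^n$. The mean curvature of $f$ is the length $H=\|\mathcal{H}\|$ of $\mathcal{H}=\mathrm{trace}(\alpha^f)/n$, where $\alpha^f$ is the second fundamental form; $f$ is minimal if $H\equiv0$. A cylinder over a surface $g\colon M^2\to\mathbb{R}^3$ is the immersion $g\times\mathrm{id}_{\mathbb{R}^{n-2}}\colon M^2\times\mathbb{R}^{n-2}\to\mathbb{R}^{n+1}$.
   Formalization: ''Open subset of the image of a cylinder'' is read as the image of an open subset of M^2×R^{n-2} under the cylinder map, for some orthogonal splitting R^{n+1}=R^3×R^{n-2}; openness of f(M) as a point set in the image fails for self-intersecting surfaces such as nodoids. *)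

(* Defs.v *)
From mathcomp Require Import all_boot all_order all_algebra.
From mathcomp Require Import all_classical all_reals all_analysis.

Set Implicit Arguments.
Unset Strict Implicit.
Unset Printing Implicit Defensive.

Import Order.TTheory GRing.Theory Num.Theory numFieldNormedType.Exports.
Local Open Scope classical_set_scope.
Local Open Scope ring_scope.

(* Conventions.  Vectors of R^n are row vectors, so that for F : R^n -> R^m
   the Jacobian ['J F x] satisfies ['d F x u = u *m 'J F x], and row i of
   ['J F x] is the partial derivative of F along x_i.  An endomorphism of
   R^n with matrix A is u |-> u *m A. *)

Section Calculus.
Context {R : realType}.

Fixpoint Ck (V : normedModType R) (n k : nat) (U : set 'rV[R]_n)
    (F : 'rV[R]_n -> V) : Prop :=
  match k with
  | 0 => forall x, U x -> {for x, continuous F}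
  | k'.+1 => (forall x, U x -> differentiable F x) /\
             (forall v, Ck k' U (fun x => 'D_v F x))
  end.

Definition smooth_on (V : normedModType R) (n : nat) (U : set 'rV[R]_n)
  (F : 'rV[R]_n -> V) : Prop := forall k, Ck k U F.

Definition partial (V : normedModType R) (n : nat) (l : 'I_n)
  (F : 'rV[R]_n -> V) : 'rV[R]_n -> V := fun x => 'D_(delta_mx 0 l) F x.

(* The library norm on 'rV[R]_m is the sup norm. *)
Definition eucl_norm (m : nat) (v : 'rV[R]_m) : R :=
  Num.sqrt (\sum_(k < m) v 0 k ^+ 2).

End Calculus.

(* Connected smooth n-manifolds (Hausdorff, second countable), presented by
   a smooth atlas.  [param c] is only relevant on the open set
   [coord c @` dom c], where it is the inverse of [coord c]. *)
Record manifold (R : realType) (n : nat) : Type := Manifold {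
  carrier :> topologicalType;
  chart : Type;
  dom : chart -> set carrier;
  coord : chart -> carrier -> 'rV[R]_n;
  param : chart -> 'rV[R]_n -> carrier;
  dom_open : forall c, open (dom c);
  dom_cover : forall p, exists c, dom c p;
  img_open : forall c, open (coord c @` dom c);
  coordK : forall c p, dom c p -> param c (coord c p) = p;
  coord_continuous : forall c p, dom c p -> {for p, continuous (coord c)};
  param_continuous : forall c x, (coord c @` dom c) x ->
    {for x, continuous (param c)};
  transition_smooth : forall c c',
    smooth_on (coord c @` (dom c `&` dom c')) (fun x => coord c' (param c x));
  manifold_hausdorff : hausdorff_space carrier;
  manifold_second_countable : @second_countable carrier;
  manifold_connected : connected [set: carrier]
}.

Section Geometry.
Context {R : realType} {n : nat}.
Implicit Type M : manifold R n.

Definition img M (c : chart M) : set 'rV[R]_n := coord c @` dom c.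

Definition overlap M (c c' : chart M) : set 'rV[R]_n :=
  coord c @` (dom c `&` dom c').

Definition transition M (c c' : chart M) : 'rV[R]_n -> 'rV[R]_n :=
  fun x => coord c' (param c x).

(* [metric_mx c x] is the Gram matrix of the coordinate frame of the chart c
   at the point with coordinates x. *)
Record riemannian_metric M : Type := RiemannianMetric {
  metric_mx :> chart M -> 'rV[R]_n -> 'M[R]_n;
  metric_smooth : forall c, smooth_on (img c) (metric_mx c);
  metric_sym : forall c x, img c x -> (metric_mx c x)^T = metric_mx c x;
  metric_pos : forall c x, img c x -> forall u : 'rV[R]_n, u != 0 ->
    0 < (u *m metric_mx c x *m u^T) 0 0;
  metric_transition : forall c c' x, overlap c c' x ->
    metric_mx c x = 'J (transition c c') x *m
      metric_mx c' (transition c c' x) *m ('J (transition c c') x)^T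
}.

(* [christoffel g c x k l m] is the coefficient of the k-th coordinate field
   in the Levi-Civita derivative of the m-th one along the l-th one. *)
Definition christoffel M (g : riemannian_metric M) (c : chart M)
    (x : 'rV[R]_n) (k l m : 'I_n) : R :=
  2^-1 * \sum_(p < n) invmx (g c x) k p *
    (partial l (g c) x m p + partial m (g c) x l p - partial p (g c) x l m).

(* Entry (i, k) is the k-th component of the image of the i-th coordinate
   field under the covariant derivative of J along the l-th one, where J is a
   field of endomorphisms in the coordinates of the chart c. *)
Definition nabla_endo M (g : riemannian_metric M) (c : chart M)
    (J : 'rV[R]_n -> 'M[R]_n) (l : 'I_n) (x : 'rV[R]_n) : 'M[R]_n :=
  \matrix_(i, k) (partial l J x i k
    + \sum_(m < n) J x i m * christoffel g c x k l m
    - \sum_(m < n) christoffel g c x m l i * J x m k).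

(* The manifold carries a smooth field J of orthogonal endomorphisms of the
   tangent spaces with J^2 = - id which is Levi-Civita parallel. *)
Definition kaehler M (g : riemannian_metric M) : Prop :=
  exists J : chart M -> 'rV[R]_n -> 'M[R]_n,
  [/\ forall c, smooth_on (img c) (J c),
      forall c c' x, overlap c c' x ->
        J c x *m 'J (transition c c') x =
        'J (transition c c') x *m J c' (transition c c' x),
      forall c x, img c x -> J c x *m J c x = - 1%:M,
      forall c x, img c x -> J c x *m g c x *m (J c x)^T = g c x &
      forall c x, img c x -> forall l, nabla_endo g c (J c) l x = 0].

Definition local_rep M (m : nat) (f : M -> 'rV[R]_m) (c : chart M) :
  'rV[R]_n -> 'rV[R]_m := fun x => f (param c x).

Definition immersion M (m : nat) (f : M -> 'rV[R]_m) : Prop :=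
  forall c : chart M, smooth_on (img c) (local_rep f c) /\
    forall x, img c x -> row_free ('J (local_rep f c) x).

Definition isometric_immersion M (g : riemannian_metric M) (m : nat)
    (f : M -> 'rV[R]_m) : Prop :=
  immersion f /\ forall (c : chart M) x, img c x ->
    g c x = 'J (local_rep f c) x *m ('J (local_rep f c) x)^T.

(* The second fundamental form on the i-th and j-th coordinate fields, by
   the Gauss formula: the derivative in R^m minus the image under f of the
   Levi-Civita derivative. *)
Definition second_fundamental_form M (g : riemannian_metric M) (m : nat)
    (f : M -> 'rV[R]_m) (c : chart M) (x : 'rV[R]_n) (i j : 'I_n) :
    'rV[R]_m :=
  partial i (partial j (local_rep f c)) x
  - \sum_(k < n) christoffel g c x k i j *: partial k (local_rep f c) x.

Definition mean_curvature_vector M (g : riemannian_metric M) (m : nat)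
    (f : M -> 'rV[R]_m) (c : chart M) (x : 'rV[R]_n) : 'rV[R]_m :=
  n%:R^-1 *: \sum_(i < n) \sum_(j < n)
    invmx (g c x) i j *: second_fundamental_form g f c x i j.

Definition mean_curvature M (g : riemannian_metric M) (m : nat)
    (f : M -> 'rV[R]_m) (c : chart M) (x : 'rV[R]_n) : R :=
  eucl_norm (mean_curvature_vector g f c x).

Definition constant_mean_curvature M (g : riemannian_metric M) (m : nat)
    (f : M -> 'rV[R]_m) : Prop :=
  exists H : R, forall (c : chart M) x, img c x -> mean_curvature g f c x = H.

Definition minimal M (g : riemannian_metric M) (m : nat)
    (f : M -> 'rV[R]_m) : Prop :=
  forall (c : chart M) x, img c x -> mean_curvature g f c x = 0.

End Geometry.

(* The map s x id on S x R^d, with values in R^m x R^d = R^(m + d). *)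
Definition cylinder (R : realType) (S : Type) (m d : nat) (s : S -> 'rV[R]_m) :
  S * 'rV[R]_d -> 'rV[R]_(m + d) := fun p => row_mx (s p.1) p.2.

(* The image of f is the image of an open subset W of the cylinder over s.
   Q is a linear isometry from R^3 x R^(n-2) to R^(n+1), onto for n >= 2:
   the orthogonal splitting of the ambient space need not be the one given by
   the standard coordinates. *)
Definition image_open_in_cylinder (R : realType) (n : nat) (M : Type)
    (S : topologicalType) (f : M -> 'rV[R]_n.+1) (s : S -> 'rV[R]_3) : Prop :=
  exists (Q : 'M[R]_(3 + (n - 2), n.+1)) (W : set (S * 'rV[R]_(n - 2))),
  [/\ Q *m Q^T = 1%:M, open W &
      range f = (fun p => cylinder s p *m Q) @` W].

(* Main.v *)
(* Suppose that f is not minimal. Let T and N be the tangent projection and the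
   unit normal, A the shape operator and J the complex structure, both extended
   by 0 to endomorphisms of R^(n+1); t = tr A is then a nonzero constant.
   As J is parallel, it commutes with the curvature operators, and contracting
   the Gauss equation yields A Q = t A for Q = A - J A J. Hence Q / t is a
   projection of rank 2, and K = T - Q / t is the projection onto the largest
   J-invariant subspace of the tangent space on which A vanishes.
   Differentiating A Q = t A and using the Codazzi equation and rank Q = 2, one
   finds that K has zero derivative except possibly where A = Q / 2; on an open
   set of such points the same equations force the derivative to vanish too. So
   K is constant on M: the image of 1 - K is a fixed copy of R^3 and, by the
   inverse function theorem, f(M) is locally the product of a ball of R^(n-2)
   with a graph in this R^3, of mean curvature |t| / 2.

   Countably many of these graphs suffice, and they can be listed along a walk
   in which consecutive ones overlap. They are glued along the walk into one
   connected Hausdorff surface, realized inside R^3 x R: each overlap contains a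
   small square through which one passes from a sheet to the next, the sheets
   being slit along the rest of its boundary. *)

Require Import Defs.
From HB Require Import structures.
From mathcomp Require Import all_boot all_order all_algebra.
From mathcomp Require Import all_classical all_reals all_analysis.
From mathcomp Require Import ring lra.
Set Implicit Arguments.
Unset Strict Implicit.
Unset Printing Implicit Defensive.
Import Order.TTheory GRing.Theory Num.Theory numFieldNormedType.Exports.
Local Open Scope classical_set_scope.
Local Open Scope ring_scope.

Local Notation coord := Defs.coord.

(** * Calculus of matrix-valued functions *)

Lemma near0_shift {R : realType} {V : normedModType R} (x : V) (A : set V) :
  nbhs x A -> \forall h \near (0 : V), A (h + x).
Proof.
have cs : (fun h : V => h + x) @ (0 : V) --> x.
  by rewrite -[X in _ --> X]add0r; apply: cvgD; [exact: cvg_id|exact: cvg_cst].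
exact: cs.
Qed.

Section Differentials.
Context {R : realType} {V W : normedModType R}.
Implicit Types (F G : V -> W) (x : V).

Lemma differentiable_littleo F x : differentiable F x ->
  forall e, 0 < e -> \forall h \near (0 : V),
    `|F (h + x) - F x - 'd F x h| <= e * `|h|.
Proof.
move=> /diff_locallyP[_ /eqaddoP dF] e e0; have := dF e e0.
by apply: filterS => h /=; rewrite opprD addrA.
Qed.

Lemma littleo_differentiable F x (L : {linear V -> W}) : continuous L ->
  (forall e, 0 < e -> \forall h \near (0 : V),
    `|F (h + x) - F x - L h| <= e * `|h|) ->
  differentiable F x /\ 'd F x = L :> (V -> W).
Proof.
move=> cL FL.
have E : F \o shift x = cst (F x) + L +o_ (0 : V) id.
  apply/eqaddoP => e e0; have := FL e e0; apply: filterS => h /=.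
  by rewrite /= opprD addrA.
have dE := diff_unique cL E; split => //.
by apply/diff_locallyP; rewrite dE.
Qed.

Lemma near_eq_differentiable F G x :
  (\near x, F x = G x) -> differentiable F x -> differentiable G x.
Proof.
move=> FG dF.
have FGx : F x = G x by exact: nbhs_singleton FG.
have cd : continuous ('d F x) by exact: diff_continuous.
suff [] : differentiable G x /\ 'd G x = 'd F x :> (V -> W) by [].
apply: littleo_differentiable => // e e0.
have {}FG : \forall h \near (0 : V), F (h + x) = G (h + x).
  exact: near0_shift FG.
have := differentiable_littleo dF e0; move: FG; apply: filterS2 => h <-.
by rewrite FGx.
Qed.

End Differentials.

Lemma cvg_sumr {R : numFieldType} {V : normedModType R} (T I : Type)
    (F : set_system T) {FF : Filter F} (r : seq I) (P : pred I)
    (f : I -> T -> V) (a : I -> V) :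
  (forall i, f i x @[x --> F] --> a i) ->
  (\sum_(i <- r | P i) f i x) @[x --> F] --> \sum_(i <- r | P i) a i.
Proof.
move=> fa; elim: r => [|i r IHr].
  by under eq_fun do rewrite big_nil; rewrite big_nil; exact: cvg_cst.
rewrite big_cons; under eq_fun do rewrite big_cons; case: ifP => _ //.
exact: cvgD.
Qed.

Section MatrixFunctions.
Context {R : realType} {V : normedModType R}.

Lemma mx_differentiableP m n (F : V -> 'M[R]_(m, n)) x :
  differentiable F x <-> forall i j, differentiable (fun y => F y i j) x.
Proof.
split=> [dF i j|dF].
  exact: (@differentiable_comp _ _ _ _ F (fun N => N i j)) dF (differentiable_coord _ _ _).
have -> : F = \sum_(i < m) \sum_(j < n) (fun y => F y i j *: delta_mx i j).
  apply/funext => y; rewrite fct_sumE [LHS]matrix_sum_delta.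
  by apply: eq_bigr => i _; rewrite fct_sumE.
apply: differentiable_sum => i; apply: differentiable_sum => j.
exact: differentiableZl.
Qed.

Lemma mx_continuousP m n (F : V -> 'M[R]_(m, n)) x :
  {for x, continuous F} <-> forall i j, {for x, continuous (fun y => F y i j)}.
Proof.
split=> [cF i j|cF].
  apply: (@continuous_comp _ _ _ F (fun N : 'M[R]_(m, n) => N i j)) => //.
  exact: coord_continuous.
have -> : F = (fun y => \sum_(i < m) \sum_(j < n) F y i j *: delta_mx i j).
  by apply/funext => y; rewrite [LHS]matrix_sum_delta.
apply: cvg_sumr => i; apply: cvg_sumr => j.
by apply: cvgZ; [exact: cF|exact: cvg_cst].
Qed.

Lemma is_derive_mxP m n (F : V -> 'M[R]_(m, n)) x v dF :
  is_derive x v F dF <-> forall i j, is_derive x v (fun y => F y i j) (dF i j).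
Proof.
split=> [[dv <-] i j|hF].
  have /derivable_mxP dv' := dv.
  by apply: DeriveDef => //; rewrite derive_mx// mxE.
have dv : derivable F x v by apply/derivable_mxP => i j; case: (hF i j).
apply: DeriveDef => //; rewrite derive_mx//; apply/matrixP => i j.
by rewrite mxE; case: (hF i j).
Qed.

Lemma is_derive_mulmx m n p (F : V -> 'M[R]_(m, n)) (G : V -> 'M[R]_(n, p))
    x v dF dG : is_derive x v F dF -> is_derive x v G dG ->
  is_derive x v (fun y => F y *m G y) (dF *m G x + F x *m dG).
Proof.
move=> /is_derive_mxP hF /is_derive_mxP hG; apply/is_derive_mxP => i j.
have -> : (fun y => (F y *m G y) i j) =
    \sum_(k < n) ((fun y => F y i k) * (fun y => G y k j)).
  by apply/funext => y; rewrite mxE fct_sumE.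
rewrite !mxE -big_split/=.
have H : is_derive x v (\sum_(k < n) ((fun y => F y i k) * (fun y => G y k j)))
    (\sum_(k < n) (F x i k *: dG k j + G x k j *: dF i k)).
  by apply: is_derive_sum => k; apply: is_deriveM.
apply: (is_derive_eq H).
by apply: eq_bigr => k _; rewrite addrC; congr (_ + _); exact: mulrC.
Qed.

Lemma is_derive_trmx m n (F : V -> 'M[R]_(m, n)) x v dF :
  is_derive x v F dF -> is_derive x v (fun y => (F y)^T) dF^T.
Proof.
move=> /is_derive_mxP hF; apply/is_derive_mxP => i j.
by rewrite mxE; have -> : (fun y => (F y)^T i j) = (fun y => F y j i)
  by apply/funext => y; rewrite mxE.
Qed.

End MatrixFunctions.

Section Smoothness.
Context {R : realType}.

Section General.
Context {V : normedModType R} {n : nat}.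
Implicit Types (U : set 'rV[R]_n) (F G : 'rV[R]_n -> V).

Lemma Ck_ext k U F G : open U -> {in U, F =1 G} -> Ck k U F -> Ck k U G.
Proof.
move=> oU; elim: k F G => [|k IHk] F G FG /=.
  move=> cF x Ux; have nFG : \forall y \near x, F y = G y.
    by apply: filterS (open_nbhs_nbhs (conj oU Ux)) => y Uy; apply: FG; rewrite inE.
  change (G @ x --> G x); rewrite -(FG x) ?inE//.
  exact: cvg_trans (near_eq_cvg nFG) (cF x Ux).
move=> [dF CF]; have nFG x : U x -> \forall y \near x, F y = G y.
  move=> Ux; apply: filterS (open_nbhs_nbhs (conj oU Ux)) => y Uy.
  by apply: FG; rewrite inE.
split=> [x Ux|v]; first exact: near_eq_differentiable (nFG x Ux) (dF x Ux).
apply: IHk (CF v) => x; rewrite inE => Ux.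
exact/near_eq_derive/nFG.
Qed.

Lemma smooth_ext U F G : open U -> {in U, F =1 G} ->
  smooth_on U F -> smooth_on U G.
Proof. by move=> oU FG sF k; exact: Ck_ext (sF k). Qed.

Lemma Ck_subset k U U' F : U' `<=` U -> Ck k U F -> Ck k U' F.
Proof.
move=> sU; elim: k F => [|k IHk] F /=; first by move=> cF x /sU; exact: cF.
by move=> [dF CF]; split => [x /sU|v]; [exact: dF|exact: IHk].
Qed.

Lemma smooth_subset U U' F : U' `<=` U -> smooth_on U F -> smooth_on U' F.
Proof. by move=> sU sF k; exact: Ck_subset (sF k). Qed.

Lemma CkS k U F : Ck k.+1 U F <->
  (forall x, U x -> differentiable F x) /\ forall v, Ck k U (fun x => 'D_v F x).
Proof. by []. Qed.

Lemma CkW k U F : Ck k.+1 U F -> Ck k U F.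
Proof.
elim: k F => [|k IHk] F [dF CF].
  by move=> x Ux; exact: differentiable_continuous (dF x Ux).
by split => // v; exact: IHk (CF v).
Qed.

Lemma smooth_differentiable U F x : smooth_on U F -> U x -> differentiable F x.
Proof. by move=> sF Ux; case: (sF 1%N) => + _; exact. Qed.

Lemma smooth_derive U F v : smooth_on U F -> smooth_on U (fun x => 'D_v F x).
Proof. by move=> sF k; case: (sF k.+1) => _; exact. Qed.

Lemma smooth_continuous U F x : smooth_on U F -> U x -> {for x, continuous F}.
Proof. by move=> sF; exact: (sF 0%N). Qed.

Lemma smooth_is_derive U F x v : smooth_on U F -> U x ->
  is_derive x v F ('D_v F x).
Proof.
move=> sF Ux; apply: derivableP.
exact/diff_derivable/(smooth_differentiable sF).
Qed.

Lemma Ck_cst k U (a : V) : Ck k U (fun=> a).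
Proof.
elim: k a => [|k IHk] a /=; first by move=> x _; exact: cst_continuous.
split=> [x _|v]; first exact: differentiable_cst.
have -> : (fun x => 'D_v (fun=> a) x) = (fun=> 0 : V).
  by apply/funext => x; rewrite derive_cst.
exact: IHk.
Qed.

Lemma CkD k U F G : open U -> Ck k U F -> Ck k U G ->
  Ck k U (fun x => F x + G x).
Proof.
move=> oU; elim: k F G => [|k IHk] F G /=.
  by move=> cF cG x Ux; exact: (cvgD (cF x Ux) (cG x Ux)).
move=> [dF CF] [dG CG]; split => [x Ux|v].
  exact: (@differentiableD _ _ _ F G x (dF x Ux) (dG x Ux)).
apply: Ck_ext (IHk _ _ (CF v) (CG v)) => // x; rewrite inE => Ux.
by rewrite -deriveD//; apply: diff_derivable; [exact: dF|exact: dG].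
Qed.

Lemma Ck_sum k U (I : Type) (r : seq I) (P : pred I) (F : I -> 'rV[R]_n -> V) :
  open U -> (forall i, Ck k U (F i)) ->
  Ck k U (fun x => \sum_(i <- r | P i) F i x).
Proof.
move=> oU CF; elim: r => [|i r IHr].
  by under eq_fun do rewrite big_nil; exact: Ck_cst.
have [Pi|Pi] := boolP (P i).
  under eq_fun do rewrite big_cons Pi.
  exact: CkD.
by under eq_fun do rewrite big_cons (negPf Pi).
Qed.

Lemma derive_coordE F x v : differentiable F x ->
  'D_v F x = \sum_(i < n) v 0 i *: 'D_(delta_mx 0 i) F x.
Proof.
move=> dF; rewrite deriveE// {1}(row_sum_delta v) linear_sum/=.
by apply: eq_bigr => i _; rewrite linearZ/= deriveE.
Qed.

End General.
End Smoothness.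

Section SmoothAlgebra.
Context {R : realType} {n : nat}.
Implicit Types (U : set 'rV[R]_n).

Lemma CkM k U (f g : 'rV[R]_n -> R) : open U -> Ck k U f -> Ck k U g ->
  Ck k U (fun x => f x * g x).
Proof.
move=> oU; elim: k f g => [|k IHk] f g Cf Cg.
  by move=> x Ux; exact: (cvgM (Cf x Ux) (Cg x Ux)).
have [Cf' Cg'] := (CkW Cf, CkW Cg); move: Cf Cg => /CkS[df Cf] /CkS[dg Cg].
split=> [x Ux|v]; first exact: (differentiableM (df x Ux) (dg x Ux)).
apply: (@Ck_ext _ _ _ _ _ (fun x => f x * 'D_v g x + g x * 'D_v f x)) => //.
  move=> x; rewrite inE => Ux.
  rewrite [RHS](@deriveM _ _ f g)//; apply: diff_derivable; [exact: df|exact: dg].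
by apply: CkD => //; apply: IHk.
Qed.

Lemma CkN (V : normedModType R) k U (F : 'rV[R]_n -> V) :
  open U -> Ck k U F -> Ck k U (fun x => - F x).
Proof.
move=> oU; elim: k F => [|k IHk] F.
  by move=> CF x Ux; exact: (cvgN (CF x Ux)).
move=> [dF CF]; split=> [x Ux|v]; first exact: (differentiableN (dF x Ux)).
apply: Ck_ext (IHk _ (CF v)) => // x; rewrite inE => Ux.
by rewrite [RHS](@deriveN _ _ _ F)//; exact/diff_derivable/dF.
Qed.

Lemma CkV k U (f : 'rV[R]_n -> R) : open U -> (forall x, U x -> f x != 0) ->
  Ck k U f -> Ck k U (fun x => (f x)^-1).
Proof.
move=> oU f0; elim: k => [|k IHk] Cf.
  by move=> x Ux; exact: (cvgV (f0 x Ux) (Cf x Ux)).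
have Cf' := CkW Cf; move: Cf => /CkS[df Cf].
split=> [x Ux|v]; first exact: (differentiableV (df x Ux) (f0 x Ux)).
apply: (@Ck_ext _ _ _ _ _ (fun x => - ((f x)^-1 * (f x)^-1 * 'D_v f x))) => //.
  move=> x; rewrite inE => Ux.
  rewrite [RHS](@deriveV _ _ f)//; last exact/diff_derivable/df.
    by rewrite -exprVn expr2 scaleNr.
  exact: f0.
by apply: CkN => //; apply: CkM => //; apply: CkM => //; exact: IHk.
Qed.

Lemma Ck_prod k U (I : Type) (r : seq I) (P : pred I) (f : I -> 'rV[R]_n -> R) :
  open U -> (forall i, Ck k U (f i)) -> Ck k U (fun x => \prod_(i <- r | P i) f i x).
Proof.
move=> oU Cf; elim: r => [|i r IHr].
  by under eq_fun do rewrite big_nil; exact: Ck_cst.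
have [Pi|Pi] := boolP (P i).
  by under eq_fun do rewrite big_cons Pi; exact: CkM.
by under eq_fun do rewrite big_cons (negPf Pi).
Qed.

Lemma Ck_mxP k U p q (F : 'rV[R]_n -> 'M[R]_(p, q)) : open U ->
  Ck k U F <-> forall i j, Ck k U (fun x => F x i j).
Proof.
move=> oU; elim: k F => [|k IHk] F.
  split=> CF; first by move=> i j x Ux; move/mx_continuousP: (CF x Ux); exact.
  by move=> x Ux; apply/mx_continuousP => i j; exact: CF.
split=> [/CkS[dF CF] i j|CF].
  split=> [x Ux|v]; first by move/mx_differentiableP: (dF x Ux).
  have /IHk/(_ i j) := CF v.
  apply: Ck_ext => // x; rewrite inE => Ux.
  by rewrite derive_mx ?mxE//; exact/diff_derivable/dF.
have dF x : U x -> differentiable F x.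
  by move=> Ux; apply/mx_differentiableP => i j; case: (CF i j) => + _; exact.
split=> // v; apply/IHk => i j; have [_ /(_ v)] := CF i j.
apply: Ck_ext => // x; rewrite inE => Ux.
by rewrite derive_mx ?mxE//; exact/diff_derivable/dF.
Qed.

Lemma smooth_mxP U p q (F : 'rV[R]_n -> 'M[R]_(p, q)) : open U ->
  smooth_on U F <-> forall i j, smooth_on U (fun x => F x i j).
Proof.
move=> oU; split=> [sF i j k|sF k]; first exact: ((Ck_mxP k F oU).1 (sF k)).
by apply/(Ck_mxP k F oU) => i j; exact: sF.
Qed.

Lemma Ck_mulmx k U p q r (F : 'rV[R]_n -> 'M[R]_(p, q)) (G : 'rV[R]_n -> 'M[R]_(q, r)) :
  open U -> Ck k U F -> Ck k U G -> Ck k U (fun x => F x *m G x).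
Proof.
move=> oU /(Ck_mxP _ _ oU) CF /(Ck_mxP _ _ oU) CG; apply/Ck_mxP => // i j.
by under eq_fun do rewrite mxE; apply: Ck_sum => // l; exact: CkM.
Qed.

Lemma smooth_mulmx U p q r (F : 'rV[R]_n -> 'M[R]_(p, q))
    (G : 'rV[R]_n -> 'M[R]_(q, r)) :
  open U -> smooth_on U F -> smooth_on U G -> smooth_on U (fun x => F x *m G x).
Proof. by move=> oU sF sG k; exact: Ck_mulmx. Qed.

Lemma smooth_trmx U p q (F : 'rV[R]_n -> 'M[R]_(p, q)) :
  open U -> smooth_on U F -> smooth_on U (fun x => (F x)^T).
Proof.
move=> oU /(smooth_mxP _ oU) sF; apply/(smooth_mxP _ oU) => i j.
by under eq_fun do rewrite mxE; exact: sF.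
Qed.

Lemma smoothD (V : normedModType R) U (F G : 'rV[R]_n -> V) :
  open U -> smooth_on U F -> smooth_on U G -> smooth_on U (fun x => F x + G x).
Proof. by move=> oU sF sG k; exact: CkD. Qed.

Lemma smoothN (V : normedModType R) U (F : 'rV[R]_n -> V) :
  open U -> smooth_on U F -> smooth_on U (fun x => - F x).
Proof. by move=> oU sF k; exact: CkN. Qed.

Lemma smooth_cst (V : normedModType R) U (a : V) : smooth_on U (fun=> a).
Proof. by move=> k; exact: Ck_cst. Qed.

Lemma Ck_det k U q (F : 'rV[R]_n -> 'M[R]_q) :
  open U -> Ck k U F -> Ck k U (fun x => \det (F x)).
Proof.
move=> oU /(Ck_mxP _ _ oU) CF; rewrite /determinant.
apply: Ck_sum => // s; apply: CkM => //; first exact: Ck_cst.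
by apply: Ck_prod => // i; exact: CF.
Qed.

Lemma Ck_invmx k U q (F : 'rV[R]_n -> 'M[R]_q) : open U ->
  (forall x, U x -> F x \in unitmx) -> Ck k U F -> Ck k U (fun x => invmx (F x)).
Proof.
move=> oU uF CF.
apply: (@Ck_ext _ _ _ _ _ (fun x => (\det (F x))^-1 *: \adj (F x))) => //.
  by move=> x; rewrite inE => Ux; rewrite /invmx uF.
apply/(Ck_mxP _ _ oU) => i j; under eq_fun do rewrite !mxE /cofactor.
apply: CkM => //.
  apply: CkV => //; last exact: Ck_det.
  by move=> x Ux; rewrite -unitfE -unitmxE; exact: uF.
apply: CkM => //; first exact: Ck_cst.
apply: Ck_det => //; apply/(Ck_mxP _ _ oU) => a b.
by under eq_fun do rewrite !mxE; move/(Ck_mxP _ _ oU): CF; exact.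
Qed.

Lemma smooth_invmx U q (F : 'rV[R]_n -> 'M[R]_q) : open U ->
  (forall x, U x -> F x \in unitmx) -> smooth_on U F ->
  smooth_on U (fun x => invmx (F x)).
Proof. by move=> oU uF sF k; exact: Ck_invmx. Qed.

Lemma smooth_linear p (L : 'M[R]_(n, p)) U : smooth_on U (fun x => x *m L).
Proof.
suff sT : smooth_on setT (fun x : 'rV[R]_n => x *m L) by exact: smooth_subset sT.
pose Ll : {linear 'rV[R]_n -> 'rV[R]_p} := mulmxr L.
have cL : continuous Ll.
  move=> x; apply/mx_continuousP => i j.
  have -> : (fun y : 'rV[R]_n => Ll y i j) = (fun y => \sum_k y i k * L k j).
    by apply/funext => y; rewrite /Ll/= mxE.
  apply: (@cvg_sumr _ _ _ _ (nbhs x)) => k.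
  apply: cvgM; last exact: cvg_cst.
  exact: coord_continuous.
have dL x : differentiable Ll x by exact: linear_differentiable.
case=> [|k]; first by move=> x _; exact: cL.
split=> [x _|v]; first exact: dL.
have -> : (fun x => 'D_v (fun y : 'rV[R]_n => y *m L) x) = (fun=> v *m L).
  apply/funext => x; rewrite (deriveE _ (dL x)).
  by rewrite (diff_lin x cL).
exact: Ck_cst.
Qed.

Lemma is_derive_linear p (L : 'M[R]_(n, p)) (x v : 'rV[R]_n) :
  is_derive x v (fun y => y *m L) (v *m L).
Proof.
have -> : v *m L = v *m L + x *m 0 by rewrite mulmx0 addr0.
apply: (@is_derive_mulmx _ _ _ _ _ id (fun=> L)).
Qed.

End SmoothAlgebra.

Section Composition.
Context {R : realType} {n m : nat}.
Implicit Types (U : set 'rV[R]_n).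

Lemma is_derive_comp (V : normedModType R) (F : 'rV[R]_m -> V)
    (G : 'rV[R]_n -> 'rV[R]_m) x v : differentiable G x ->
  differentiable F (G x) -> is_derive x v (F \o G) ('D_('D_v G x) F (G x)).
Proof.
move=> dG dF; have dFG := differentiable_comp dG dF.
apply: DeriveDef; first exact: diff_derivable.
by rewrite !deriveE// diff_comp.
Qed.

Lemma Ck_comp k U (U' : set 'rV[R]_m) (F : 'rV[R]_m -> R)
    (G : 'rV[R]_n -> 'rV[R]_m) : open U -> (forall x, U x -> U' (G x)) ->
  Ck k U' F -> Ck k U G -> Ck k U (F \o G).
Proof.
move=> oU UU'; elim: k F => [|k IHk] F CF CG.
  by move=> x Ux; apply: continuous_comp; [exact: CG|exact/CF/UU'].
have CG' := CkW CG; move: CF CG => /CkS[dF CF] /CkS[dG CG].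
split=> [x Ux|v].
  by apply: differentiable_comp; [exact: dG|exact/dF/UU'].
apply: (@Ck_ext _ _ _ _ _ (fun x =>
    \sum_(i < m) 'D_v G x 0 i * ('D_(delta_mx 0 i) F \o G) x)) => //.
  move=> x; rewrite inE => Ux; have Ux' := UU' _ Ux.
  have [_ ->] := is_derive_comp v (dG x Ux) (dF _ Ux').
  by rewrite (derive_coordE _ (dF _ Ux')).
apply: Ck_sum => // i; apply: CkM => //.
  by have /(Ck_mxP _ _ oU) := CG v; exact.
exact: IHk.
Qed.

Lemma smooth_comp p q U (U' : set 'rV[R]_m) (F : 'rV[R]_m -> 'M[R]_(p, q))
    (G : 'rV[R]_n -> 'rV[R]_m) : open U -> open U' ->
  (forall x, U x -> U' (G x)) -> smooth_on U' F -> smooth_on U G ->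
  smooth_on U (F \o G).
Proof.
move=> oU oU' UU' /(smooth_mxP _ oU') sF sG; apply/(smooth_mxP _ oU) => i j k.
by apply: (Ck_comp (F := fun x => F x i j) (U' := U')) => //; exact: sF.
Qed.

End Composition.

Section Jacobian.
Context {R : realType} {n m : nat}.
Implicit Types (U : set 'rV[R]_n) (F : 'rV[R]_n -> 'rV[R]_m).

Lemma row_jacobian F x i : differentiable F x -> row i ('J F x) = partial i F x.
Proof. by move=> dF; rewrite /partial deriveEjacobian// rowE. Qed.

Lemma smooth_jacobian U F : open U -> smooth_on U F -> smooth_on U (jacobian F).
Proof.
move=> oU sF; apply/(smooth_mxP _ oU) => i j.
have /(smooth_mxP _ oU)/(_ 0 j) := smooth_derive (delta_mx 0 i) sF.
apply: smooth_ext => // x; rewrite inE => Ux.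
have dF := smooth_differentiable sF Ux.
by rewrite -[LHS]/(partial i F x 0 j) -row_jacobian// mxE.
Qed.

Lemma derive_jacobian U F x v : open U -> smooth_on U F -> U x ->
  is_derive x v (jacobian F) (\matrix_i 'D_v (partial i F) x).
Proof.
move=> oU sF Ux; apply/is_derive_mxP => i j; rewrite mxE.
have sP : smooth_on U (partial i F) := smooth_derive _ sF.
have /is_derive_mxP/(_ 0 j) := smooth_is_derive v sP Ux.
apply: near_eq_is_derive; apply: filterS (open_nbhs_nbhs (conj oU Ux)) => y Uy.
by rewrite -row_jacobian ?mxE//; exact: smooth_differentiable Uy.
Qed.

End Jacobian.

Section Lines.
Context {R : realType} {V : normedModType R}.

Lemma is_derive_line (W : normedModType R) (F : V -> W) (c v : V) (s : R) :
  differentiable F (c + s *: v) ->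
  is_derive s 1 (fun s : R => F (c + s *: v)) ('D_v F (c + s *: v)).
Proof.
move=> dF.
have dl : is_diff s (fun s : R => c + s *: v) (fun h : R => h *: v).
  have H := is_diffD (is_diff_cst c s) (is_diff_scalel s v).
  by move: H; rewrite add0r.
have dl1 : differentiable (fun s : R => c + s *: v) s by case: dl.
apply: DeriveDef.
  exact/diff_derivable/(@differentiable_comp _ _ _ _ (fun s : R => c + s *: v) F).
rewrite (_ : (fun s : R => F (c + s *: v)) = F \o (fun s : R => c + s *: v))//.
rewrite deriveE; last exact: differentiable_comp.
by rewrite diff_comp//= diff_val scale1r deriveE.
Qed.

Lemma line_MVT (f : V -> R) (c v : V) (b : R) : 0 < b ->
  (forall s, 0 <= s <= b -> differentiable f (c + s *: v)) ->
  exists2 s, 0 < s < b & f (c + b *: v) - f c = b * 'D_v f (c + s *: v).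
Proof.
move=> b0 df.
have [||s sab E] := @MVT R (fun s => f (c + s *: v)) (fun s => 'D_v f (c + s *: v))
  0 b b0.
- move=> s; rewrite in_itv/= => /andP[s0 sb].
  by apply: is_derive_line; apply: df; rewrite !ltW.
- apply/continuous_in_subspaceT => s; rewrite inE/= in_itv/= => sb.
  have [ds _] := is_derive_line (df s sb).
  exact/differentiable_continuous/derivable1_diffP.
exists s; first by move: sab; rewrite in_itv.
by move: E; rewrite scale0r addr0 subr0 mulrC.
Qed.

Lemma translate_differentiable (W : normedModType R) (F : V -> W) (c x : V) :
  differentiable F (x + c) -> differentiable (fun z => F (z + c)) x.
Proof.
by move=> dF; exact: (@differentiable_comp _ _ _ _ (fun z => z + c) F).
Qed.

Lemma derive_translate (W : normedModType R) (F : V -> W) (c x v : V) :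
  'D_v (fun z => F (z + c)) x = 'D_v F (x + c).
Proof.
rewrite /derive.
rewrite (_ : (fun h => h^-1 *: (((fun z => F (z + c)) \o shift x) (h *: v) - _)) =
  (fun h : R => h^-1 *: ((F \o shift (x + c)) (h *: v) - F (x + c))))//.
by apply/funext => h /=; rewrite addrA.
Qed.

Lemma second_difference (f : V -> R) (x v w : V) (d h : R) :
  (forall y, `|x - y| < d -> differentiable f y) ->
  (forall y, `|x - y| < d -> differentiable (fun z => 'D_v f z) y) -> 0 < h ->
  h * (`|v| + `|w|) < d ->
  exists2 y, `|x - y| < d &
    f (x + h *: v + h *: w) - f (x + h *: v) - f (x + h *: w) + f x
      = h * (h * 'D_w (fun z => 'D_v f z) y).
Proof.
move=> df dfv h0 hd.
have inU s t : 0 <= s <= h -> 0 <= t <= h -> `|x - (x + s *: v + t *: w)| < d.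
  move=> /andP[s0 sh] /andP[t0 th]; apply: le_lt_trans hd.
  rewrite !opprD !addrA subrr add0r -opprD normrN (le_trans (ler_normD _ _))//.
  by rewrite !normrZ !ger0_norm// mulrDr lerD// ler_wpM2r.
have h00 : 0 <= (0 : R) <= h by rewrite lexx ltW.
have hh : 0 <= h <= h by rewrite lexx ltW.
pose a z := f (z + h *: w) - f z.
have d1 s : 0 <= s <= h -> differentiable (fun z => f (z + h *: w)) (x + s *: v).
  by move=> sh; apply: translate_differentiable; exact/df/inU.
have d2 s : 0 <= s <= h -> differentiable f (x + s *: v).
  by move=> sh; apply: df; have := inU _ _ sh h00; rewrite scale0r addr0.
have da s : 0 <= s <= h ->
    'D_v a (x + s *: v) = 'D_v f (x + s *: v + h *: w) - 'D_v f (x + s *: v).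
  move=> sh; have := @diff_derivable _ _ _ _ _ v (d1 s sh); have := @diff_derivable _ _ _ _ _ v (d2 s sh).
  by move=> D2 D1; rewrite (deriveB D1 D2) derive_translate.
have dfa s : 0 <= s <= h -> differentiable a (x + s *: v).
  by move=> sh; exact: (differentiableB (d1 s sh) (d2 s sh)).
have [s sh Ea] := line_MVT h0 dfa.
have sh' : 0 <= s <= h by case/andP: sh => ? ?; rewrite !ltW.
have [t th Eb] := line_MVT h0 (fun t th => dfv _ (inU s t sh' th)).
exists (x + s *: v + t *: w).
  by apply: inU => //; case/andP: th => ? ?; rewrite !ltW.
rewrite -Eb -(da s sh') -Ea /a.
by rewrite opprB addrA addrAC.
Qed.

Let derive_commute_aux (U : set V) (f A B : V -> R) (x v w : V) : open U ->
  (forall y, U y -> differentiable f y) ->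
  (forall y, U y -> differentiable (fun z => 'D_v f z) y) ->
  (forall y, U y -> differentiable (fun z => 'D_w f z) y) ->
  (forall y, 'D_v (fun y => 'D_w f y) y = A y) ->
  (forall y, 'D_w (fun y => 'D_v f y) y = B y) ->
  {for x, continuous A} -> {for x, continuous B} -> U x -> A x = B x.
Proof.
move=> oU df dfv dfw DA DB C1 C2 Ux.
apply/eqP; rewrite -subr_eq0 -normr_le0; apply/ler_addgt0Pr => e e0.
rewrite add0r; have e20 : 0 < e / 2 by rewrite divr_gt0.
have /nbhs_ballP[d /= d0 xd] : nbhs x [set y | [/\ U y,
    `|A x - A y| < e / 2 & `|B x - B y| < e / 2]].
  have N0 := open_nbhs_nbhs (conj oU Ux).
  move/cvgrPdist_lt: C1 => /(_ _ e20); move/cvgrPdist_lt: C2 => /(_ _ e20).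
  by move: N0; apply: filterS3.
have xd' y : `|x - y| < d -> [/\ U y, `|A x - A y| < e / 2 & `|B x - B y| < e / 2].
  by move=> xy; apply: xd; rewrite -ball_normE.
have dU y : `|x - y| < d -> U y by move=> /xd'[].
pose h := d / 2 / (1 + (`|v| + `|w|)).
have s0 : 0 < 1 + (`|v| + `|w|) by rewrite ltr_pwDl// addr_ge0.
have h0 : 0 < h by rewrite !divr_gt0.
have hd : h * (`|v| + `|w|) < d.
  rewrite /h mulrAC ltr_pdivrMr// -mulrA ltr_pM2l// mulrC ltr_pdivrMr//.
  have : 0 <= `|v| + `|w| by rewrite addr_ge0.
  by move=> ?; lra.
have hd' : h * (`|w| + `|v|) < d by rewrite [`|w| + _]addrC.
have df' y : `|x - y| < d -> differentiable f y by move=> /dU/df.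
have dfv' y : `|x - y| < d -> differentiable (fun z => 'D_v f z) y by move=> /dU/dfv.
have dfw' y : `|x - y| < d -> differentiable (fun z => 'D_w f z) y by move=> /dU/dfw.
have [y xy] := second_difference df' dfv' h0 hd; rewrite DB => Ey.
have [z xz] := second_difference df' dfw' h0 hd'; rewrite DA => Ez.
have : h * (h * B y) = h * (h * A z).
  rewrite -Ey -Ez; congr (_ + _); rewrite -!addrA; congr (f _ + _).
    by rewrite [h *: w + _]addrC.
  by rewrite addrC.
move/(mulfI (lt0r_neq0 h0))/(mulfI (lt0r_neq0 h0)) => E.
have [_ _ Hy] := xd' _ xy; have [_ Hz _] := xd' _ xz.
rewrite -E in Hz; rewrite (splitr e).
rewrite (_ : A x - B x = (A x - B y) - (B x - B y)).
  by rewrite (le_trans (ler_normB _ _))// lerD// ltW.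
by rewrite opprB addrA subrK.
Qed.

Lemma derive_commute (U : set V) (f : V -> R) (x v w : V) : open U ->
  (forall y, U y -> differentiable f y) ->
  (forall y, U y -> differentiable (fun z => 'D_v f z) y) ->
  (forall y, U y -> differentiable (fun z => 'D_w f z) y) ->
  {for x, continuous (fun y => 'D_v (fun y => 'D_w f y) y)} ->
  {for x, continuous (fun y => 'D_w (fun y => 'D_v f y) y)} -> U x ->
  'D_v (fun y => 'D_w f y) x = 'D_w (fun y => 'D_v f y) x.
Proof. by move=> oU df dfv dfw; exact: (derive_commute_aux oU df dfv dfw). Qed.

End Lines.

Section Schwarz.
Context {R : realType} {n : nat}.
Implicit Types (U : set 'rV[R]_n).

Lemma Schwarz U (f : 'rV[R]_n -> R) x v w : open U -> Ck 2 U f -> U x ->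
  'D_v (fun y => 'D_w f y) x = 'D_w (fun y => 'D_v f y) x.
Proof.
move=> oU /CkS[df Cf] Ux.
have [/CkS[dv Cv] /CkS[dw Cw]] := (Cf v, Cf w).
exact: (derive_commute oU df dv dw (Cw v x Ux) (Cv w x Ux) Ux).
Qed.

Lemma Schwarz_mx U p q (F : 'rV[R]_n -> 'M[R]_(p, q)) x v w : open U ->
  smooth_on U F -> U x ->
  'D_v (fun y => 'D_w F y) x = 'D_w (fun y => 'D_v F y) x.
Proof.
move=> oU sF Ux.
have H a b i j : ('D_a (fun y => 'D_b F y) x) i j
    = 'D_a (fun y => 'D_b (fun z => F z i j) y) x.
  have sD : smooth_on U (fun y => 'D_b F y) := smooth_derive b sF.
  rewrite derive_mx; last by case: (smooth_is_derive a sD Ux).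
  rewrite mxE; apply: near_eq_derive.
  apply: filterS (open_nbhs_nbhs (conj oU Ux)) => y Uy.
  by rewrite derive_mx ?mxE//; case: (smooth_is_derive b sF Uy).
apply/matrixP => i j; have sFij := (smooth_mxP F oU).1 sF i j.
exact: (etrans (H v w i j) (etrans (Schwarz v w oU (sFij 2%N) Ux)
  (esym (H w v i j)))).
Qed.

End Schwarz.

(** * The inverse function theorem *)

HB.instance Definition _ (R : realType) (m n : nat) := Complete.on 'M[R]_(m, n).

Section Perturbation.
Context {R : realType} {V : completeNormedModType R}.
Variables (P : V -> V) (x0 : V) (r : R).
Hypothesis r_gt0 : 0 < r.
Hypothesis P_near_id : forall x y, `|x - x0| <= r -> `|y - x0| <= r ->
  `|(x - P x) - (y - P y)| <= 2^-1 * `|x - y|.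

Lemma perturbation_expanding x y : `|x - x0| <= r -> `|y - x0| <= r ->
  `|x - y| <= 2 * `|P x - P y|.
Proof.
move=> xr yr; have := P_near_id xr yr.
have : `|x - y| <= `|(x - P x) - (y - P y)| + `|P x - P y|.
  apply: le_trans (ler_normD _ _); rewrite le_eqVlt; apply/orP; left; apply/eqP.
  congr `|_|; have -> : x - P x - (y - P y) = x - y - (P x - P y).
    by rewrite !opprD !opprK addrACA.
  by rewrite subrK.
set a := `|x - y|; set b := `|P x - P y|; set c := `|_ - _| => H1 H2; lra.
Qed.

Lemma perturbation_onto w : `|w - P x0| < r / 2 ->
  exists2 x, `|x - x0| < r & P x = w.
Proof.
move=> wr; pose U := [set x : V | `|x - x0| <= r].
pose T x := w + (x - P x).
have x0r : `|x0 - x0| <= r by rewrite subrr normr0 ltW.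
have TU : {homo T : x / U x >-> U x}.
  move=> x /= xr; rewrite /U/= /T.
  have -> : w + (x - P x) - x0 = (w - P x0) + ((x - P x) - (x0 - P x0)).
    by rewrite opprB addrACA [- P x0 + _]addrA addNr add0r addrA.
  rewrite (le_trans (ler_normD _ _))// (splitr r) lerD//; first exact: ltW.
  by rewrite (le_trans (P_near_id xr x0r))// mulrC ler_pM2r.
have cT : is_contraction (mkfun TU : {fun U >-> U}).
  exists 2^-1%:nng; split; first by rewrite /= invf_lt1 ?ltr1n.
  move=> [x y] /= [xU yU].
  by rewrite /T opprD addrACA subrr add0r; exact: P_near_id.
have cU : closed U.
  have -> : U = closed_ball_ (fun x => `|x|) x0 r.
    by apply/seteqP; split=> x; rewrite /U/closed_ball_/= distrC.
  exact: closed_closed_ball_.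
have [x Ux xE] := banach_fixed_point cT cU (ex_intro _ x0 x0r).
have Px : P x = w.
  have {}xE : x = w + (x - P x) := xE.
  by apply/esym/subr0_eq/(addrI x); rewrite addr0 addrCA -xE.
exists x => //; rewrite -Px in wr.
have := perturbation_expanding Ux x0r; move: wr.
set a := `|_|; set b := `|_| => H1 H2; lra.
Qed.

End Perturbation.

Lemma differentiable_inverse (R : realType) (V W : normedModType R) (P : V -> W)
    (G : W -> V) (L : {linear W -> V}) (w : W) (k : R) :
  differentiable P (G w) -> continuous L -> (forall u, L ('d P (G w) u) = u) ->
  0 < k ->
  (\forall h \near (0 : W), P (G (h + w)) = h + w /\
      `|G (h + w) - G w| <= k * `|h|) ->
  differentiable G w /\ 'd G w = L :> (W -> V).
Proof.
move=> dP cL LP k0 PG; apply: littleo_differentiable => // e e0.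
have [C C0 LC] := linear_lipschitz cL.
have ek0 : 0 < e / (C * k) by rewrite divr_gt0// mulr_gt0.
have /nbhs_ballP[d /= d0 Hd] := differentiable_littleo dP ek0.
have PGw : P (G w) = w by have [] := nbhs_singleton PG; rewrite !add0r.
have N : \forall h \near (0 : W), `|h| < d / k.
  apply/nbhs_ballP; exists (d / k); first by rewrite /= divr_gt0.
  by move=> h /=; rewrite -ball_normE/= sub0r normrN.
near=> h.
have [PGh Gh] : P (G (h + w)) = h + w /\ `|G (h + w) - G w| <= k * `|h| by near: h.
have hd : `|h| < d / k by near: h.
set u := G (h + w) - G w.
have ud : ball 0 d u.
  rewrite -ball_normE/= sub0r normrN (le_lt_trans Gh)// mulrC.
  by rewrite -ltr_pdivlMr.
have := Hd _ ud; rewrite /= subrK PGh PGw addrK => Hu.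
have -> : u - L h = - L (h - 'd P (G w) u) by rewrite linearB LP opprB.
rewrite normrN (le_trans (LC _))//.
rewrite (@le_trans _ _ (C * (e / (C * k) * (k * `|h|))))//.
  by rewrite ler_pM2l// (le_trans Hu)// ler_wpM2l// ltW.
have [Cn kn] : C != 0 /\ k != 0 by rewrite !gt_eqF.
rewrite le_eqVlt; apply/orP; left; apply/eqP; field.
by rewrite Cn kn.
Unshelve. all: by end_near. Qed.

Section InverseFunction.
Context {R : realType} {q : nat}.
Implicit Types (U : set 'rV[R]_q) (P : 'rV[R]_q -> 'rV[R]_q).

Lemma jacobian_id_near_id U P x0 : open U -> smooth_on U P -> U x0 ->
  'J P x0 = 1%:M ->
  exists2 r, 0 < r & (forall x, `|x - x0| <= r -> U x) /\
    forall x y, `|x - x0| <= r -> `|y - x0| <= r ->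
      `|(x - P x) - (y - P y)| <= 2^-1 * `|x - y|.
Proof.
move=> oU sP Ux J1.
pose F x := x - P x.
have sF : smooth_on U F.
  apply: smoothD => //; last exact: smoothN.
  by have := smooth_linear 1%:M U; under eq_fun do rewrite mulmx1.
have J0 : 'J F x0 = 0.
  apply/row_matrixP => i; rewrite row_jacobian; last exact: smooth_differentiable Ux.
  rewrite row0 /partial; have dP := smooth_is_derive (delta_mx 0 i) sP Ux.
  have [_ ->] := is_deriveB (is_derive_id x0 (delta_mx 0 i)) dP.
  by rewrite deriveEjacobian ?J1 ?mulmx1 ?subrr//; exact: smooth_differentiable Ux.
pose e : R := 2^-1 / q.+1%:R.
have e0 : 0 < e by rewrite divr_gt0.
have cJ : {for x0, continuous (jacobian F)}.
  exact: smooth_continuous (smooth_jacobian oU sF) Ux.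
have /nbhs_ballP[d /= d0 Hd] : nbhs x0 (U `&` [set x | `|'J F x| < e]).
  apply: filterI; first exact: open_nbhs_nbhs.
  move/cvgrPdist_lt: cJ => /(_ _ e0); rewrite J0.
  by apply: filterS => x /=; rewrite sub0r normrN.
have inB x : `|x - x0| <= d / 2 -> U x /\ `|'J F x| < e.
  move=> xd; apply: Hd; rewrite -ball_normE/= distrC (le_lt_trans xd)//.
  by rewrite ltr_pdivrMr// mulr_natr mulr2n ltrDl.
exists (d / 2); first by rewrite divr_gt0.
split=> [x /inB[]//|x y xr yr].
rewrite -/(F x) -/(F y) [leLHS]/Num.Def.normr/= mx_normrE.
rewrite (bigmax_le _ (mulr_ge0 _ (normr_ge0 _)))//.
move=> [i j] _; rewrite /= (ord1 i) => {i}.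
have seg s : 0 <= s <= 1 -> `|y + s *: (x - y) - x0| <= d / 2.
  move=> /andP[s0 s1].
  have -> : y + s *: (x - y) - x0 = (1 - s) *: (y - x0) + s *: (x - x0).
    rewrite scalerBl scale1r !scalerBr.
    by apply/matrixP => a b; rewrite !mxE; ring.
  rewrite (le_trans (ler_normD _ _))// !normrZ !ger0_norm ?subr_ge0//.
  rewrite [leRHS](_ : _ = (1 - s) * (d / 2) + s * (d / 2)); last by ring.
  by rewrite lerD// ler_wpM2l// subr_ge0.
have sFj := (smooth_mxP F oU).1 sF 0 j.
have dFj s : 0 <= s <= 1 -> differentiable (fun z => F z 0 j) (y + s *: (x - y)).
  by move=> /seg/inB[Us _]; exact: smooth_differentiable sFj Us.
have [s /andP[s0 s1]] := line_MVT ltr01 dFj.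
have s01 : 0 <= s <= 1 by rewrite !ltW.
rewrite scale1r [y + _]addrC subrK mul1r => E.
rewrite mxE [(- F y) _ _]mxE E.
have [Us Js] := inB _ (seg _ s01).
have dFs := smooth_is_derive (x - y) sF Us.
move/is_derive_mxP: (dFs) => /(_ 0 j)[_ ->].
rewrite deriveEjacobian; last exact: smooth_differentiable Us.
rewrite mxE (le_trans (ler_norm_sum _ _ _))//.
rewrite (@le_trans _ _ (\sum_(k < q) `|x - y| * e))//.
  apply: ler_sum => k _; rewrite normrM ler_pM//.
    by rewrite [leRHS]/Num.Def.normr/= mx_normrE (le_bigmax _ _ (0, k)).
  rewrite ltW// (le_lt_trans _ Js)//.
  by rewrite [leRHS]/Num.Def.normr/= mx_normrE (le_bigmax _ _ (k, j)).
rewrite sumr_const card_ord -[leLHS]mulr_natr -mulrA [leRHS]mulrC ler_wpM2l//.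
rewrite /e -mulrA ler_piMr// mulrC.
by rewrite ler_pdivrMr// mul1r ler_nat.
Qed.

Theorem inverse_function U P x0 : open U -> smooth_on U P -> U x0 ->
  'J P x0 = 1%:M ->
  exists G r d, [/\ 0 < r /\ 0 < d, ball x0 d `<=` U,
    smooth_on (ball (P x0) r) G,
    forall w, ball (P x0) r w -> ball x0 d (G w) /\ P (G w) = w &
    forall x, ball x0 d x -> ball (P x0) r (P x) -> G (P x) = x].
Proof.
move=> oU sP Ux J1.
have [r r0 [rU Pnear]] := jacobian_id_near_id oU sP Ux J1.
have onto := perturbation_onto r0 Pnear.
have expd := perturbation_expanding Pnear.
pose G w := if pselect (`|w - P x0| < r / 2) is left H
  then sval (cid2 (onto w H)) else x0.
have GP w : ball (P x0) (r / 2) w -> `|G w - x0| < r /\ P (G w) = w.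
  rewrite -ball_normE/= distrC => H; rewrite /G; case: pselect => // H'.
  by case: (cid2 _) => x.
have r20 : 0 < r / 2 by rewrite divr_gt0.
have oB : open (ball (P x0) (r / 2)) by exact: ball_open.
have UG w : ball (P x0) (r / 2) w -> U (G w).
  by move=> /GP[/ltW/rU].
have Glip w w' : ball (P x0) (r / 2) w -> ball (P x0) (r / 2) w' ->
    `|G w - G w'| <= 2 * `|w - w'|.
  move=> /GP[/ltW a Pw] /GP[/ltW b Pw'].
  by have := expd _ _ a b; rewrite Pw Pw'.
have dG w : ball (P x0) (r / 2) w -> [/\ differentiable G w,
    'J P (G w) \in unitmx & forall v, 'D_v G w = v *m invmx ('J P (G w))].
  move=> Bw; have [Gwr PGw] := GP _ Bw; have UGw := UG _ Bw.
  have dP := smooth_differentiable sP UGw.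
  have Ju : 'J P (G w) \in unitmx.
    rewrite -row_free_unit -kermx_eq0; apply/rowV0P => u.
    rewrite (sameP sub_kermxP eqP) => /eqP uJ.
    have uD : 'd P (G w) u = 0 by rewrite -deriveE// deriveEjacobian.
    apply/eqP; rewrite -normr_le0 leNgt; apply/negP => u0.
    have e0 : (0 : R) < 4^-1 by rewrite invr_gt0.
    have /nbhs_ballP[d /= d0 Hd] := differentiable_littleo dP e0.
    have [t [t0 td tr]] : exists t, [/\ 0 < t, t * `|u| < d & t * `|u| < r - `|G w - x0|].
      pose m := Num.min d (r - `|G w - x0|).
      have m0 : 0 < m by rewrite lt_min d0 subr_gt0.
      have tm : m / 2 / `|u| * `|u| < m.
        by rewrite divfK ?gt_eqF// ltr_pdivrMr// mulr_natr mulr2n ltrDl.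
      exists (m / 2 / `|u|); split; first by rewrite !divr_gt0.
        by apply: lt_le_trans tm _; rewrite ge_min lexx.
      by apply: lt_le_trans tm _; rewrite ge_min lexx orbT.
    have tu : `|t *: u| = t * `|u| by rewrite normrZ gtr0_norm.
    have := Hd (t *: u); rewrite -ball_normE/= sub0r normrN tu linearZ/= uD scaler0.
    rewrite subr0 => /(_ td); move: (@expd (t *: u + G w) (G w)).
    rewrite addrK tu => E; have {}E : t * `|u| <= 2 * `|P (t *: u + G w) - P (G w)|.
      apply: E; last exact: ltW.
      rewrite -addrA (le_trans (ler_normD _ _))// tu.
      by move: tr; rewrite ltrBrDr => /ltW.
    have : 0 < t * `|u| by rewrite mulr_gt0.
    have aux (a b : R) : a <= 2 * b -> 0 < a -> b <= 4^-1 * a -> False by lra.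
    exact: aux E.
  pose L : {linear 'rV[R]_q -> 'rV[R]_q} := mulmxr (invmx ('J P (G w))).
  have cL : continuous L.
    move=> x; exact: (smooth_continuous (smooth_linear (invmx ('J P (G w))) setT)).
  have LP u : L ('d P (G w) u) = u.
    by rewrite -deriveE// deriveEjacobian// /L/= mulmxK.
  have [||dGw dE] := differentiable_inverse (k := 2) (w := w) (G := G) dP cL LP.
  - by [].
  - have : \forall h \near (0 : 'rV[R]_q), ball (P x0) (r / 2) (h + w).
      exact: near0_shift (open_nbhs_nbhs (conj oB Bw)).
    apply: filterS => h Bh; split; first by case: (GP _ Bh).
    by rewrite (le_trans (Glip _ _ Bh Bw))// addrK.
  by split => // v; rewrite deriveE// dE.
have CG k : Ck k (ball (P x0) (r / 2)) G.
  elim: k => [|k IHk].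
    by move=> w /dG[dGw _ _]; exact: differentiable_continuous.
  apply/CkS; split=> [w /dG[]//|v].
  apply: (@Ck_ext _ _ _ _ _ (fun w => v *m invmx ('J P (G w)))) => //.
    by move=> w; rewrite inE => /dG[_ _ ->].
  apply: Ck_mulmx => //; first exact: Ck_cst.
  apply: Ck_invmx => //.
    by move=> w /dG[].
  apply/(Ck_mxP _ _ oB) => i j.
  apply: (Ck_comp (U' := U) (F := fun x => 'J P x i j)) => //.
  have sJ := smooth_jacobian oU sP.
  exact: ((smooth_mxP _ oU).1 sJ i j k).
exists G, (r / 2), r; split => //.
- by move=> x; rewrite -ball_normE/= distrC => /ltW/rU.
- by move=> w /GP[Gr PG]; rewrite -ball_normE/= distrC.
- move=> x xr Bx; have [Gr GE] := GP _ Bx.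
  rewrite -ball_normE/= distrC in xr.
  apply/eqP; rewrite -subr_eq0 -normr_le0.
  have := @expd (G (P x)) x; rewrite GE subrr normr0 mulr0; apply; exact: ltW.
Qed.

End InverseFunction.

(** * Pointwise algebra of Kähler hypersurfaces *)

Section TransposeTrace.
Context {R : pzRingType}.

Lemma trmx_D m n (X Y : 'M[R]_(m, n)) : (X + Y)^T = X^T + Y^T.
Proof. exact: linearD. Qed.

Lemma trmx_N m n (X : 'M[R]_(m, n)) : (- X)^T = - X^T.
Proof. exact: linearN. Qed.

Lemma trmx_B m n (X Y : 'M[R]_(m, n)) : (X - Y)^T = X^T - Y^T.
Proof. exact: linearB. Qed.

Lemma trmx_Z m n (a : R) (X : 'M[R]_(m, n)) : (a *: X)^T = a *: X^T.
Proof. exact: linearZ. Qed.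

Lemma mxtrace_B m (X Y : 'M[R]_m) : \tr (X - Y) = \tr X - \tr Y.
Proof. exact: linearB. Qed.

Lemma mxtrace_N m (X : 'M[R]_m) : \tr (- X) = - \tr X.
Proof. exact: linearN. Qed.

Lemma mxtrace_Z m (a : R) (X : 'M[R]_m) : \tr (a *: X) = a * \tr X.
Proof. exact: linearZ. Qed.

End TransposeTrace.

Section SymmetricIdempotent.
Context {R : realFieldType}.

Lemma trmx_mul_trace_eq0 m n (X : 'M[R]_(m, n)) : \tr (X *m X^T) = 0 -> X = 0.
Proof.
move=> tr0; apply/matrixP => i j; rewrite mxE.
have sq k l : 0 <= X k l * X k l by rewrite -expr2 sqr_ge0.
have E : \tr (X *m X^T) = \sum_(k < m) \sum_(l < n) X k l * X k l.
  apply: eq_bigr => k _; rewrite mxE; apply: eq_bigr => l _; by rewrite mxE.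
rewrite E in tr0.
have H : \sum_(l < n) X i l * X i l = 0.
  by apply: (psumr_eq0P _ tr0) => // k _; apply: sumr_ge0.
have /eqP : X i j * X i j = 0 by apply: (psumr_eq0P _ H).
by rewrite mulf_eq0 orbb => /eqP.
Qed.

Lemma sym_idem_trace0 n (X : 'M[R]_n) :
  X^T = X -> X *m X = X -> \tr X = 0 -> X = 0.
Proof. by move=> sX iX tX; apply: trmx_mul_trace_eq0; rewrite sX iX. Qed.

End SymmetricIdempotent.

Section ShapeOperatorAlgebra.
Context {R : realFieldType} {V : algType R}.
Variables (t : R) (T J A : V).
Hypotheses (t_neq0 : t != 0) (JJ : J * J = - T) (TJ : T * J = J) (JT : J * T = J)
  (AT : A * T = A) (TA : T * A = A).
Let Q := A - J * A * J.
Hypotheses (AQ : A * Q = t *: A) (QA : Q * A = t *: A).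

Lemma Q_commJ : Q * J = J * Q.
Proof.
rewrite /Q mulrBl mulrBr -!mulrA JJ !mulrN opprK AT !mulrA JJ !mulNr opprK TA.
by rewrite addrC.
Qed.

Lemma Q_sqr : Q * Q = t *: Q.
Proof.
rewrite {2}/Q mulrBr QA !mulrA Q_commJ -(mulrA J Q A) QA.
by rewrite -scalerAr -scalerAl -scalerBr.
Qed.

Let Phi := A - 2^-1 *: Q.

Lemma traceless_antiJ : Phi * J = - (J * Phi).
Proof.
rewrite /Phi mulrBl mulrBr -scalerAl -scalerAr Q_commJ opprB.
have -> : A * J = J * Q - J * A.
  by rewrite -Q_commJ /Q mulrBl -!mulrA JJ !mulrN opprK AT addrK.
rewrite addrAC; congr (_ - _); apply/eqP; rewrite subr_eq -scalerDl.
by rewrite -[X in X + X]mul1r -splitr scale1r.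
Qed.

Section TransverseDerivative.
Variables (B B' : V).
Hypotheses (BQ : B * Q = t *: B) (B'Q : B' * Q = t *: B')
  (BT : B * T = B) (B'T : B' * T = B') (TB : T * B = B)
  (BJ : B * J = - (J * B)) (B'J : B' * J = - (J * B'))
  (BB' : (B - B' * J) * A = t *: B).

Lemma transverse_eq0 : B' * J = - B /\ B * Phi = 0.
Proof.
have AE : A = 2^-1 *: Q + Phi by rewrite /Phi addrC subrK.
pose X := 2^-1 *: (t *: (B' * J + B)).
pose Y := (B - B' * J) * Phi.
have XY : X = Y.
  have E : B' * J * A = B * J * A * J.
    have : B * A - B' * J * A = B * A - B * J * A * J.
      by rewrite -mulrBl BB' -BQ /Q mulrBr !mulrA.
    by move/addrI/oppr_inj.
  have E1 : B' * J * A = 2^-1 *: (t *: (B' * J)) + B' * J * Phi.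
    rewrite {1}AE mulrDr -scalerAr -[B' * J * Q]mulrA -Q_commJ mulrA B'Q.
    by rewrite -scalerAl.
  have E2 : B * J * A * J = - (2^-1 *: (t *: B)) + B * Phi.
    rewrite {1}AE mulrDr mulrDl -scalerAr -[B * J * Q]mulrA -Q_commJ mulrA BQ.
    rewrite -!scalerAl -!mulrA JJ traceless_antiJ !mulrN BT !scalerN.
    congr (_ + _); rewrite !mulrA -(mulrA B J J) JJ mulrN BT mulNr opprK.
    by [].
  rewrite /X /Y mulrBl scalerDr scalerDr.
  move: E; rewrite E1 E2 => E.
  apply/eqP; rewrite -subr_eq0 opprB addrACA.
  move/eqP: E; rewrite -subr_eq0 opprD opprK addrACA => /eqP <-.
  by [].
have JXJ : J * X * J = X.
  rewrite /X -!scalerAr -!scalerAl; congr (_ *: (_ *: _)).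
  rewrite mulrDr mulrDl; congr (_ + _).
    by rewrite -!mulrA JJ !mulrN B'T -B'J.
  by rewrite -!mulrA BJ mulrN mulrA JJ mulNr opprK.
have JYJ : J * Y * J = - Y.
  rewrite /Y mulrBl mulrBr mulrBl opprB addrC -!mulrA traceless_antiJ !mulrN opprK.
  congr (_ + _).
    by rewrite !mulrA -(mulrA (J * B') J J) JJ mulrN -(mulrA J B' T) B'T -B'J.
  by rewrite !mulrA -(mulrA J B J) BJ mulrN mulNr opprK mulrA JJ mulNr TB mulNr.
have dbl (Z : V) : Z + Z = 0 -> Z = 0.
  by rewrite -mulr2n -scaler_nat => /eqP; rewrite scaler_eq0 pnatr_eq0 => /eqP.
have X0 : X = 0.
  have : X + X = 0 by rewrite -{1}JXJ XY JYJ addNr.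
  exact: dbl.
have B'JE : B' * J = - B.
  apply/eqP; rewrite -addr_eq0; move/eqP: X0.
  by rewrite !scaler_eq0 invr_eq0 pnatr_eq0 (negPf t_neq0).
split=> //; move: XY; rewrite X0 /Y B'JE opprK => /esym/eqP.
by rewrite mulrDl => /eqP/dbl.
Qed.

End TransverseDerivative.
End ShapeOperatorAlgebra.

Lemma gauss_contraction (R : realFieldType) m (A J : 'M[R]_m) :
  A^T = A -> J^T = - J -> A *m J *m J = - A ->
  (forall i j, J *m (row i A)^T *m row j A + (row j A)^T *m row i A *m J =
               J *m (row j A)^T *m row i A + (row i A)^T *m row j A *m J) ->
  A *m (A - J *m A *m J) = \tr A *: A.
Proof.
move=> symA skewJ AJJ H.
have trJA : \tr (J *m A) = 0.
  have : \tr (J *m A) = - \tr (J *m A).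
    by rewrite -{1}mxtrace_tr trmx_mul symA skewJ mulmxN mxtrace_N mxtrace_mulC.
  by move/eqP; rewrite -addr_eq0 -mulr2n mulrn_eq0/= => /eqP.
have E i j q : A i i * A j q - A j i * A i q
    = (J *m A) i j * (A *m J) i q - (J *m A) i i * (A *m J) j q.
  have outer k l (X Y : 'M[R]_m) a b : (col k X *m row l Y) a b = X a k * Y l b.
    by rewrite mxE big_ord1 !mxE.
  have rJJ k : row k A *m (J *m J) = row k (- A).
    by rewrite mulmxA -!row_mul AJJ.
  have trE k : (row k A)^T = col k A by rewrite -{1}symA tr_row trmxK.
  have := congr1 (fun M : 'M[R]_m => (M *m J) i q) (H i j).
  rewrite /= !mulmxDl -!mulmxA !rJJ !(mulmxA J) !trE.
  have cM k : J *m col k A = col k (J *m A) by rewrite !colE mulmxA.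
  rewrite !cM -!row_mul.
  have NE (X : 'M[R]_m) a b : (- X) a b = - X a b by rewrite mxE.
  rewrite [LHS]mxE [RHS]mxE !outer !NE.
  have -> : A i j = A j i by rewrite -{1}symA mxE.
  move: ((J *m A) i i) ((J *m A) i j) ((A *m J) i q) ((A *m J) j q).
  by move: (A i i) (A j q) (A j i) (A i q) => a b c d x y z w ?; lra.
apply/matrixP => j q.
have : \sum_i (A i i * A j q - A j i * A i q)
    = \sum_i ((J *m A) i j * (A *m J) i q - (J *m A) i i * (A *m J) j q).
  by apply: eq_bigr => i _; exact: E.
rewrite !sumrB -!mulr_suml -/(\tr A) -/(\tr (J *m A)) trJA mul0r subr0.
have -> : \sum_i A j i * A i q = (A *m A) j q by rewrite mxE.
have -> : \sum_i (J *m A) i j * (A *m J) i q = ((J *m A)^T *m (A *m J)) j q.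
  by rewrite [RHS]mxE; apply: eq_bigr => i _; rewrite [(_^T) _ _]mxE.
rewrite trmx_mul symA skewJ mulmxN mulNmx => H1.
rewrite mulmxBr [RHS]mxE.
have NE (X : 'M[R]_m) a b : (- X) a b = - X a b by rewrite mxE.
have DE (X Y : 'M[R]_m) a b : (X + Y) a b = X a b + Y a b by rewrite mxE.
rewrite DE NE; move: H1; rewrite NE !mulmxA => /(canRL (subrK _)) ->.
by rewrite addrC.
Qed.

Section ShapeOperatorMatrices.
Context {R : realFieldType} {n : nat}.
Local Notation m := n.+1.
Variables (t : R) (T J A : 'M[R]_m).
Hypotheses (t_neq0 : t != 0) (TT : T *m T = T) (symT : T^T = T)
  (JJ : J *m J = - T) (TJ : T *m J = J) (JT : J *m T = J) (skewJ : J^T = - J)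
  (AT : A *m T = A) (TA : T *m A = A) (symA : A^T = A).
Let Q := A - J *m A *m J.
Let Phi := A - 2^-1 *: Q.
Hypotheses (AQ : A *m Q = t *: A) (trA : \tr A = t).

Lemma sym_Q : Q^T = Q.
Proof.
by rewrite /Q trmx_B !trmx_mul skewJ symA !mulmxN !mulNmx opprK mulmxA.
Qed.

Let QA : Q *m A = t *: A.
Proof. by have := congr1 trmx AQ; rewrite trmx_mul sym_Q symA trmx_Z symA. Qed.

Let QJ : Q *m J = J *m Q.
Proof. exact: (Q_commJ (V := 'M[R]_m) JJ AT TA). Qed.

Let QQ : Q *m Q = t *: Q.
Proof. exact: (Q_sqr (V := 'M[R]_m) JJ AT TA QA). Qed.

Let TQ : T *m Q = Q.
Proof. by rewrite /Q mulmxBr TA !mulmxA TJ. Qed.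

Let QT : Q *m T = Q.
Proof. by rewrite /Q mulmxBl AT -!mulmxA JT. Qed.

Let antiJ : Phi *m J = - (J *m Phi).
Proof. exact: (traceless_antiJ (V := 'M[R]_m) JJ AT TA). Qed.

Lemma trace_Q : \tr Q = t *+ 2.
Proof.
rewrite /Q mxtrace_B -mulmxA mxtrace_mulC -mulmxA JJ mulmxN AT mxtrace_N opprK trA.
by rewrite mulr2n.
Qed.

Lemma rank2_eq0 (B : 'M[R]_m) : B != 0 -> B *m Q = t *: B -> B *m Phi = 0 ->
  Phi = 0.
Proof.
move=> B0 BQ BPhi.
have [v [v0 vQ vPhi]] : exists v : 'rV[R]_m,
    [/\ v != 0, v *m Q = t *: v & v *m Phi = 0].
  have /rowV0Pn[_ /submxP[c ->] v0] := B0; exists (c *m B); split => //.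
    by rewrite -mulmxA BQ -scalemxAr.
  by rewrite -mulmxA BPhi mulmx0.
have vT : v *m T = v.
  by apply: (scalerI t_neq0); rewrite scalemxAl -vQ -mulmxA QT.
pose s := (v *m v^T) 0 0.
have sE : v *m v^T = s%:M by rewrite [LHS]mx11_scalar.
have s0 : s != 0.
  apply: contraNN v0 => /eqP s0; apply/eqP/trmx_mul_trace_eq0.
  by rewrite sE s0 mxtrace_scalar mul0rn.
pose w := v *m J.
have vw : v *m w^T = 0.
  have : (v *m w^T)^T = v *m w^T by rewrite [v *m w^T]mx11_scalar tr_scalar_mx.
  rewrite /w !trmx_mul trmxK !mulmxA => /eqP.
  rewrite trmxK skewJ -subr_eq0 mulmxN mulNmx opprK -mulr2n.
  by rewrite -scaler_nat scaler_eq0 pnatr_eq0 => /eqP->; rewrite oppr0.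
have wv : w *m v^T = 0 by have := congr1 trmx vw; rewrite trmx_mul trmxK trmx0.
have ww : w *m w^T = s%:M.
  rewrite /w trmx_mul skewJ mulNmx mulmxN mulmxA -[v *m J *m J]mulmxA JJ.
  by rewrite mulmxN mulNmx opprK vT sE.
have wQ : w *m Q = t *: w by rewrite /w -mulmxA -QJ mulmxA vQ -scalemxAl.
have wPhi : w *m Phi = 0.
  by rewrite /w -mulmxA -[J *m Phi]opprK -antiJ mulmxN mulmxA vPhi mul0mx oppr0.
clearbody w.
pose X := t^-1 *: Q - s^-1 *: (v^T *m v) - s^-1 *: (w^T *m w).
have symX : X^T = X.
  by rewrite /X !trmx_B !trmx_Z sym_Q !trmx_mul !trmxK.
have QvT : Q *m v^T = t *: v^T.
  by have := congr1 trmx vQ; rewrite trmx_mul sym_Q trmx_Z.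
have QwT : Q *m w^T = t *: w^T.
  by have := congr1 trmx wQ; rewrite trmx_mul sym_Q trmx_Z.
have Xv : X *m v^T = 0.
  rewrite /X !mulmxBl -!scalemxAl QvT -!mulmxA sE wv mulmx0 scaler0 subr0.
  by rewrite mul_mx_scalar !scalerA !mulVf// subrr.
have Xw : X *m w^T = 0.
  rewrite /X !mulmxBl -!scalemxAl QwT -!mulmxA ww vw mulmx0 scaler0 subr0.
  by rewrite mul_mx_scalar !scalerA !mulVf// subrr.
have idX : X *m X = X.
  rewrite {2}/X !mulmxBr -!scalemxAr !mulmxA Xv Xw !mul0mx !scaler0 !subr0.
  rewrite /X !mulmxBl -!scalemxAl QQ -!mulmxA vQ wQ !scalerBr -!scalemxAr.
  have tK (Z : 'M[R]_m) : t^-1 *: (t *: Z) = Z by rewrite scalerA mulVf// scale1r.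
  have stK (Z : 'M[R]_m) : t^-1 *: (s^-1 *: (t *: Z)) = s^-1 *: Z.
    by rewrite scalerA mulrC -scalerA tK.
  by rewrite !stK !tK.
have trX : \tr X = 0.
  rewrite /X !mxtrace_B !mxtrace_Z trace_Q ![\tr (_^T *m _)]mxtrace_mulC sE ww.
  rewrite mxtrace_scalar mulr1n mulVf// mulrnAr mulVf//.
  by rewrite mulr2n addrK subrr.
have X0 := sym_idem_trace0 symX idX trX.
have QE : Q = t *: (s^-1 *: (v^T *m v) + s^-1 *: (w^T *m w)).
  move/eqP: X0; rewrite /X -addrA -opprD subr_eq0 => /eqP <-.
  by rewrite scalerA divff// scale1r.
have QPhi : Q *m Phi = t *: Phi.
  by rewrite /Phi mulmxBr QA -scalemxAr QQ [RHS]scalerBr !scalerA mulrC.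
apply: (scalerI t_neq0); rewrite -QPhi QE -scalemxAl mulmxDl -!scalemxAl.
by rewrite -!mulmxA vPhi wPhi !mulmx0 !scaler0 addr0 scaler0.
Qed.

Section CovariantDerivative.
Variable e : 'rV[R]_m -> 'M[R]_m.
Hypotheses (sym_e : forall X, (e X)^T = e X) (eT : forall X, e X *m T = e X).
Let q X := e X - J *m e X *m J.
Hypothesis codazzi : forall X Y, X *m T = X -> Y *m T = Y -> X *m e Y = Y *m e X.
Hypothesis derive_AQ : forall X, e X *m Q + A *m q X = t *: e X.

Let Te X : T *m e X = e X.
Proof. by have := congr1 trmx (eT X); rewrite trmx_mul sym_e symT. Qed.

Let sym_q X : (q X)^T = q X.
Proof.
by rewrite /q trmx_B !trmx_mul skewJ sym_e !mulmxN !mulNmx opprK mulmxA.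
Qed.

Let derive_QA X : Q *m e X + q X *m A = t *: e X.
Proof.
have := congr1 trmx (derive_AQ X).
by rewrite trmx_D !trmx_mul trmx_Z !sym_e sym_q symA sym_Q.
Qed.

Let qJ X : q X *m J = J *m q X.
Proof.
rewrite /q mulmxBl mulmxBr -!mulmxA JJ !mulmxN eT opprK !mulmxA JJ !mulNmx Te.
by rewrite opprK addrC.
Qed.

Let derive_QQ X : q X *m Q + Q *m q X = t *: q X.
Proof.
rewrite {2}/q mulmxBr {1}/Q mulmxBr addrACA [q X *m A + _]addrC derive_QA.
rewrite /q scalerBr -[e X - _]/(q X); congr (_ + _).
rewrite !mulmxA qJ QJ -opprD -!mulmxDl -!(mulmxA J) -mulmxDr.
by rewrite [_ *m A + _]addrC derive_QA -scalemxAr -scalemxAl mulmxA.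
Qed.

Let QqQ X : Q *m q X *m Q = 0.
Proof.
have := congr1 (fun M => Q *m M *m Q) (derive_QQ X).
rewrite mulmxDr mulmxDl -!scalemxAr -scalemxAl !mulmxA QQ -!scalemxAl.
rewrite -(mulmxA _ Q Q) QQ -scalemxAr -scalerDr => /(scalerI t_neq0)/eqP.
by rewrite -subr_eq0 addrK => /eqP.
Qed.

Let vertical (tau : 'rV[R]_m) := tau *m T = tau /\ tau *m Q = 0.

Let verticalJ tau : vertical tau -> vertical (tau *m J).
Proof.
move=> [tT tQ]; split; first by rewrite -mulmxA JT.
by rewrite -mulmxA -QJ mulmxA tQ mul0mx.
Qed.

Lemma vertical_q tau X : vertical tau -> X *m T = X ->
  tau *m q X = X *m (e tau - e (tau *m J) *m J).
Proof.
move=> vt XT; have [tT _] := vt; have [tJT _] := verticalJ vt.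
by rewrite /q !mulmxBr !mulmxA (codazzi tT XT) (codazzi tJT XT).
Qed.

Let K := t *: T - Q.

Let KeK Z : K *m e Z *m K = 0.
Proof.
have KA : K *m A = 0 by rewrite mulmxBl -scalemxAl TA QA subrr.
have QK : Q *m K = 0 by rewrite mulmxBr -scalemxAr QT QQ subrr.
have := congr1 (fun M => K *m M *m K) (derive_AQ Z).
rewrite mulmxDr mulmxDl !mulmxA KA !mul0mx addr0 -(mulmxA _ Q K) QK mulmx0.
by rewrite -scalemxAr -scalemxAl => /esym/eqP; rewrite scaler_eq0 (negPf t_neq0) => /eqP.
Qed.

Lemma vertical_eQ tau : vertical tau -> e tau *m Q = t *: e tau.
Proof.
move=> [tT tQ].
have tK : tau *m K = t *: tau by rewrite mulmxBr -scalemxAr tT tQ subr0.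
suff : e tau *m K = 0.
  by rewrite mulmxBr -scalemxAr eT => /eqP; rewrite subr_eq0 => /eqP.
apply/row_matrixP => i; rewrite row0 rowE mulmxA.
set Z := delta_mx 0 i; rewrite -[Z *m e tau](_ : (Z *m T) *m e tau = _); last first.
  by rewrite -mulmxA Te.
have ZTT : Z *m T *m T = Z *m T by rewrite -mulmxA TT.
rewrite (codazzi ZTT tT); apply: (scalerI t_neq0).
by rewrite scaler0 !scalemxAl -tK -!mulmxA [K *m _]mulmxA KeK mulmx0.
Qed.

Lemma vertical_Qe tau : vertical tau -> Q *m e tau = t *: e tau.
Proof.
move=> /vertical_eQ/(congr1 trmx); rewrite trmx_mul sym_e sym_Q trmx_Z.
by rewrite sym_e.
Qed.

Lemma vertical_antiJ tau : vertical tau -> e tau *m J = - (J *m e tau).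
Proof.
move=> vt; have eQ := vertical_eQ vt; have Qe := vertical_Qe vt.
have Qq : Q *m q tau = t *: q tau.
  rewrite /q scalerBr (mulmxBr Q (e tau)) Qe; congr (_ - _).
  by rewrite !mulmxA QJ -(mulmxA J Q) Qe -scalemxAr -scalemxAl.
have q0 : q tau = 0.
  have := QqQ tau; rewrite Qq -scalemxAl -[q tau *m Q]trmxK trmx_mul sym_Q sym_q.
  by rewrite Qq trmx_Z sym_q => /eqP; rewrite !scaler_eq0 (negPf t_neq0)/= => /eqP.
have : e tau = J *m e tau *m J by apply/eqP; rewrite -subr_eq0; apply/eqP.
move=> {1}->; rewrite -!mulmxA JJ mulmxN eT mulmxN.
by [].
Qed.

Lemma vertical_traceless tau : vertical tau -> e tau *m Phi = 0.
Proof.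
move=> vt; have vtJ := verticalJ vt.
have star : (e tau - e (tau *m J) *m J) *m A = t *: e tau.
  have [tT tQ] := vt; set D := e tau - _.
  have TD : T *m D = D by rewrite (mulmxBr T) mulmxA !Te.
  apply/row_matrixP => i; rewrite !rowE; set Z : 'rV_m := delta_mx 0 i.
  have ZTT : Z *m T *m T = Z *m T by rewrite -mulmxA TT.
  rewrite -{1}TD -(mulmxA T) mulmxA mulmxA -(vertical_q vt ZTT).
  rewrite -scalemxAr -(Te tau) (mulmxA Z) (codazzi ZTT tT) scalemxAr -derive_QA.
  by rewrite (mulmxDr tau (Q *m _)) (mulmxA tau Q) tQ mul0mx add0r mulmxA.
by case: (@transverse_eq0 _ 'M[R]_m t T J A t_neq0 JJ AT TA
  (e tau) (e (tau *m J)) (vertical_eQ vt) (vertical_eQ vtJ) (eT _) (eT _)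
  (Te _) (vertical_antiJ vt) (vertical_antiJ vtJ) star).
Qed.

Lemma vertical_parallel :
  (forall tau, vertical tau -> e tau = 0) -> forall X, X *m T = X -> q X = 0.
Proof.
move=> e0 X XT.
have Kq : K *m q X = 0.
  apply/row_matrixP => i; rewrite row0 row_mul.
  have vK : vertical (row i K).
    split; rewrite -row_mul mulmxBl -scalemxAl ?TT ?QT// TQ QQ.
    by rewrite subrr row0.
  rewrite (vertical_q vK XT) e0// (e0 _ (verticalJ vK)).
  by rewrite mul0mx subrr mulmx0.
have Tq : T *m q X = q X by rewrite /q mulmxBr !mulmxA TJ Te.
have tq : t *: q X = Q *m q X.
  by apply/eqP; rewrite -subr_eq0 -{1}Tq scalemxAl -mulmxBl -/K Kq.
have qQ : q X *m Q = 0.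
  by apply: (scalerI t_neq0); rewrite scalemxAl tq QqQ scaler0.
have : t *: q X = 0 by rewrite tq -[Q *m q X]trmxK trmx_mul sym_q sym_Q qQ trmx0.
by move/eqP; rewrite scaler_eq0 (negPf t_neq0) => /eqP.
Qed.

Lemma umbilic_vertical tau : vertical tau -> e tau = 2^-1 *: q tau -> e tau = 0.
Proof.
move=> vt eE; have := QqQ tau.
have -> : q tau = 2 *: e tau by rewrite eE scalerA divff ?pnatr_eq0// scale1r.
rewrite -scalemxAr -scalemxAl (vertical_Qe vt) -scalemxAl (vertical_eQ vt).
by move/eqP; rewrite !scaler_eq0 pnatr_eq0 !(negPf t_neq0)/= => /eqP.
Qed.

End CovariantDerivative.
End ShapeOperatorMatrices.

(** * Local geometry of a Kähler hypersurface *)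

Lemma near_neq0 (R : realType) (V W : normedModType R) (f : V -> W) x :
  {for x, continuous f} -> f x != 0 -> \forall y \near x, f y != 0.
Proof.
move=> /cvgrPdist_lt cf fx; have p : 0 < `|f x| by rewrite normr_gt0.
apply: filterS (cf _ p) => y; apply: contraTN => /eqP ->.
by rewrite subr0 ltxx.
Qed.

Section MatrixDerivatives.
Context {R : realType} {n : nat}.
Implicit Types (U : set 'rV[R]_n).

Lemma derive_ext (V : normedModType R) U (f g : 'rV[R]_n -> V) u x : open U ->
  U x -> (forall y, U y -> f y = g y) -> 'D_u f x = 'D_u g x.
Proof.
move=> oU Ux fg; apply: near_eq_derive.
by apply: filterS (open_nbhs_nbhs (conj oU Ux)).
Qed.

Lemma derive_mulmx U p q r (X : 'rV[R]_n -> 'M[R]_(p, q))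
    (Y : 'rV[R]_n -> 'M[R]_(q, r)) u x :
  smooth_on U X -> smooth_on U Y -> U x ->
  'D_u (fun y => X y *m Y y) x = 'D_u X x *m Y x + X x *m 'D_u Y x.
Proof.
move=> sX sY Ux; apply: derive_val.
exact: is_derive_mulmx (smooth_is_derive u sX Ux) (smooth_is_derive u sY Ux).
Qed.

Lemma derive_trmx U p q (X : 'rV[R]_n -> 'M[R]_(p, q)) u x :
  smooth_on U X -> U x -> 'D_u (fun y => (X y)^T) x = ('D_u X x)^T.
Proof.
move=> sX Ux; apply: derive_val.
exact: is_derive_trmx (smooth_is_derive u sX Ux).
Qed.

End MatrixDerivatives.

Section GaussMap.
Context {R : realType} {n m : nat}.
Implicit Types (F N : 'rV[R]_n -> 'rV[R]_m) (J : 'rV[R]_n -> 'M[R]_n).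

Definition coframe F x := ('J F x)^T *m invmx ('J F x *m ('J F x)^T).

Definition tangent_proj F x := coframe F x *m 'J F x.

(* The shape operator and the complex structure as endomorphisms of the
   ambient space, extended by 0 on the normal line. *)
Definition shape F N x := - (coframe F x *m 'J N x).

Definition ambient_endo F J x := coframe F x *m J x *m 'J F x.

Definition curved_endo F N J x :=
  shape F N x - ambient_endo F J x *m shape F N x *m ambient_endo F J x.

End GaussMap.

Lemma gram_unitmx (R : realFieldType) m n (D : 'M[R]_(m, n)) :
  row_free D -> D *m D^T \in unitmx.
Proof.
move=> fD; rewrite -row_free_unit -kermx_eq0; apply/rowV0P => u.
rewrite (sameP sub_kermxP eqP) => /eqP uD.
have : u *m D = 0.
  apply: trmx_mul_trace_eq0.
  by rewrite trmx_mul mulmxA -(mulmxA u D) uD mul0mx mxtrace0.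
by move/eqP; rewrite mulmx_free_eq0// => /eqP.
Qed.

Section LocalHypersurface.
Context {R : realType} {n : nat}.
Local Notation m := n.+1.
Variables (U : set 'rV[R]_n) (F N : 'rV[R]_n -> 'rV[R]_m).
Hypotheses (oU : open U) (sF : smooth_on U F) (sN : smooth_on U N).
Hypothesis freeF : forall x, U x -> row_free ('J F x).
Hypothesis unitN : forall x, U x -> N x *m (N x)^T = 1%:M.
Hypothesis normalN : forall x, U x -> 'J F x *m (N x)^T = 0.

Local Notation D := (jacobian F).
Local Notation C := (coframe F).
Local Notation T := (tangent_proj F).
Local Notation A := (shape F N).

Let gU x : U x -> D x *m (D x)^T \in unitmx.
Proof. by move=> Ux; exact/gram_unitmx/freeF. Qed.

Lemma mul_jac_coframe x : U x -> D x *m C x = 1%:M.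
Proof. by move=> Ux; rewrite /coframe mulmxA mulmxV// gU. Qed.

Lemma tr_coframe x : (C x)^T = invmx (D x *m (D x)^T) *m D x.
Proof. by rewrite trmx_mul trmxK trmx_inv trmx_mul trmxK. Qed.

Lemma sym_tangent_proj x : (T x)^T = T x.
Proof. by rewrite trmx_mul tr_coframe mulmxA. Qed.

Lemma mul_jac_tangent x : U x -> D x *m T x = D x.
Proof. by move=> Ux; rewrite mulmxA mul_jac_coframe// mul1mx. Qed.

Lemma mul_tangent_coframe x : U x -> T x *m C x = C x.
Proof. by move=> Ux; rewrite -mulmxA mul_jac_coframe// mulmx1. Qed.

Lemma tangent_projK x : U x -> T x *m T x = T x.
Proof. by move=> Ux; rewrite {1}/tangent_proj -mulmxA mul_jac_tangent. Qed.

Lemma mul_tangent_normal x : U x -> T x *m (N x)^T = 0.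
Proof. by move=> Ux; rewrite -mulmxA normalN// mulmx0. Qed.

Lemma tangent_normal_split x : U x -> T x + (N x)^T *m N x = 1%:M.
Proof.
move=> Ux; apply/esym/eqP; rewrite -subr_eq0; apply/eqP.
have TN := mul_tangent_normal Ux; have TT := tangent_projK Ux.
have NT : N x *m T x = 0.
  by rewrite -[LHS]trmxK trmx_mul sym_tangent_proj TN trmx0.
have EE : (T x + (N x)^T *m N x) *m (T x + (N x)^T *m N x)
    = T x + (N x)^T *m N x.
  rewrite mulmxDl (mulmxDr (T x)) TT (mulmxA (T x)) TN mul0mx addr0.
  rewrite mulmxDr -(mulmxA _ (N x) (T x)) NT mulmx0 add0r -mulmxA (mulmxA (N x)).
  by rewrite unitN// mul1mx.
apply: sym_idem_trace0.
- by rewrite trmx_B trmx_D trmx1 sym_tangent_proj trmx_mul trmxK.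
- by rewrite mulmxBl mul1mx mulmxBr mulmx1 EE subrr subr0.
- rewrite mxtrace_B mxtraceD mxtrace1 mxtrace_mulC mul_jac_coframe// mxtrace1.
  by rewrite mxtrace_mulC unitN// mxtrace1 -natrD addn1 subrr.
Qed.

Lemma derive_normal x u : U x -> 'D_u N x = u *m 'J N x.
Proof. by move=> Ux; rewrite deriveEjacobian//; exact: smooth_differentiable Ux. Qed.

Lemma jac_normal_orth x : U x -> 'J N x *m (N x)^T = 0.
Proof.
move=> Ux; apply/row_matrixP => i; rewrite row_mul row0.
rewrite row_jacobian; last exact: smooth_differentiable Ux.
rewrite /partial; set u := delta_mx 0 i.
have sNT := smooth_trmx oU sN.
have : 'D_u (fun y => N y *m (N y)^T) x = 0.
  by rewrite (derive_ext u oU Ux unitN) derive_cst.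
rewrite (derive_mulmx u sN sNT Ux) (derive_trmx u sN Ux).
set a := 'D_u N x *m _; have -> : N x *m ('D_u N x)^T = a.
  by rewrite -[LHS]trmxK trmx_mul trmxK /a [RHS]mx11_scalar [X in X^T]mx11_scalar tr_scalar_mx.
move/eqP; rewrite -mulr2n -scaler_nat scaler_eq0 pnatr_eq0/= => /eqP.
by [].
Qed.

Lemma jac_normal_tangent x : U x -> 'J N x *m T x = 'J N x.
Proof.
move=> Ux; have := congr1 (mulmx ('J N x)) (tangent_normal_split Ux).
by rewrite mulmxDr mulmx1 (mulmxA _ (N x)^T) jac_normal_orth// mul0mx addr0.
Qed.

Lemma jac_normal_jac x a b : U x -> ('J N x *m (D x)^T) a b
  = - ('D_(delta_mx 0 a) (partial b F) x *m (N x)^T) 0 0.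
Proof.
move=> Ux.
set u := delta_mx 0 a.
have sb : smooth_on U (partial b F) := smooth_derive _ sF.
have dN := smooth_differentiable sN Ux.
have Nb y : U y -> partial b F y *m (N y)^T = 0.
  move=> Uy; rewrite -row_jacobian; last exact: smooth_differentiable Uy.
  by rewrite -row_mul normalN// row0.
have : 'D_u (fun y => partial b F y *m (N y)^T) x = 0.
  by rewrite (derive_ext u oU Ux Nb) derive_cst.
rewrite (derive_mulmx u sb (smooth_trmx oU sN) Ux) (derive_trmx u sN Ux).
move/(congr1 (fun M : 'M[R]_1 => M 0 0)); rewrite mxE [RHS]mxE => /eqP.
rewrite addrC addr_eq0 => /eqP <-.
rewrite -row_jacobian; last exact: smooth_differentiable Ux.
have -> : 'D_u N x = row a ('J N x) by rewrite row_jacobian.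
move: ('J N x) (D x) => P Q.
by rewrite !mxE; apply: eq_bigr => k _; rewrite !mxE mulrC.
Qed.

Lemma second_fundamental_sym x : U x ->
  'J N x *m (D x)^T = ('J N x *m (D x)^T)^T.
Proof.
move=> Ux; apply/matrixP => i j; rewrite [RHS]mxE.
have S : 'D_(delta_mx 0 i) (partial j F) x = 'D_(delta_mx 0 j) (partial i F) x.
  exact: Schwarz_mx oU sF Ux.
exact: (etrans (jac_normal_jac i j Ux) (etrans (congr1 (fun V => - (V *m (N x)^T) 0 0) S)
  (esym (jac_normal_jac j i Ux)))).
Qed.

Lemma sym_shape x : U x -> (A x)^T = A x.
Proof.
move=> Ux; rewrite /shape trmx_N; congr (- _).
have E : C x *m 'J N x = (D x)^T *m invmx (D x *m (D x)^T)
    *m ('J N x *m (D x)^T) *m invmx (D x *m (D x)^T) *m D x.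
  rewrite -[in LHS]jac_normal_tangent// /tangent_proj /coframe !mulmxA.
  by [].
have := second_fundamental_sym Ux; move: E.
have : (invmx (D x *m (D x)^T))^T = invmx (D x *m (D x)^T).
  by rewrite trmx_inv trmx_mul trmxK.
move: ('J N x *m _) (invmx _) => S G symG -> symS.
by rewrite !trmx_mul trmxK symG -symS !mulmxA.
Qed.

Lemma mul_jac_shape x : U x -> D x *m A x = - 'J N x.
Proof. by move=> Ux; rewrite /shape mulmxN mulmxA mul_jac_coframe// mul1mx. Qed.

Lemma mul_shape_tangent x : U x -> A x *m T x = A x.
Proof. by move=> Ux; rewrite /shape mulNmx -mulmxA jac_normal_tangent. Qed.

Lemma mul_tangent_shape x : U x -> T x *m A x = A x.
Proof. by move=> Ux; rewrite /shape mulmxN mulmxA mul_tangent_coframe. Qed.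

Lemma smooth_coframe : smooth_on U C.
Proof.
have sD := smooth_jacobian oU sF; have sDT := smooth_trmx oU sD.
apply: smooth_mulmx => //; apply: smooth_invmx => //.
exact: smooth_mulmx.
Qed.

Lemma smooth_tangent_proj : smooth_on U T.
Proof.
apply: smooth_mulmx => //; first exact: smooth_coframe.
exact: smooth_jacobian.
Qed.

Lemma smooth_shape : smooth_on U A.
Proof.
apply: smoothN => //; apply: smooth_mulmx => //; first exact: smooth_coframe.
exact: smooth_jacobian.
Qed.

Section ComplexStructure.
Variable J : 'rV[R]_n -> 'M[R]_n.
Hypothesis sJ : smooth_on U J.
Hypothesis JJ : forall x, U x -> J x *m J x = - 1%:M.
Hypothesis orthJ : forall x, U x ->
  J x *m (D x *m (D x)^T) *m (J x)^T = D x *m (D x)^T.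
Hypothesis parallelJ : forall u x, U x -> 'D_u J x
  + J x *m ('D_u D x *m C x) - 'D_u D x *m C x *m J x = 0.

Local Notation Jt := (ambient_endo F J).

Lemma ambient_endo_sqr x : U x -> Jt x *m Jt x = - T x.
Proof.
move=> Ux; have := mul_jac_coframe Ux; have := JJ Ux.
rewrite /ambient_endo /tangent_proj; move: (C x) (D x) (J x) => C0 D0 J0 JJ0 DC.
rewrite -!mulmxA (mulmxA D0) DC mul1mx (mulmxA J0) JJ0.
by rewrite mulNmx mul1mx mulmxN.
Qed.

Lemma mul_tangent_ambient x : U x -> T x *m Jt x = Jt x.
Proof. by move=> Ux; rewrite /ambient_endo 2!(mulmxA (T x)) mul_tangent_coframe. Qed.

Lemma mul_ambient_tangent x : U x -> Jt x *m T x = Jt x.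
Proof. by move=> Ux; rewrite /ambient_endo -(mulmxA _ (D x)) mul_jac_tangent. Qed.

Lemma mul_jac_ambient x : U x -> D x *m Jt x = J x *m D x.
Proof.
by move=> Ux; rewrite /ambient_endo 2!(mulmxA (D x)) mul_jac_coframe// mul1mx.
Qed.

Lemma skew_ambient x : U x -> (Jt x)^T = - Jt x.
Proof.
move=> Ux; rewrite /ambient_endo (trmx_mul (C x *m J x)) (trmx_mul (C x)).
rewrite tr_coframe /coframe.
set G := D x *m (D x)^T; have uG : G \in unitmx := gU Ux.
suff E : (J x)^T *m invmx G = - (invmx G *m J x).
  by rewrite !mulmxA -(mulmxA _ (J x)^T) E mulmxN mulNmx !mulmxA.
have oG : J x *m G *m (J x)^T = G := orthJ Ux.
clearbody G.
have E1 : G *m (J x)^T = - (J x *m G).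
  have := congr1 (mulmx^~ (J x)^T) oG; rewrite /= -(mulmxA (J x *m G)) -trmx_mul.
  by rewrite JJ// trmx_N trmx1 mulmxN mulmx1.
have := congr1 (fun M => invmx G *m M *m invmx G) E1.
by rewrite mulKmx// mulmxN mulNmx -!mulmxA mulmxV// mulmx1.
Qed.

Lemma smooth_ambient : smooth_on U Jt.
Proof.
apply: smooth_mulmx => //; last exact: smooth_jacobian.
by apply: smooth_mulmx => //; exact: smooth_coframe.
Qed.

Lemma mul_normal_tangent x : U x -> N x *m T x = 0.
Proof.
move=> Ux; rewrite -[LHS]trmxK trmx_mul sym_tangent_proj mul_tangent_normal//.
by rewrite trmx0.
Qed.

Lemma mul_ambient_normal x : U x -> Jt x *m (N x)^T = 0.
Proof.
by move=> Ux; rewrite -mul_ambient_tangent// -mulmxA mul_tangent_normal// mulmx0.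
Qed.

Lemma mul_normal_ambient x : U x -> N x *m Jt x = 0.
Proof.
by move=> Ux; rewrite -mul_tangent_ambient// mulmxA mul_normal_tangent// mul0mx.
Qed.

Lemma derive_normal_tangent x u : U x -> 'D_u N x *m T x = 'D_u N x.
Proof.
by move=> Ux; rewrite derive_normal// -mulmxA jac_normal_tangent.
Qed.

Lemma tangential_derive_ambient x u : U x -> T x *m 'D_u Jt x *m T x = 0.
Proof.
move=> Ux; rewrite {1}/tangent_proj -!mulmxA (mulmxA (D x)).
suff -> : D x *m 'D_u Jt x *m T x = 0 by rewrite !mulmx0.
have sD := smooth_jacobian oU sF.
have : 'D_u (fun y => D y *m Jt y) x = 'D_u (fun y => J y *m D y) x.
  by apply: (derive_ext u oU Ux) => y Uy; exact: mul_jac_ambient.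
rewrite (derive_mulmx u sD smooth_ambient Ux) (derive_mulmx u sJ sD Ux) addrC.
move/(congr1 (fun M => M *m T x)); rewrite !mulmxDl => /(canRL (addrK _)) ->.
rewrite -(mulmxA _ (Jt x)) mul_ambient_tangent//.
rewrite -(mulmxA _ (D x)) mul_jac_tangent//.
have -> : 'D_u D x *m Jt x = 'D_u D x *m C x *m J x *m D x.
  by rewrite /ambient_endo !mulmxA.
have -> : J x *m 'D_u D x *m T x = J x *m ('D_u D x *m C x) *m D x.
  by rewrite /tangent_proj !mulmxA.
by rewrite -mulmxDl -mulmxBl parallelJ// mul0mx.
Qed.

Lemma derive_ambient x u : U x -> 'D_u Jt x =
  - (Jt x *m ('D_u N x)^T *m N x) - (N x)^T *m 'D_u N x *m Jt x.
Proof.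
move=> Ux; set dJ := 'D_u Jt x; set dN := 'D_u N x.
have sJt := smooth_ambient; have sNT := smooth_trmx oU sN.
have dJN : dJ *m (N x)^T = - (Jt x *m dN^T).
  apply/eqP; rewrite -addr_eq0; apply/eqP.
  rewrite -(derive_trmx u sN Ux) -(derive_mulmx u sJt sNT Ux).
  by rewrite (derive_ext u oU Ux mul_ambient_normal) derive_cst.
have NdJ : N x *m dJ = - (dN *m Jt x).
  apply/eqP; rewrite -addr_eq0 addrC; apply/eqP.
  rewrite -(derive_mulmx u sN sJt Ux).
  by rewrite (derive_ext u oU Ux mul_normal_ambient) derive_cst.
have TdT : T x *m dJ *m T x = 0 := tangential_derive_ambient u Ux.
have TJ := mul_tangent_ambient Ux; have JT := mul_ambient_tangent Ux.
have NJ := mul_normal_ambient Ux.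
have := tangent_normal_split Ux; move: (T x) (Jt x) (N x) TdT TJ JT NJ dJN NdJ.
clearbody dJ dN => {sJt sNT}; move=> T0 J0 N0 TdT TJ JT NJ dJN NdJ E.
rewrite -[LHS]mul1mx -[LHS]mulmx1 -E !(mulmxDl, mulmxDr) TdT add0r.
rewrite -!mulmxA (mulmxA dJ N0^T) dJN (mulmxA N0 dJ T0) NdJ.
by rewrite !(mulNmx, mulmxN) -!mulmxA JT (mulmxA N0 J0) NJ !mul0mx !mulmx0
  oppr0 addr0 (mulmxA T0 J0) TJ addrC.
Qed.

Lemma gauss_equation x u v : U x ->
  Jt x *m ('D_u N x)^T *m 'D_v N x + ('D_v N x)^T *m 'D_u N x *m Jt x =
  Jt x *m ('D_v N x)^T *m 'D_u N x + ('D_u N x)^T *m 'D_v N x *m Jt x.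
Proof.
move=> Ux.
have sJt := smooth_ambient; have sNT := smooth_trmx oU sN.
have E a b : T x *m 'D_b (fun y => 'D_a Jt y) x *m T x =
    - (Jt x *m ('D_a N x)^T *m 'D_b N x + ('D_b N x)^T *m 'D_a N x *m Jt x).
  pose P y := Jt y *m ('D_a N y)^T.
  pose Q y := (N y)^T *m 'D_a N y.
  have sDa : smooth_on U (fun y => 'D_a N y) := smooth_derive a sN.
  have sP : smooth_on U P.
    by apply: smooth_mulmx => //; exact: smooth_trmx.
  have sQ : smooth_on U Q by exact: smooth_mulmx.
  have sPN : smooth_on U (fun y => P y *m N y) by exact: smooth_mulmx.
  have sQJ : smooth_on U (fun y => Q y *m Jt y) by exact: smooth_mulmx.
  have -> : 'D_b (fun y => 'D_a Jt y) x
      = - ('D_b (fun y => P y *m N y) x) - 'D_b (fun y => Q y *m Jt y) x.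
    rewrite (derive_ext b oU Ux (fun y => @derive_ambient y a)).
    have [dP dQ] := (smooth_is_derive b sPN Ux, smooth_is_derive b sQJ Ux).
    apply: derive_val; exact: (is_deriveB (is_deriveN dP) dQ).
  rewrite (derive_mulmx b sP sN Ux) (derive_mulmx b sQ sJt Ux).
  rewrite /Q (derive_mulmx b sNT sDa Ux) (derive_trmx b sN Ux) -/(Q x) /P.
  have NT := mul_normal_tangent Ux; have TN := mul_tangent_normal Ux.
  have NJ := mul_normal_ambient Ux; have TJ := mul_tangent_ambient Ux.
  have JT := mul_ambient_tangent Ux.
  have bT := derive_normal_tangent b Ux.
  have Tb : T x *m ('D_b N x)^T = ('D_b N x)^T.
    by rewrite -[LHS]trmxK trmx_mul trmxK sym_tangent_proj bT.
  rewrite /Q; move: ('D_b _ x) ('D_b (fun y => 'D_a N y) x) ('D_b Jt x) => X Y Z.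
  move: NT TN NJ TJ JT bT Tb.
  move: (T x) (Jt x) (N x) ('D_a N x) ('D_b N x) => T0 J0 N0 a0 b0.
  move=> NT TN NJ TJ JT bT Tb.
  rewrite !(mulmxDl, mulmxDr, mulmxN, mulNmx, opprD) -!mulmxA.
  rewrite NT bT JT (mulmxA T0 b0^T) Tb !(mulmxA T0 N0^T) TN (mulmxA T0 J0) TJ.
  by rewrite !(mulmx0, mul0mx, oppr0, add0r, addr0).
have S : 'D_u (fun y => 'D_v Jt y) x = 'D_v (fun y => 'D_u Jt y) x.
  exact: Schwarz_mx oU sJt Ux.
apply: oppr_inj; exact: (etrans (esym (E u v))
  (etrans (congr1 (fun M => T x *m M *m T x) (esym S)) (E v u))).
Qed.

Variable t : R.
Hypotheses (t_neq0 : t != 0) (trA : forall x, U x -> \tr (A x) = t).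

Local Notation Q := (curved_endo F N J).

Lemma shape_curved x : U x -> A x *m Q x = t *: A x.
Proof.
move=> Ux; rewrite -(trA Ux); apply: gauss_contraction.
- exact: sym_shape.
- exact: skew_ambient.
- by rewrite -mulmxA ambient_endo_sqr// mulmxN mul_shape_tangent.
have rowA i : row i (A x) = - 'D_(delta_mx 0 i *m C x) N x.
  by rewrite rowE /shape derive_normal// mulmxN mulmxA.
move=> i j; move: (rowA i) (rowA j).
have := gauss_equation (delta_mx 0 i *m C x) (delta_mx 0 j *m C x) Ux.
move: ('D_(delta_mx 0 i *m C x) N x) ('D_(delta_mx 0 j *m C x) N x).
move=> a b G -> ->.
by rewrite !trmx_N !(mulmxN, mulNmx) !opprK.
Qed.

Lemma codazzi_shape x u v : U x ->
  u *m D x *m 'D_v A x = v *m D x *m 'D_u A x.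
Proof.
move=> Ux.
have dF w y : U y -> 'D_w F y = w *m D y.
  by move=> Uy; rewrite deriveEjacobian//; exact: smooth_differentiable Uy.
have E a b : 'D_b (fun y => 'D_a N y) x
    = - ('D_b (fun y => 'D_a F y) x *m A x + a *m D x *m 'D_b A x).
  have Na y : U y -> 'D_a N y = - ('D_a F y *m A y).
    by move=> Uy; rewrite dF// -mulmxA mul_jac_shape// mulmxN opprK derive_normal.
  have sDa : smooth_on U (fun y => 'D_a F y) := smooth_derive a sF.
  have sA := smooth_shape.
  rewrite (derive_ext b oU Ux Na).
  have sP : smooth_on U (fun y => 'D_a F y *m A y) by exact: smooth_mulmx.
  rewrite -(dF a x Ux) -(derive_mulmx b sDa sA Ux); apply: derive_val.
  exact: is_deriveN (smooth_is_derive b sP Ux).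
have SF : 'D_v (fun y => 'D_u F y) x = 'D_u (fun y => 'D_v F y) x.
  exact: Schwarz_mx oU sF Ux.
have SN : 'D_v (fun y => 'D_u N y) x = 'D_u (fun y => 'D_v N y) x.
  exact: Schwarz_mx oU sN Ux.
have := etrans (esym (E u v)) (etrans SN (E v u)).
by move/oppr_inj; rewrite SF => /addrI.
Qed.

Lemma smooth_curved : smooth_on U Q.
Proof.
have sA := smooth_shape; have sJt := smooth_ambient.
apply: smoothD => //; apply: smoothN => //; apply: smooth_mulmx => //.
exact: smooth_mulmx.
Qed.

Lemma derive_curved x u : U x ->
  T x *m 'D_u Q x *m T x = T x *m 'D_u A x *m T x
    - Jt x *m (T x *m 'D_u A x *m T x) *m Jt x.
Proof.
move=> Ux; have sA := smooth_shape; have sJt := smooth_ambient.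
have sJA : smooth_on U (fun y => Jt y *m A y) by exact: smooth_mulmx.
have sJAJ : smooth_on U (fun y => Jt y *m A y *m Jt y) by exact: smooth_mulmx.
have -> : 'D_u Q x = 'D_u A x - 'D_u (fun y => Jt y *m A y *m Jt y) x.
  apply: derive_val.
  exact: is_deriveB (smooth_is_derive u sA Ux) (smooth_is_derive u sJAJ Ux).
rewrite (derive_mulmx u sJA sJt Ux) (derive_mulmx u sJt sA Ux).
have := tangential_derive_ambient u Ux.
have := mul_tangent_ambient Ux; have := mul_ambient_tangent Ux.
have := mul_tangent_shape Ux; have := mul_shape_tangent Ux.
move: ('D_u A x) ('D_u Jt x) (T x) (A x) (Jt x) => dA dJ T0 A0 J0 AT TA JT TJ E.
have E1 : T0 *m dJ *m A0 = 0 by rewrite -TA mulmxA E mul0mx.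
have E2 : A0 *m dJ *m T0 = 0 by rewrite -AT -!mulmxA (mulmxA T0) E mulmx0.
rewrite mulmxBr mulmxBl; congr (_ - _).
rewrite mulmxDr mulmxDl (mulmxDl (dJ *m A0)) mulmxDr mulmxDl.
rewrite !mulmxA E1 !mul0mx add0r -(mulmxA (T0 *m J0) A0) -(mulmxA (T0 *m J0) _ T0) E2.
by rewrite mulmx0 addr0 -!mulmxA JT (mulmxA T0 J0) TJ (mulmxA J0 T0) JT.
Qed.

Lemma derive_shape_curved x u : U x ->
  T x *m 'D_u A x *m T x *m Q x + A x *m (T x *m 'D_u Q x *m T x)
    = t *: (T x *m 'D_u A x *m T x).
Proof.
move=> Ux; have sA := smooth_shape; have sQ := smooth_curved.
have : 'D_u (fun y => A y *m Q y) x = t *: 'D_u A x.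
  rewrite (derive_ext u oU Ux shape_curved); apply: derive_val.
  exact: is_deriveZ (smooth_is_derive u sA Ux).
rewrite (derive_mulmx u sA sQ Ux) => /(congr1 (fun M => T x *m M *m T x)).
have QT : Q x *m T x = Q x.
  rewrite /curved_endo mulmxBl mul_shape_tangent//.
  by rewrite -(mulmxA _ _ (T x)) mul_ambient_tangent.
have TQ : T x *m Q x = Q x.
  rewrite /curved_endo mulmxBr mul_tangent_shape//.
  by rewrite 2!(mulmxA (T x)) mul_tangent_ambient.
have := mul_tangent_shape Ux; have := mul_shape_tangent Ux.
move: ('D_u A x) ('D_u Q x) (T x) (A x) (Q x) QT TQ => dA dQ T0 A0 Q0 QT TQ AT TA.
rewrite mulmxDr mulmxDl -scalemxAr -scalemxAl => <-.
rewrite -!mulmxA QT TQ (mulmxA T0 A0) TA; congr (_ + _).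
by rewrite (mulmxA A0 T0) AT.
Qed.

Lemma tangential_derive_curved x u : U x -> T x *m 'D_u Q x *m T x = 0.
Proof.
pose e y X := T y *m 'D_(X *m C y) A y *m T y.
have symA y : U y -> forall X, (e y X)^T = e y X.
  move=> Uy X; rewrite /e; set v := X *m C y.
  have : ('D_v A y)^T = 'D_v A y.
    rewrite -(derive_trmx v smooth_shape Uy).
    by apply: (derive_ext v oU Uy) => z Uz; exact: sym_shape.
  move: (sym_tangent_proj y); move: (T y) ('D_v A y) => T0 dA sT sA.
  by rewrite !trmx_mul sT sA mulmxA.
have eT y : U y -> forall X, e y X *m T y = e y X.
  by move=> Uy X; rewrite /e -mulmxA tangent_projK.
have cod y : U y -> forall X Y, X *m T y = X -> Y *m T y = Y ->
    X *m e y Y = Y *m e y X.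
  move=> Uy X Y XT YT; rewrite /e 2!(mulmxA X) 2!(mulmxA Y) XT YT.
  have := codazzi_shape (X *m C y) (Y *m C y) Uy.
  by rewrite -!(mulmxA _ (C y)) XT YT => ->.
have dq y : U y -> forall X, e y X - Jt y *m e y X *m Jt y
    = T y *m 'D_(X *m C y) Q y *m T y.
  by move=> Uy X; rewrite derive_curved.
have dAQ y : U y -> forall X,
    e y X *m Q y + A y *m (e y X - Jt y *m e y X *m Jt y) = t *: e y X.
  by move=> Uy X; rewrite dq// derive_shape_curved.
have vert y v : U y -> T y *m 'D_v Q y *m T y != 0 ->
    exists tau, [/\ tau *m T y = tau, tau *m Q y = 0 & e y tau != 0].
  move=> Uy qN0; apply: contrapT => H.
  have e0 tau : tau *m T y = tau /\ tau *m Q y = 0 -> e y tau = 0.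
    move=> [tT tQ]; apply/eqP/negPn/negP => eN0.
    by apply: H; exists tau.
  have XT : v *m D y *m T y = v *m D y by rewrite -mulmxA mul_jac_tangent.
  have := vertical_parallel t_neq0 (tangent_projK Uy) (sym_tangent_proj y)
    (ambient_endo_sqr Uy) (mul_tangent_ambient Uy) (mul_ambient_tangent Uy)
    (skew_ambient Uy) (mul_shape_tangent Uy) (mul_tangent_shape Uy)
    (sym_shape Uy) (shape_curved Uy) (symA _ Uy) (eT _ Uy) (cod _ Uy)
    (dAQ _ Uy) e0 XT.
  rewrite dq// -(mulmxA v) mul_jac_coframe// mulmx1.
  by move/eqP; rewrite (negPf qN0).
pose q v y := T y *m 'D_v Q y *m T y.
have sT := smooth_tangent_proj; have sQ := smooth_curved.
have sq v : smooth_on U (q v).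
  apply: smooth_mulmx => //; apply: smooth_mulmx => //.
  exact: smooth_derive.
move=> Ux; apply: contrapT => /eqP qN0.
have /nbhs_interior Nx : nbhs x (U `&` [set y | q u y != 0]).
  apply: filterI; first exact: open_nbhs_nbhs.
  exact: near_neq0 (smooth_continuous (sq u) Ux) qN0.
set O := interior _ in Nx; have oO : open O := open_interior _.
have Ox : O x := nbhs_singleton Nx.
have OU y : O y -> U y /\ q u y != 0 by move/interior_subset.
have umb y : O y -> A y = 2^-1 *: Q y.
  move=> /OU[Uy qy]; have [tau [tT tQ eN0]] := vert y u Uy qy.
  apply/eqP; rewrite -subr_eq0; apply/eqP.
  have vt : tau *m T y = tau /\ tau *m Q y = 0 by [].
  apply: (rank2_eq0 t_neq0 (ambient_endo_sqr Uy) (mul_ambient_tangent Uy)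
    (skew_ambient Uy) (mul_shape_tangent Uy) (mul_tangent_shape Uy)
    (sym_shape Uy) (shape_curved Uy) (trA Uy) eN0).
    exact: (vertical_eQ t_neq0 (tangent_projK Uy) (sym_tangent_proj y)
      (ambient_endo_sqr Uy) (mul_ambient_tangent Uy)
      (skew_ambient Uy) (mul_shape_tangent Uy) (mul_tangent_shape Uy)
      (sym_shape Uy) (shape_curved Uy) (symA _ Uy) (eT _ Uy) (cod _ Uy)
      (dAQ _ Uy) vt).
  exact: (vertical_traceless t_neq0 (tangent_projK Uy) (sym_tangent_proj y)
    (ambient_endo_sqr Uy) (mul_ambient_tangent Uy)
    (skew_ambient Uy) (mul_shape_tangent Uy) (mul_tangent_shape Uy)
    (sym_shape Uy) (shape_curved Uy) (symA _ Uy) (eT _ Uy) (cod _ Uy)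
    (dAQ _ Uy) vt).
have [tau [tT tQ /eqP]] := vert x u Ux qN0; apply.
have vt : tau *m T x = tau /\ tau *m Q x = 0 by [].
apply: (umbilic_vertical t_neq0 (tangent_projK Ux) (sym_tangent_proj x)
  (ambient_endo_sqr Ux) (mul_ambient_tangent Ux)
  (skew_ambient Ux) (mul_shape_tangent Ux) (mul_tangent_shape Ux)
  (sym_shape Ux) (shape_curved Ux) (symA _ Ux) (eT _ Ux) (cod _ Ux)
  (dAQ _ Ux) vt).
rewrite dq// /e; have -> : 'D_(tau *m C x) A x = 2^-1 *: 'D_(tau *m C x) Q x.
  rewrite (derive_ext _ oO Ox umb); apply: derive_val.
  exact: is_deriveZ (smooth_is_derive _ sQ Ux).
by rewrite -scalemxAr -scalemxAl.
Qed.

Lemma derive_flat_proj x u : U x ->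
  'D_u (fun y => T y - t^-1 *: Q y) x = 0.
Proof.
move=> Ux; pose K y := T y - t^-1 *: Q y; rewrite -/K.
have sT := smooth_tangent_proj; have sQ := smooth_curved.
have sK : smooth_on U K.
  apply: smoothD => //; apply: smoothN => // k.
  apply/(Ck_mxP _ _ oU) => i j.
  under eq_fun do rewrite mxE; apply: CkM => //; first exact: Ck_cst.
  exact: ((smooth_mxP _ oU).1 sQ).
have symQ y : U y -> (Q y)^T = Q y.
  by move=> Uy; apply: sym_Q; [exact: skew_ambient|exact: sym_shape].
have symK y : U y -> (K y)^T = K y.
  by move=> Uy; rewrite /K trmx_B trmx_Z symQ// sym_tangent_proj.
have QN y : U y -> Q y *m (N y)^T = 0.
  move=> Uy; rewrite /curved_endo mulmxBl -[_ *m _ *m _ *m (N y)^T]mulmxA.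
  rewrite mul_ambient_normal// mulmx0 subr0 -mul_shape_tangent// -mulmxA.
  by rewrite mul_tangent_normal// mulmx0.
have KN y : U y -> K y *m (N y)^T = 0.
  by move=> Uy; rewrite /K mulmxBl mul_tangent_normal// -scalemxAl QN// scaler0 subr0.
have KA : K x *m A x = 0.
  have QA : Q x *m A x = t *: A x.
    rewrite -[LHS]trmxK trmx_mul symQ// sym_shape// shape_curved//.
    by rewrite trmx_Z sym_shape.
  by rewrite /K mulmxBl mul_tangent_shape// -scalemxAl QA scalerA mulVf// scale1r subrr.
have symdK : ('D_u K x)^T = 'D_u K x.
  by rewrite -(derive_trmx u sK Ux); exact: (derive_ext u oU Ux symK).
have dKN : 'D_u K x *m (N x)^T = 0.
  have := derive_mulmx u sK (smooth_trmx oU sN) Ux.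
  rewrite (derive_ext u oU Ux KN) derive_cst (derive_trmx u sN Ux).
  have -> : 'D_u N x = - (u *m D x *m A x).
    by rewrite derive_normal// -mulmxA mul_jac_shape// mulmxN opprK.
  rewrite trmx_N trmx_mul sym_shape// mulmxN (mulmxA (K x)) KA mul0mx oppr0 addr0.
  by move=> <-.
have NdK : N x *m 'D_u K x = 0.
  by rewrite -[LHS]trmxK trmx_mul symdK dKN trmx0.
have TdTT : T x *m 'D_u T x *m T x = 0.
  have := derive_mulmx u sT sT Ux.
  rewrite (derive_ext u oU Ux tangent_projK) => /(congr1 (fun M => T x *m M *m T x)).
  have := tangent_projK Ux; move: ('D_u T x) (T x) => dT T0 TT.
  rewrite mulmxDr mulmxDl !mulmxA TT -!(mulmxA _ T0 T0) TT => /eqP.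
  by rewrite -subr_eq0 opprD addrA subrr add0r oppr_eq0 => /eqP.
have TdK : T x *m 'D_u K x *m T x = 0.
  have -> : 'D_u K x = 'D_u T x - t^-1 *: 'D_u Q x.
    apply: derive_val.
    exact: is_deriveB (smooth_is_derive u sT Ux) (is_deriveZ _ (smooth_is_derive u sQ Ux)).
  rewrite mulmxBr mulmxBl TdTT -scalemxAr -scalemxAl tangential_derive_curved//.
  by rewrite scaler0 subr0.
have := tangent_normal_split Ux.
move: ('D_u K x) (T x) (N x) dKN NdK TdK => dK T0 N0 dKN NdK TdK E.
rewrite -[LHS]mul1mx -[LHS]mulmx1 -E !(mulmxDl, mulmxDr) TdK add0r.
by rewrite -!mulmxA (mulmxA dK) dKN (mulmxA N0) NdK !(mul0mx, mulmx0) !addr0.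
Qed.

End ComplexStructure.
End LocalHypersurface.

(** * Isometric immersions in charts *)

Lemma christoffel_symbols_gram (R : realFieldType) n (G : 'M[R]_n)
    (P S : 'I_n -> 'M[R]_n) k l i : G^T = G ->
  (forall a p q, P a p q = S a p q + S a q p) ->
  (forall a p q, S a p q = S p a q) ->
  2^-1 * \sum_(p < n) G k p * (P l i p + P i l p - P p l i) = (S l *m G) i k.
Proof.
move=> symG PE Ssym; rewrite [RHS]mxE mulr_sumr; apply: eq_bigr => p _.
rewrite !PE (Ssym l p i) (Ssym i p l) (Ssym i l p).
have -> : G k p = G p k by rewrite -{1}symG mxE.
by move: (S l i p) (S p l i) (S p i l) (G p k) => a b d e; field.
Qed.

Lemma mxtrace_sandwich (R : comPzRingType) n m (D L : 'M[R]_(n, m))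
    (G : 'M[R]_n) : G^T = G ->
  \tr (D^T *m G *m L) = \sum_i \sum_j G i j * (L *m D^T) i j.
Proof.
move=> symG; rewrite -mulmxA mxtrace_mulC -mulmxA.
under [LHS]eq_bigr do rewrite mxE.
rewrite exchange_big; apply: eq_bigr => i _; apply: eq_bigr => j _.
by rewrite -[in LHS]symG mxE.
Qed.

Section IsometricImmersion.
Context {R : realType} {n : nat} {M : manifold R n} {m : nat}.
Variables (g : riemannian_metric M) (f : M -> 'rV[R]_m) (c : chart M).
Hypothesis isof : isometric_immersion g f.
Local Notation U := (img c).
Local Notation F := (local_rep f c).
Local Notation D := (jacobian F).

Lemma open_img : open U.
Proof. exact: img_open. Qed.

Lemma smooth_local_rep : smooth_on U F.
Proof. by case: isof => /(_ c)[]. Qed.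

Lemma free_local_rep x : U x -> row_free (D x).
Proof. by case: isof => /(_ c)[_ +] _; exact. Qed.

Lemma metricE x : U x -> g c x = D x *m (D x)^T.
Proof. by case: isof => _; exact. Qed.

Let oU := open_img.
Let sF := smooth_local_rep.

Lemma row_derive_jac x i u : U x -> row i ('D_u D x) = 'D_u (partial i F) x.
Proof.
move=> Ux; have [_ ->] := derive_jacobian u oU sF Ux.
exact: rowK.
Qed.

Lemma derive_jac_sym x i j : U x ->
  row i ('D_(delta_mx 0 j) D x) = row j ('D_(delta_mx 0 i) D x).
Proof.
move=> Ux; rewrite (row_derive_jac i _ Ux) (row_derive_jac j _ Ux).
exact: Schwarz_mx oU sF Ux.
Qed.

Lemma christoffelE x k l i : U x ->
  christoffel g c x k l i = ('D_(delta_mx 0 l) D x *m coframe F x) i k.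
Proof.
move=> Ux; have sD := smooth_jacobian oU sF; have sDT := smooth_trmx oU sD.
pose S a := 'D_(delta_mx 0 a) D x *m (D x)^T.
have gE a p q : partial a (g c) x p q = S a p q + S a q p.
  rewrite /partial (derive_ext _ oU Ux metricE).
  rewrite (derive_mulmx _ sD sDT Ux) (derive_trmx _ sD Ux) mxE; congr (_ + _).
  have -> : D x *m ('D_(delta_mx 0 a) D x)^T = (S a)^T by rewrite /S trmx_mul trmxK.
  by rewrite mxE.
have Ssym a p q : S a p q = S p a q.
  have E b r : S b r q = (row r ('D_(delta_mx 0 b) D x) *m (D x)^T) 0 q.
    by rewrite -row_mul [RHS]mxE.
  exact: (etrans (E a p) (etrans
    (congr1 (fun X : 'rV_m => (X *m (D x)^T) 0 q) (derive_jac_sym p a Ux))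
    (esym (E p a)))).
have symG : (invmx (D x *m (D x)^T))^T = invmx (D x *m (D x)^T).
  by rewrite trmx_inv trmx_mul trmxK.
have CE : 'D_(delta_mx 0 l) D x *m coframe F x = S l *m invmx (D x *m (D x)^T).
  by rewrite /coframe mulmxA.
rewrite CE /christoffel (metricE Ux).
exact: (@christoffel_symbols_gram R n _ (fun a => partial a (g c) x) S k l i
  symG gE Ssym).
Qed.

Lemma second_fundamental_formE x i j : U x ->
  second_fundamental_form g f c x i j =
    partial i (partial j F) x *m (1%:M - tangent_proj F x).
Proof.
move=> Ux; rewrite /second_fundamental_form mulmxBr mulmx1; congr (_ - _).
rewrite -[partial i (partial j F) x](row_derive_jac j _ Ux) /tangent_proj.
rewrite mulmxA -row_mul -row_mul row_mul; set W := _ *m coframe F x.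
rewrite [RHS]mulmx_sum_row; apply: eq_bigr => k _.
rewrite christoffelE// -/W [row j W 0 k]mxE row_jacobian//.
exact: smooth_differentiable sF Ux.
Qed.

End IsometricImmersion.

Section Hypersurface.
Context {R : realType} {n : nat} {M : manifold R n}.
Variables (g : riemannian_metric M) (f : M -> 'rV[R]_n.+1) (c : chart M).
Hypothesis isof : isometric_immersion g f.
Local Notation U := (img c).
Local Notation F := (local_rep f c).
Local Notation D := (jacobian F).
Variable N : 'rV[R]_n -> 'rV[R]_n.+1.
Hypotheses (sN : smooth_on U N)
  (unitN : forall x, U x -> N x *m (N x)^T = 1%:M)
  (normalN : forall x, U x -> D x *m (N x)^T = 0).

Let oU := @open_img _ _ _ c.
Let sF := @smooth_local_rep _ _ _ _ _ _ c isof.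

Lemma mean_curvature_vector_shape x : U x ->
  mean_curvature_vector g f c x = (n%:R^-1 * \tr (shape F N x)) *: N x.
Proof.
move=> Ux; have fF := @free_local_rep _ _ _ _ _ _ c isof.
have E i j : second_fundamental_form g f c x i j
    = - ('J N x *m (D x)^T) i j *: N x.
  rewrite (second_fundamental_formE isof)//.
  have := tangent_normal_split fF unitN normalN Ux.
  move=> <-; rewrite [tangent_proj F x + _]addrC addrK mulmxA.
  rewrite [_ *m (N x)^T]mx11_scalar mul_scalar_mx; congr (_ *: _).
  by rewrite (jac_normal_jac oU sF sN normalN) ?opprK.
rewrite /mean_curvature_vector -scalerA; congr (_ *: _).
have -> : \tr (shape F N x) = - \sum_(i < n) \sum_(j < n)
    invmx (g c x) i j * ('J N x *m (D x)^T) i j.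
  rewrite /shape mxtrace_N; congr (- _).
  rewrite (metricE isof Ux); apply: mxtrace_sandwich.
  by rewrite trmx_inv trmx_mul trmxK.
rewrite -sumrN scaler_suml; apply: eq_bigr => i _.
rewrite -sumrN scaler_suml; apply: eq_bigr => j _.
by rewrite E scalerA mulrN.
Qed.

Lemma mean_curvature_shape x : U x ->
  mean_curvature g f c x = `|n%:R^-1 * \tr (shape F N x)|.
Proof.
move=> Ux; rewrite /mean_curvature mean_curvature_vector_shape// /eucl_norm.
set a := _ * \tr _; have -> : \sum_(k < n.+1) (a *: N x) 0 k ^+ 2 = a ^+ 2.
  have := congr1 (fun X : 'M[R]_1 => X 0 0) (unitN Ux); rewrite [RHS]mxE/= mxE.
  rewrite mulr1n => E; rewrite -[RHS]mulr1 -E mulr_sumr; apply: eq_bigr => k _.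
  by rewrite !mxE exprMn.
exact: sqrtr_sqr.
Qed.

End Hypersurface.

(** * The constant splitting of the ambient space *)

Section FlatProjection.
Context {R : realType} {n : nat} (U : set 'rV[R]_n).
Variables (F N : 'rV[R]_n -> 'rV[R]_n.+1) (J : 'rV[R]_n -> 'M[R]_n) (t : R).
Hypotheses (oU : open U) (sF : smooth_on U F) (sN : smooth_on U N)
  (freeF : forall x, U x -> row_free ('J F x))
  (unitN : forall x, U x -> N x *m (N x)^T = 1%:M)
  (normalN : forall x, U x -> 'J F x *m (N x)^T = 0)
  (sJ : smooth_on U J) (JJ : forall x, U x -> J x *m J x = - 1%:M)
  (orthJ : forall x, U x ->
    J x *m ('J F x *m ('J F x)^T) *m (J x)^T = 'J F x *m ('J F x)^T)
  (parallelJ : forall u x, U x -> 'D_u J x + J x *m ('D_u (jacobian F) x *m coframe F x)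
      - 'D_u (jacobian F) x *m coframe F x *m J x = 0)
  (t_neq0 : t != 0) (trA : forall x, U x -> \tr (shape F N x) = t).

(* By [shape_curved] the curved endomorphism divided by t is a projection; this
   is the orthogonal projection onto the tangent vectors v with v A = v J A = 0. *)
Definition flat_proj x := tangent_proj F x - t^-1 *: curved_endo F N J x.

Local Notation K := flat_proj.
Local Notation T := (tangent_proj F).
Local Notation A := (shape F N).
Local Notation Q := (curved_endo F N J).

Lemma smooth_flat_proj : smooth_on U K.
Proof.
have sT := smooth_tangent_proj oU sF freeF.
have sQ := smooth_curved oU sF sN freeF sJ.
apply: smoothD => //; apply: smoothN => // k.
apply/(Ck_mxP _ _ oU) => i j.
under eq_fun do rewrite mxE; apply: CkM => //; first exact: Ck_cst.
exact: ((smooth_mxP _ oU).1 sQ).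
Qed.

Lemma flat_projP x : U x -> [/\ (K x)^T = K x, K x *m K x = K x,
  \tr (K x) = n%:R - 2%:R, N x *m K x = 0 & 'J N x *m K x = 0].
Proof.
move=> Ux.
have TT := tangent_projK freeF Ux.
have symT := sym_tangent_proj F x.
have AQ := shape_curved oU sF sN freeF unitN normalN sJ JJ orthJ parallelJ trA Ux.
have NT : N x *m T x = 0.
  by rewrite -[LHS]trmxK trmx_mul symT (mul_tangent_normal normalN Ux) trmx0.
have DA := mul_jac_shape N freeF Ux.
have trT : \tr (T x) = n%:R.
  by rewrite /tangent_proj mxtrace_mulC (mul_jac_coframe freeF Ux) mxtrace1.
have AT := mul_shape_tangent oU sN freeF unitN normalN Ux.
have TA := mul_tangent_shape N freeF Ux.
have symA := sym_shape oU sF sN freeF unitN normalN Ux.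
have JtJt := ambient_endo_sqr freeF JJ Ux.
have TJ := mul_tangent_ambient freeF J Ux.
have JT := mul_ambient_tangent freeF J Ux.
have skJ := skew_ambient freeF JJ orthJ Ux.
have symQ : (Q x)^T = Q x := sym_Q skJ symA.
have QA : Q x *m A x = t *: A x.
  by have := congr1 trmx AQ; rewrite trmx_mul symQ symA trmx_Z symA.
have QQ : Q x *m Q x = t *: Q x := Q_sqr (V := 'M[R]_n.+1) JtJt AT TA QA.
have TQ : T x *m Q x = Q x.
  by rewrite /curved_endo mulmxBr TA 2!(mulmxA (T x)) TJ.
have QT : Q x *m T x = Q x.
  by have := congr1 trmx TQ; rewrite trmx_mul symQ symT.
have trQ : \tr (Q x) = t *+ 2 := trace_Q JtJt AT (trA Ux).
have AK : A x *m K x = 0.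
  rewrite /K mulmxBr AT -scalemxAr AQ scalerA mulVf// scale1r; exact: subrr.
split.
- by rewrite /K trmx_B trmx_Z symQ symT.
- rewrite /K; move: (T x) (Q x) TT TQ QT QQ => T0 Q0 TT TQ QT QQ.
  rewrite mulmxBl !mulmxBr TT -!scalemxAr TQ -!scalemxAl QT QQ (scalerA _ t).
  rewrite mulVf// scale1r; move: (_ *: Q0) => b.
  by rewrite subrr subr0.
- by rewrite /K mxtrace_B mxtrace_Z trT trQ mulrnAr mulVf.
- rewrite /K mulmxBr NT sub0r -scalemxAr -TQ (mulmxA (N x)) NT mul0mx scaler0.
  exact: oppr0.
- by rewrite -[X in X *m _]opprK -DA mulNmx -(mulmxA _ (A x)) AK mulmx0 oppr0.
Qed.

End FlatProjection.

Lemma ball_segment (R : realType) (V : normedModType R) (x y : V) (e s : R) :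
  ball x e y -> 0 <= s <= 1 -> ball x e (x + s *: (y - x)).
Proof.
move=> xy /andP[s0 s1]; move: xy; rewrite -!ball_normE/= opprD addNKr normrN normrZ.
by apply: le_lt_trans; rewrite ger0_norm// distrC ler_piMl.
Qed.

Lemma derive0_const_ball (R : realType) n p q (F : 'rV[R]_n -> 'M[R]_(p, q)) x (e : R) y :
  smooth_on (ball x e) F -> (forall z u, ball x e z -> 'D_u F z = 0) ->
  ball x e y -> F y = F x.
Proof.
move=> sF dF xy; have seg s := ball_segment (s := s) xy.
apply/matrixP => i j.
have dFij s : 0 <= s <= 1 -> differentiable (fun z => F z i j) (x + s *: (y - x)).
  by move=> s01; apply: (mx_differentiableP _ _).1; apply: smooth_differentiable sF _; exact: seg.
have [s /andP[s0 s1]] := line_MVT ltr01 dFij.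
have s01 : 0 <= s <= 1 by rewrite !ltW.
move/is_derive_mxP: (smooth_is_derive (y - x) sF (seg _ s01)) => /(_ i j)[_ ->].
rewrite dF; last exact: seg.
by rewrite mxE mulr0 scale1r subrKC => /eqP; rewrite subr_eq0 => /eqP.
Qed.

Lemma connected_locally_const (X : topologicalType) (Y : Type) (h : X -> Y) :
  connected [set: X] -> (forall p, \forall q \near p, h q = h p) ->
  forall p q, h p = h q.
Proof.
move=> cX lc p q; suff E : [set r | h r = h p] = setT.
  by have := I : [set: X] q; rewrite -E => /esym.
apply: cX; first by exists p.
- exists [set r | h r = h p]; last by rewrite setTI.
  rewrite openE => r /= rp; apply: filterS (lc r) => z /= ->; exact: rp.
- exists [set r | h r = h p]; last by rewrite setTI.
  rewrite -[X in closed X]setCK closedC openE => r /= rp.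
  by apply: filterS (lc r) => z /= ->.
Qed.

Lemma kaehler_parallel (R : realType) n (M : manifold R n) m
    (g : riemannian_metric M) (f : M -> 'rV[R]_m) (c : chart M)
    (J : 'rV[R]_n -> 'M[R]_n) x u :
  isometric_immersion g f -> smooth_on (img c) J ->
  (forall l, nabla_endo g c J l x = 0) -> img c x ->
  'D_u J x + J x *m ('D_u (jacobian (local_rep f c)) x *m coframe (local_rep f c) x)
    - 'D_u (jacobian (local_rep f c)) x *m coframe (local_rep f c) x *m J x = 0.
Proof.
move=> isof sJ nabla0 Ux; set F := local_rep f c.
have sF : smooth_on (img c) F := smooth_local_rep c isof.
have sD := smooth_jacobian (open_img (c := c)) sF.
have E l : 'D_(delta_mx 0 l) J x
    + J x *m ('D_(delta_mx 0 l) (jacobian F) x *m coframe F x)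
    - 'D_(delta_mx 0 l) (jacobian F) x *m coframe F x *m J x = 0.
  rewrite -(nabla0 l); set G := _ *m coframe F x.
  have GE k i : christoffel g c x k l i = G i k := christoffelE isof k l i Ux.
  apply/matrixP => i k; rewrite [RHS]mxE /partial.
  have entE (a b d : 'M[R]_n) : (a + b - d) i k = a i k + b i k - d i k by rewrite !mxE.
  apply: (etrans (entE _ _ _)); congr (_ + _ - _).
    by rewrite mxE; apply: eq_bigr => m' _; rewrite GE.
  by rewrite mxE; apply: eq_bigr => m' _; rewrite GE.
rewrite (derive_coordE u (smooth_differentiable sJ Ux)).
rewrite (derive_coordE u (smooth_differentiable sD Ux)).
rewrite mulmx_suml mulmx_sumr mulmx_suml -big_split -sumrB; apply: big1 => l _.
have scaleE (a : R) p (dJ J0 : 'M[R]_n) (dD : 'M[R]_(n, p)) (C : 'M[R]_(p, n)) :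
    a *: dJ + J0 *m (a *: dD *m C) - a *: dD *m C *m J0
    = a *: (dJ + J0 *m (dD *m C) - dD *m C *m J0).
  by rewrite -!scalemxAl -scalemxAr -scalerDr -scalerBr.
apply: (etrans (scaleE _ _ _ _ _ _)); rewrite (E l); exact: scaler0.
Qed.

Lemma open_overlap (R : realType) n (M : manifold R n) (c c' : chart M) :
  open (overlap c c').
Proof.
rewrite openE => x /= [p [cp c'p] <-].
have Ux : img c (coord c p) by exists p.
have Pc : param c (coord c p) = p by exact: coordK.
have H1 : nbhs (coord c p) (img c) by apply: open_nbhs_nbhs; split => //; exact: img_open.
have H2 : nbhs (coord c p) (param c @^-1` dom c').
  apply: (param_continuous Ux); rewrite Pc.
  by apply: open_nbhs_nbhs; split => //; exact: dom_open.
apply: filterS2 H1 H2 => y [q cq <-] /=; rewrite coordK// => c'q.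
by exists q.
Qed.

Lemma overlap_img (R : realType) n (M : manifold R n) (c c' : chart M) x :
  overlap c c' x -> img c x /\ img c' (transition c c' x).
Proof.
move=> [p [cp c'p] <-]; split; first by exists p.
by exists p => //; rewrite /transition coordK.
Qed.

Lemma coframe_change (R : realFieldType) n m (D D' : 'M[R]_(n, m)) (X : 'M[R]_n) :
  X \in unitmx -> D' *m D'^T \in unitmx -> D = X *m D' ->
  D^T *m invmx (D *m D^T) = D'^T *m invmx (D' *m D'^T) *m invmx X.
Proof.
move=> uX uG DE; have uGD : D *m D^T \in unitmx.
  by rewrite DE trmx_mul mulmxA -(mulmxA X) 2!unitmx_mul uX uG unitmx_tr.
apply: (canLR (mulmxK uGD)); rewrite DE trmx_mul -!mulmxA mulKmx//.
by rewrite (mulmxA D') mulKmx.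
Qed.

Section ChartChange.
Context {R : realType} {n : nat} {M : manifold R n} {m : nat}.
Variables (f : M -> 'rV[R]_m) (c c' : chart M).
Hypothesis immf : immersion f.
Local Notation F := (local_rep f c).
Local Notation F' := (local_rep f c').
Local Notation tau := (transition c c').

Lemma local_rep_transition x : overlap c c' x -> F x = F' (tau x).
Proof. by move=> [p [cp c'p] <-]; rewrite /local_rep /transition !coordK. Qed.

Lemma derive_transition (V : normedModType R) (h h' : 'rV[R]_n -> V) x u :
  overlap c c' x -> smooth_on (img c') h' ->
  (forall y, overlap c c' y -> h y = h' (tau y)) ->
  'D_u h x = 'D_(u *m 'J tau x) h' (tau x).
Proof.
move=> Ox sh' hE.
have dtau : differentiable tau x := smooth_differentiable (transition_smooth c c') Ox.
have dh' : differentiable h' (tau x) by apply: smooth_differentiable sh' _; case: (overlap_img Ox).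
rewrite (derive_ext u (@open_overlap _ _ _ c c') Ox hE).
have [_ ->] := is_derive_comp u dtau dh'.
by rewrite deriveEjacobian.
Qed.

Lemma jac_transition x : overlap c c' x -> 'J F x = 'J tau x *m 'J F' (tau x).
Proof.
move=> Ox; have [Ux Ux'] := overlap_img Ox.
have dF := smooth_differentiable (immf c).1 Ux.
have dF' := smooth_differentiable (immf c').1 Ux'.
apply/row_matrixP => i; rewrite row_jacobian// /partial.
rewrite (derive_transition (delta_mx 0 i) Ox (immf c').1 local_rep_transition).
by rewrite deriveEjacobian// row_mul rowE.
Qed.

Lemma unit_transition x : overlap c c' x -> 'J tau x \in unitmx.
Proof.
move=> Ox; have [Ux Ux'] := overlap_img Ox.
have := (immf c).2 _ Ux; rewrite (jac_transition Ox) -row_free_unit /row_free.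
move=> /eqP E; rewrite eqn_leq rank_leq_row -{1}E mxrankM_maxl//.
Qed.

Lemma coframe_transition x : overlap c c' x ->
  coframe F x = coframe F' (tau x) *m invmx ('J tau x).
Proof.
move=> Ox; have [Ux Ux'] := overlap_img Ox.
apply: (coframe_change (unit_transition Ox) _ (jac_transition Ox)).
by apply: gram_unitmx; exact: (immf c').2.
Qed.

Lemma tangent_proj_transition x : overlap c c' x ->
  tangent_proj F x = tangent_proj F' (tau x).
Proof.
move=> Ox; rewrite /tangent_proj (coframe_transition Ox) (jac_transition Ox).
by rewrite (mulmxA _ ('J tau x)) mulmxKV// unit_transition.
Qed.

End ChartChange.

Lemma complement_unique (V : zmodType) (e a a' b b' : V) :
  a + b = e -> a' + b' = e -> a = a' -> b = b'.
Proof. by move=> <- + aa'; rewrite -aa' => /addrI. Qed.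

Lemma eucl_norm_sqr (R : realType) m (v : 'rV[R]_m) :
  v *m v^T = (eucl_norm v ^+ 2)%:M.
Proof.
rewrite [LHS]mx11_scalar sqr_sqrtr; last by apply: sumr_ge0 => k _; exact: sqr_ge0.
by congr (_%:M); rewrite mxE; apply: eq_bigr => k _; rewrite mxE expr2.
Qed.

Lemma shape_change (R : realFieldType) n p (C C' : 'M[R]_(p, n)) (X : 'M[R]_n)
    (L L' : 'M[R]_(n, p)) b :
  X \in unitmx -> C = C' *m invmx X -> L = b *: (X *m L') ->
  - (C *m L) = b *: - (C' *m L').
Proof. by move=> uX' -> ->; rewrite -scalemxAr mulmxA mulmxKV// scalerN. Qed.

Lemma endo_change (R : realFieldType) n p (C C' : 'M[R]_(p, n)) (X I I' : 'M[R]_n)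
    (D D' : 'M[R]_(n, p)) :
  X \in unitmx -> C = C' *m invmx X -> D = X *m D' -> I *m X = X *m I' ->
  C *m I *m D = C' *m I' *m D'.
Proof.
move=> uX' -> -> IE; rewrite -!mulmxA; congr (_ *m _).
by rewrite (mulmxA I) IE -mulmxA mulKmx.
Qed.

Lemma flat_change (R : realFieldType) p (s : R) (T T' A A' I I' : 'M[R]_p) :
  T = T' -> A = A' -> I = I' ->
  T - s *: (A - I *m A *m I) = T' - s *: (A' - I' *m A' *m I').
Proof. by move=> -> -> ->. Qed.

Section MeanCurvatureNormal.
Context {R : realType} {n : nat} {M : manifold R n}.
Variables (g : riemannian_metric M) (f : M -> 'rV[R]_n.+1).
Hypothesis isof : isometric_immersion g f.
Variable H : R.
Hypotheses (H_neq0 : H != 0)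
  (cmcf : forall (c : chart M) x, img c x -> mean_curvature g f c x = H).
Hypothesis n_gt0 : (0 < n)%N.

Definition mean_normal (c : chart M) x := H^-1 *: mean_curvature_vector g f c x.

Section OneChart.
Variable c : chart M.
Local Notation U := (img c).
Local Notation F := (local_rep f c).
Local Notation T := (tangent_proj F).
Local Notation N := (mean_normal c).
Let oU := @open_img _ _ _ c.
Let sF : smooth_on U F := smooth_local_rep c isof.
Let fF x : U x -> row_free ('J F x) := free_local_rep isof (x := x).

Lemma mean_curvature_vector_tangent x : U x -> mean_curvature_vector g f c x *m T x = 0.
Proof.
move=> Ux; rewrite -scalemxAl mulmx_suml big1 ?scaler0// => i _.
rewrite mulmx_suml big1// => j _; rewrite -scalemxAl (second_fundamental_formE isof _ _ Ux).
rewrite -mulmxA mulmxBl mul1mx (tangent_projK fF Ux) subrr mulmx0.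
exact: scaler0.
Qed.

Lemma mean_normal_orth x : U x -> 'J F x *m (N x)^T = 0.
Proof.
move=> Ux; rewrite -(mul_jac_tangent fF Ux) -mulmxA.
have -> : T x *m (N x)^T = 0.
  rewrite -(sym_tangent_proj F) -trmx_mul -scalemxAl mean_curvature_vector_tangent//.
  by rewrite scaler0 trmx0.
exact: mulmx0.
Qed.

Lemma mean_normal_unit x : U x -> N x *m (N x)^T = 1%:M.
Proof.
move=> Ux; rewrite trmx_Z -scalemxAr -scalemxAl eucl_norm_sqr.
rewrite -/(mean_curvature g f c x) (cmcf Ux) scalerA scale_scalar_mx.
by rewrite -invfM -expr2 mulVf// expf_neq0.
Qed.

Lemma smooth_mean_normal : smooth_on U N.
Proof.
have sT := smooth_tangent_proj oU sF fF.
have sD := smooth_jacobian oU sF.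
have sG : smooth_on U (fun x => invmx ('J F x *m ('J F x)^T)).
  apply: smooth_invmx => //; first by move=> x Ux; exact/gram_unitmx/fF.
  by apply: smooth_mulmx => //; exact: smooth_trmx.
have sP : smooth_on U (fun x => 1%:M - T x).
  by apply: smoothD => //; [exact: smooth_cst|exact: smoothN].
pose S i j x := partial i (partial j F) x *m (1%:M - T x).
have sS i j : smooth_on U (S i j).
  apply: smooth_mulmx => //; exact/smooth_derive/smooth_derive/sF.
pose N' x := H^-1 *: (n%:R^-1 *: \sum_(i < n) \sum_(j < n)
  invmx ('J F x *m ('J F x)^T) i j *: S i j x).
have sN' : smooth_on U N'.
  move=> k; apply/(Ck_mxP _ _ oU) => a b.
  pose e (x : 'rV_n) := H^-1 * (n%:R^-1 * \sum_(i < n) \sum_(j < n)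
     invmx ('J F x *m ('J F x)^T) i j * S i j x a b).
  have -> : (fun x => N' x a b) = e.
    apply/funext => x; rewrite /N' /e !mxE summxE; congr (_ * (_ * _)).
    by apply: eq_bigr => i _; rewrite summxE; apply: eq_bigr => j _; rewrite mxE.
  apply: CkM => //; first exact: Ck_cst.
  apply: CkM => //; first exact: Ck_cst.
  apply: Ck_sum => // i; apply: Ck_sum => // j; apply: CkM => //.
    exact: ((smooth_mxP _ oU).1 sG).
  exact: ((smooth_mxP _ oU).1 (sS i j)).
apply: smooth_ext sN' => // x; rewrite inE => Ux.
rewrite /N' /mean_normal; congr (_ *: (_ *: _)); apply: eq_bigr => i _.
apply: eq_bigr => j _.
by rewrite (second_fundamental_formE isof _ _ Ux) -(metricE isof Ux).
Qed.

Lemma trace_mean_normal x : U x -> \tr (shape F N x) = n%:R * H.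
Proof.
move=> Ux; have E := mean_curvature_vector_shape isof smooth_mean_normal mean_normal_unit
  mean_normal_orth Ux.
have E2 : mean_curvature_vector g f c x = H *: N x.
  by rewrite /mean_normal scalerA divff// scale1r.
have := congr1 (fun v => (v *m (N x)^T) 0 0) (etrans (esym E) E2).
have Z a : (a *: N x *m (N x)^T) 0 0 = a.
  by rewrite -(scalemxAl a (N x)) mean_normal_unit// !mxE mulr1.
rewrite !Z => <-.
by rewrite mulVKf// pnatr_eq0 -lt0n.
Qed.

End OneChart.

Section TwoCharts.
Variables (c c' : chart M) (x : 'rV[R]_n).
Hypothesis Ox : overlap c c' x.
Local Notation tau := (transition c c').
Local Notation F := (local_rep f c).
Local Notation F' := (local_rep f c').
Let Ux : img c x := (overlap_img Ox).1.
Let Ux' : img c' (tau x) := (overlap_img Ox).2.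
Let immf : immersion f := isof.1.
Let sF (c : chart M) : smooth_on (img c) (local_rep f c) := smooth_local_rep c isof.
Let fF (c : chart M) x : img c x -> row_free ('J (local_rep f c) x) := free_local_rep isof (x := x).
Let oU (c : chart M) : open (img c) := @open_img _ _ _ c.

Lemma jac_normal_via_tangent c0 y u : img c0 y ->
  u *m 'J (mean_normal c0) y = - (mean_normal c0 y *m 'D_u (tangent_proj (local_rep f c0)) y).
Proof.
move=> Uy; have sN := @smooth_mean_normal c0.
have sT := smooth_tangent_proj (@oU c0) (sF c0) (@fF c0).
have NT z : img c0 z -> mean_normal c0 z *m tangent_proj (local_rep f c0) z = 0.
  by move=> Uz; rewrite -scalemxAl mean_curvature_vector_tangent// scaler0.
have := derive_mulmx u sN sT Uy.
rewrite (derive_ext u (@oU c0) Uy NT) derive_cst (derive_normal sN u Uy).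
have := jac_normal_tangent (@oU c0) sN (@fF c0) (@mean_normal_unit c0) (@mean_normal_orth c0) Uy.
rewrite -mulmxA => -> /esym/eqP; rewrite addr_eq0 => /eqP.
exact.
Qed.

Lemma normal_transition : exists a,
  mean_normal c x = a *: mean_normal c' (tau x) /\
  'J (mean_normal c) x = a *: ('J tau x *m 'J (mean_normal c') (tau x)).
Proof.
set N := mean_normal c x; set N' := mean_normal c' (tau x).
pose a := (N *m N'^T) 0 0; exists a.
have NN : N^T *m N = N'^T *m N'.
  have E1 : tangent_proj F x + N^T *m N = 1%:M := tangent_normal_split (@fF c)
    (@mean_normal_unit c) (@mean_normal_orth c) Ux.
  have E2 : tangent_proj F' (tau x) + N'^T *m N' = 1%:M := tangent_normal_split (@fF c')
    (@mean_normal_unit c') (@mean_normal_orth c') Ux'.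
  exact: (complement_unique E1 E2 (tangent_proj_transition immf Ox)).
have NE : N = a *: N'.
  rewrite -mul_scalar_mx -[a%:M]mx11_scalar -mulmxA -NN mulmxA.
  by rewrite (mean_normal_unit Ux) mul1mx.
split; first exact: NE.
apply/row_matrixP => i; pose e : 'rV[R]_n := delta_mx 0 i.
pose w : 'rV[R]_n := e *m 'J tau x.
have sT' := smooth_tangent_proj (@oU c') (sF c') (@fF c').
have E1 := jac_normal_via_tangent e Ux.
have E2 := jac_normal_via_tangent w Ux'.
have E3 := derive_transition (c := c) (c' := c') e Ox sT'
  (fun y => tangent_proj_transition (x := y) immf).
have E4 : w *m 'J (mean_normal c') (tau x)
    = e *m ('J tau x *m 'J (mean_normal c') (tau x)) by rewrite mulmxA.
have E : e *m 'J (mean_normal c) x =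
   a *: (e *m ('J tau x *m 'J (mean_normal c') (tau x))).
  have chain q (N0 N1 X Y Z : 'rV[R]_q) (T0 T1 : 'M[R]_q) b : N0 = b *: N1 ->
      X = - (N0 *m T0) -> Y = - (N1 *m T1) -> T0 = T1 -> Y = Z -> X = b *: Z.
    by move=> -> -> -> -> <-; rewrite -scalemxAl scalerN.
  exact: (chain _ _ _ _ _ _ _ _ _ NE E1 E2 E3 E4).
by rewrite !(rowE i) -/e E -scalemxAr.
Qed.

Lemma flat_proj_transition J J' t : t != 0 -> t = n%:R * H ->
  J x *m 'J tau x = 'J tau x *m J' (tau x) ->
  flat_proj F (mean_normal c) J t x = flat_proj F' (mean_normal c') J' t (tau x).
Proof.
move=> t0 tE JE; have [a [NE LE]] := normal_transition.
have uX := unit_transition immf Ox.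
have TE := tangent_proj_transition immf Ox.
have CE := coframe_transition immf Ox.
have DE := jac_transition immf Ox.
have AE : shape F (mean_normal c) x = a *: shape F' (mean_normal c') (tau x).
  exact: shape_change uX CE LE.
have a1 : a = 1.
  have E : n%:R * H = a * (n%:R * H) := etrans (esym (trace_mean_normal Ux))
    (etrans (congr1 mxtrace AE) (etrans (mxtrace_Z _ _)
    (congr1 ( *%R a) (trace_mean_normal Ux')))).
  by move: E; rewrite -tE -[X in X = _]mul1r => /(mulIf t0) ->.
have JtE : ambient_endo F J x = ambient_endo F' J' (tau x).
  exact: endo_change uX CE DE JE.
have AE1 : shape F (mean_normal c) x = shape F' (mean_normal c') (tau x).
  by rewrite AE a1 scale1r.
exact: flat_change TE AE1 JtE.
Qed.

End TwoCharts.

End MeanCurvatureNormal.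

Lemma cmc_kaehler_splitting (R : realType) n (M : manifold R n)
    (g : riemannian_metric M) (f : M -> 'rV[R]_n.+1) : (0 < n)%N ->
  isometric_immersion g f -> constant_mean_curvature g f -> kaehler g ->
  minimal g f \/ exists (t : R) (N : chart M -> 'rV[R]_n -> 'rV[R]_n.+1)
      (K : 'M[R]_n.+1),
    [/\ t != 0, [/\ K^T = K, K *m K = K & \tr K = n%:R - 2%:R],
      forall c, smooth_on (img c) (N c),
      forall c x, img c x -> N c x *m (N c x)^T = 1%:M /\
        'J (local_rep f c) x *m (N c x)^T = 0 &
      forall c x, img c x -> [/\ \tr (shape (local_rep f c) (N c) x) = t,
        N c x *m K = 0 & 'J (N c) x *m K = 0]].
Proof.
move=> n0 isof [H cmcf] [J [sJ Jtr JJ orthJ nablaJ]].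
have [H0|H0] := eqVneq H 0; first by left => c x Ux; rewrite cmcf.
have [[p0 _]|M0] := pselect (exists p : M, True); last first.
  by left => c x [p]; case: M0; exists p.
right; pose N := mean_normal g f H; pose t : R := n%:R * H.
have t0 : t != 0 by rewrite mulf_neq0// pnatr_eq0 -lt0n.
pose Kc c := flat_proj (local_rep f c) (N c) (J c) t.
have oU (c : chart M) := @open_img _ _ _ c.
have sF (c : chart M) := smooth_local_rep c isof.
have sN (c : chart M) : smooth_on (img c) (N c) := smooth_mean_normal isof H c.
have fF (c : chart M) x : img c x -> row_free ('J (local_rep f c) x) :=
  free_local_rep isof (x := x).
have uN (c : chart M) x : img c x -> N c x *m (N c x)^T = 1%:M :=
  @mean_normal_unit _ _ _ _ _ _ H0 cmcf c x.
have nN (c : chart M) x : img c x -> 'J (local_rep f c) x *m (N c x)^T = 0 :=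
  @mean_normal_orth _ _ _ _ _ isof H c x.
have tN (c : chart M) x : img c x -> \tr (shape (local_rep f c) (N c) x) = t :=
  @trace_mean_normal _ _ _ _ _ isof _ H0 cmcf n0 c x.
have oJ (c : chart M) x : img c x -> J c x *m ('J (local_rep f c) x *m
    ('J (local_rep f c) x)^T) *m (J c x)^T = 'J (local_rep f c) x *m ('J (local_rep f c) x)^T.
  by move=> Ux; rewrite -(metricE isof Ux) orthJ.
have pJ (c : chart M) u x : img c x -> _ :=
  fun Ux => kaehler_parallel u isof (sJ c) (nablaJ c x Ux) Ux.
have KP (c : chart M) x : img c x -> _ := fun Ux => flat_projP (oU c) (sF c) (sN c)
  (@fF c) (@uN c) (@nN c) (sJ c) (JJ c) (@oJ c) (pJ c) t0 (@tN c) Ux.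
have sK c : smooth_on (img c) (Kc c) := smooth_flat_proj t (oU c) (sF c) (sN c) (@fF c) (sJ c).
have [ch chP] := choice (@dom_cover _ _ M).
pose Kp p := Kc (ch p) (coord (ch p) p).
have KpE c p : dom c p -> Kp p = Kc c (coord c p).
  move=> cp; have Ox : overlap (ch p) c (coord (ch p) p) by exists p.
  have := flat_proj_transition isof H0 cmcf n0 Ox (J' := J c) t0 erefl (Jtr _ _ _ Ox).
  by rewrite /transition coordK.
have KpC : forall p q, Kp p = Kp q.
  apply: connected_locally_const (@manifold_connected _ _ M) _ => p.
  set c := ch p; have Ux : img c (coord c p) by exists p => //; exact: chP.
  have [e /= e0 eU] := (nbhs_ballP _ _).1 (open_nbhs_nbhs (conj (oU c) Ux)).
  have N1 : \forall q \near p, dom c q.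
    by apply: open_nbhs_nbhs; split; [exact: dom_open|exact: chP].
  have N2 : \forall q \near p, ball (coord c p) e (coord c q).
    have cc := @Defs.coord_continuous R n M c p (chP p).
    exact: (cc (ball (coord c p) e) (nbhsx_ballx (coord c p) e e0)).
  apply: filterS2 N1 N2 => q cq qe.
  rewrite (KpE c q cq) (KpE c p (chP p)).
  apply: derive0_const_ball qe; first exact: smooth_subset eU (sK c).
  move=> z u /eU Uz.
  exact: (derive_flat_proj (oU c) (sF c) (sN c) (@fF c) (@uN c) (@nN c) (sJ c)
    (JJ c) (@oJ c) (pJ c) t0 (@tN c) u Uz).
exists t, N, (Kp p0); split=> //.
- have Ux : img (ch p0) (coord (ch p0) p0) by exists p0 => //; exact: chP.
  by have [] := KP _ _ Ux.
- by move=> c x Ux; split; [exact: uN|exact: nN].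
- move=> c _ [p cp <-]; have Ux : img c (coord c p) by exists p.
  split; first exact: tN.
    by rewrite (KpC p0 p) (KpE c p cp); have [] := KP _ _ Ux.
  by rewrite (KpC p0 p) (KpE c p cp); have [] := KP _ _ Ux.
Qed.

(** * Local cylinders *)

Lemma sym_idem_factor (R : rcfType) n r (X : 'M[R]_n) :
  X^T = X -> X *m X = X -> \tr X = r%:R ->
  exists B : 'M[R]_(r, n), B^T *m B = X /\ B *m B^T = 1%:M.
Proof.
elim: r X => [|r IH] X symX XX trX.
  exists 0; split; last by rewrite flatmx0 [RHS]flatmx0.
  by rewrite mulmx0; apply/esym/sym_idem_trace0.
have [i iX] : exists i, row i X != 0.
  apply/existsP; apply: contraT; rewrite negb_exists => /forallP H.
  suff X0 : X = 0 by move/eqP: trX; rewrite X0 mxtrace0 eq_sym pnatr_eq0.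
  by apply/row_matrixP => i; rewrite row0; apply/eqP; move: (H i); rewrite negbK.
have vX : row i X *m X = row i X by rewrite -row_mul XX.
move: (row i X) iX vX => v iX vX.
have [c [c0 vv]] : exists c, 0 < c /\ v *m v^T = c%:M.
  exists (\sum_j v 0 j ^+ 2); split; last first.
    rewrite [LHS]mx11_scalar; congr (_%:M).
    by rewrite mxE; apply: eq_bigr => j _; rewrite mxE expr2.
  rewrite lt0r sumr_ge0 ?andbT; last by move=> j _; exact: sqr_ge0.
  apply: contra iX; rewrite psumr_eq0; last by move=> j _; exact: sqr_ge0.
  move=> /allP H; apply/eqP/rowP => j; rewrite mxE.
  by have := H j (mem_index_enum j); rewrite sqrf_eq0 => /eqP.
pose w := (Num.sqrt c)^-1 *: v.
have ww : w *m w^T = 1%:M.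
  rewrite trmx_Z -scalemxAl -scalemxAr vv scalerA -invfM -expr2 sqr_sqrtr ?ltW//.
  by rewrite scale_scalar_mx mulVf// gt_eqF.
have wX : w *m X = w by rewrite -scalemxAl vX.
have Xw : X *m w^T = w^T by rewrite -[in LHS]symX -trmx_mul wX.
pose Y := X - w^T *m w.
have Yw : Y *m w^T = 0 by rewrite mulmxBl Xw -mulmxA ww mulmx1 subrr.
have symY : Y^T = Y by rewrite trmx_B trmx_mul trmxK symX.
have YY : Y *m Y = Y.
  by rewrite {2}/Y mulmxBr (mulmxA Y w^T) Yw mul0mx subr0 mulmxBl XX -mulmxA wX.
have trY : \tr Y = r%:R.
  by rewrite mxtrace_B trX mxtrace_mulC ww mxtrace1 -natrB// subn1.
have [B [BB BBt]] := IH Y symY YY trY.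
have Bw : B *m w^T = 0.
  by rewrite -[B]mul1mx -BBt -(mulmxA B) BB -mulmxA Yw mulmx0.
suff : exists C : 'M[R]_(1 + r, n), C^T *m C = X /\ C *m C^T = 1%:M by [].
exists (col_mx w B); split.
  by rewrite tr_col_mx mul_row_col BB addrC subrK.
rewrite tr_col_mx mul_col_row ww Bw BBt -[w *m B^T]trmxK trmx_mul trmxK Bw trmx0.
by rewrite -scalar_mx_block.
Qed.

Lemma ball_row_mx (R : realType) p q (a a' : 'rV[R]_p) (b b' : 'rV[R]_q) (e : R) :
  0 < e ->
  ball (row_mx a b) e (row_mx a' b') <-> ball a e a' /\ ball b e b'.
Proof.
move=> e0; split=> [[_ H]|[[_ Ha] [_ Hb]]].
  split; split=> // i j.
    by have := H i (lshift q j); rewrite !row_mxEl.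
  by have := H i (rshift p j); rewrite !row_mxEr.
split=> // i j; rewrite -(splitK j); case: (fintype.split j) => k /=.
  by rewrite !row_mxEl.
by rewrite !row_mxEr.
Qed.

Lemma row_mx_affine (R : pzRingType) p q (a : 'rV[R]_p) (b : 'rV[R]_q) :
  row_mx a b = row_mx 0 b + a *m row_mx 1%:M 0.
Proof. by rewrite mul_mx_row mulmx1 mulmx0 add_row_mx add0r addr0. Qed.

Section Affine.
Context {R : realType}.
Variables (p n : nat) (A : 'M[R]_(p, n)) (x0 : 'rV[R]_n).

Lemma smooth_affine (U : set 'rV[R]_p) :
  open U -> smooth_on U (fun z => x0 + z *m A).
Proof.
by move=> oU; apply: smoothD => //; [exact: smooth_cst|exact: smooth_linear].
Qed.

Lemma derive_affine z v : 'D_v (fun z : 'rV[R]_p => x0 + z *m A) z = v *m A.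
Proof.
have := is_deriveD (is_derive_cst x0 z v) (is_derive_linear A z v).
by move=> [_ ->]; rewrite add0r.
Qed.

End Affine.

Lemma derive_smooth_comp (R : realType) n m (V : normedModType R) (U : set 'rV[R]_n)
    (U' : set 'rV[R]_m) (F : 'rV[R]_m -> V) (G : 'rV[R]_n -> 'rV[R]_m) x v :
  smooth_on U' F -> smooth_on U G -> U x -> U' (G x) ->
  'D_v (F \o G) x = 'D_('D_v G x) F (G x).
Proof.
move=> sF sG Ux UGx.
by have [] := is_derive_comp v (smooth_differentiable sG Ux) (smooth_differentiable sF UGx).
Qed.

Lemma jacobian_comp (R : realType) n m p (U : set 'rV[R]_n) (U' : set 'rV[R]_m)
    (F : 'rV[R]_m -> 'rV[R]_p) (G : 'rV[R]_n -> 'rV[R]_m) x :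
  smooth_on U' F -> smooth_on U G -> U x -> U' (G x) ->
  'J (F \o G) x = 'J G x *m 'J F (G x).
Proof.
move=> sF sG Ux UGx.
have dG := smooth_differentiable sG Ux; have dF := smooth_differentiable sF UGx.
have dFG : differentiable (F \o G) x by exact: differentiable_comp.
apply/row_matrixP => i.
rewrite row_jacobian// row_mul row_jacobian// /partial.
by rewrite (derive_smooth_comp _ sF sG Ux UGx) deriveEjacobian.
Qed.

Lemma jacobian_affine (R : realType) p n (A : 'M[R]_(p, n)) (x0 : 'rV[R]_n) z :
  'J (fun z : 'rV[R]_p => x0 + z *m A) z = A.
Proof.
have dA : differentiable (fun z : 'rV[R]_p => x0 + z *m A) z.
  exact: smooth_differentiable (smooth_affine A x0 (openT (T := 'rV[R]_p))) I.
by apply/row_matrixP => i; rewrite row_jacobian// /partial derive_affine rowE.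
Qed.

Lemma jacobian_mulmxr (R : realType) n m p (F : 'rV[R]_n -> 'rV[R]_m) (L : 'M[R]_(m, p)) x :
  differentiable F x -> 'J (fun y => F y *m L) x = 'J F x *m L.
Proof.
move=> dF.
have E u : is_derive x u (fun y => F y *m L) ('D_u F x *m L + F x *m 0).
  have dFu : is_derive x u F ('D_u F x) by apply: DeriveDef => //; exact: diff_derivable.
  exact: is_derive_mulmx dFu (is_derive_cst L x u).
have dFL : differentiable (fun y => F y *m L) x.
  apply: (@differentiable_comp _ _ _ _ F (fun y => y *m L)) => //.
  exact: smooth_differentiable (smooth_linear L setT) I.
apply/row_matrixP => i; rewrite row_jacobian// row_mul row_jacobian// /partial.
by have [_ ->] := E (delta_mx 0 i); rewrite mulmx0 addr0.
Qed.

Lemma jacobian_ext (R : realType) n m (U : set 'rV[R]_n) (F G : 'rV[R]_n -> 'rV[R]_m) x :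
  open U -> smooth_on U F -> (forall y, U y -> G y = F y) -> U x -> 'J G x = 'J F x.
Proof.
move=> oU sF GF Ux; have sG : smooth_on U G.
  by apply: smooth_ext sF => // y; rewrite inE => /GF.
apply/row_matrixP => i.
have rG := row_jacobian i (smooth_differentiable sG Ux).
have rF := row_jacobian i (smooth_differentiable sF Ux).
exact: (etrans rG (etrans (derive_ext _ oU Ux GF) (esym rF))).
Qed.

Lemma section_free (R : realType) n m (U : set 'rV[R]_n) (F : 'rV[R]_n -> 'rV[R]_m)
    (L : 'M[R]_(m, n)) x :
  open U -> smooth_on U F -> (forall y, U y -> F y *m L = y) -> U x -> row_free ('J F x).
Proof.
move=> oU sF FL Ux; apply/row_freeP; exists L.
rewrite -jacobian_mulmxr; last exact: smooth_differentiable sF Ux.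
apply/row_matrixP => i; have sL : smooth_on U (fun a => F a *m L).
  by apply: smooth_mulmx => //; exact: smooth_cst.
rewrite row_jacobian; last exact: smooth_differentiable sL Ux.
by rewrite /partial (derive_ext _ oU Ux FL) derive_id rowE mulmx1.
Qed.

Section FrameAlgebra.
Context {R : realType} {n d : nat}.
Variables (K : 'M[R]_n.+1) (B3 : 'M[R]_(3, n.+1)) (B2 : 'M[R]_(d, n.+1)).
Hypotheses (B3B : B3^T *m B3 = 1%:M - K) (B2B : B2^T *m B2 = K)
  (BB3 : B3 *m B3^T = 1%:M) (BB2 : B2 *m B2^T = 1%:M).

Lemma splitting_orth : B3 *m B2^T = 0.
Proof.
have E : B3 *m K = 0.
  have -> : K = 1%:M - B3^T *m B3 by rewrite B3B opprB subrKC.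
  by rewrite mulmxBr mulmx1 mulmxA BB3 mul1mx subrr.
by rewrite -[B2^T]mulmx1 -BB2 (mulmxA B2^T) B2B (mulmxA B3) E mul0mx.
Qed.

Lemma split_normal (N0 : 'rV[R]_n.+1) : N0 *m K = 0 -> N0 *m B3^T *m B3 = N0.
Proof. by move=> NK; rewrite -mulmxA B3B mulmxBr mulmx1 NK subr0. Qed.

Lemma split_normal_unit (N0 : 'rV[R]_n.+1) : N0 *m N0^T = 1%:M -> N0 *m K = 0 ->
  N0 *m B3^T *m (N0 *m B3^T)^T = 1%:M.
Proof. by move=> NN NK; rewrite trmx_mul trmxK mulmxA split_normal. Qed.

Lemma adapted_frame (N0 : 'rV[R]_n.+1) : N0 *m N0^T = 1%:M -> N0 *m K = 0 ->
  exists E : 'M[R]_(2, 3), [/\ E *m E^T = 1%:M,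
    E^T *m E = 1%:M - (N0 *m B3^T)^T *m (N0 *m B3^T),
    (row_mx (B3^T *m E^T) B2^T)^T *m row_mx (B3^T *m E^T) B2^T = 1%:M &
    row_mx (B3^T *m E^T) B2^T *m (row_mx (B3^T *m E^T) B2^T)^T = 1%:M - N0^T *m N0].
Proof.
move=> NN NK; have nn := split_normal_unit NN NK.
have nB := split_normal NK.
move: (N0 *m B3^T) nn nB => nb nn nB.
have PP : (nb^T *m nb) *m (nb^T *m nb) = nb^T *m nb.
  by rewrite mulmxA -(mulmxA nb^T) nn mulmx1.
have [||| E [EE EEt]] := @sym_idem_factor R 3 2 (1%:M - nb^T *m nb).
- by rewrite trmx_B trmx1 trmx_mul trmxK.
- by rewrite mulmxBl mul1mx mulmxBr mulmx1 PP subrr subr0.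
- by rewrite mxtrace_B mxtrace1 mxtrace_mulC nn mxtrace1 -natrB.
have orth := splitting_orth.
have orth' : B2 *m B3^T = 0 by rewrite -[LHS]trmxK trmx_mul trmxK orth trmx0.
exists E; split=> //.
  rewrite tr_row_mx mul_col_row trmx_mul !trmxK.
  have -> : E *m B3 *m (B3^T *m E^T) = 1%:M.
    by rewrite mulmxA -(mulmxA E) BB3 mulmx1.
  have -> : E *m B3 *m B2^T = 0 by rewrite -mulmxA orth mulmx0.
  have -> : B2 *m (B3^T *m E^T) = 0 by rewrite mulmxA orth' mul0mx.
  by rewrite BB2 -scalar_mx_block.
rewrite tr_row_mx mul_row_col trmx_mul !trmxK B2B.
rewrite mulmxA -(mulmxA B3^T) EE mulmxBr mulmxBl mulmx1 B3B.
have -> : B3^T *m (nb^T *m nb) *m B3 = N0^T *m N0.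
  by rewrite -nB trmx_mul !mulmxA.
by rewrite addrAC subrK.
Qed.

End FrameAlgebra.

Section LocalCylinder.
Context {R : realType} {n d : nat} (U : set 'rV[R]_n).
Variables (F N : 'rV[R]_n -> 'rV[R]_n.+1).
Hypotheses (oU : open U) (sF : smooth_on U F) (sN : smooth_on U N)
  (freeF : forall x, U x -> row_free ('J F x))
  (unitN : forall x, U x -> N x *m (N x)^T = 1%:M)
  (normalN : forall x, U x -> 'J F x *m (N x)^T = 0).
Variables (K : 'M[R]_n.+1) (B3 : 'M[R]_(3, n.+1)) (B2 : 'M[R]_(d, n.+1)).
Hypotheses (NK : forall x, U x -> N x *m K = 0)
  (B3B : B3^T *m B3 = 1%:M - K) (B2B : B2^T *m B2 = K)
  (BB3 : B3 *m B3^T = 1%:M) (BB2 : B2 *m B2^T = 1%:M).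

Lemma local_chart x0 : U x0 ->
  exists (E : 'M[R]_(2, 3)) (X : 'rV[R]_(2 + d) -> 'rV[R]_n) (r : R) (V : set 'rV[R]_n),
  let Lm := row_mx (B3^T *m E^T) B2^T in let w0 := F x0 *m Lm in
  [/\ 0 < r, E *m E^T = 1%:M /\ E^T *m E = 1%:M - (N x0 *m B3^T)^T *m (N x0 *m B3^T),
    [/\ open V, V `<=` U & V x0],
    smooth_on (ball w0 r) X &
    (forall w, ball w0 r w -> [/\ V (X w), F (X w) *m Lm = w &
       (N (X w) *m B3^T *m (N x0 *m B3^T)^T) 0 0 != 0]) /\
    (forall x, V x -> ball w0 r (F x *m Lm) /\ X (F x *m Lm) = x)].
Proof.
move=> Ux0; have [E [EE EEt LL LLt]] := adapted_frame B3B B2B BB3 BB2 (unitN Ux0) (NK Ux0).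
pose Lm := row_mx (B3^T *m E^T) B2^T; rewrite -/Lm in LL LLt.
have T0 := tangent_normal_split freeF unitN normalN Ux0.
have T0E : Lm *m Lm^T = tangent_proj F x0 by rewrite LLt -T0 addrK.
pose A0 := Lm^T *m coframe F x0; pose Bm := 'J F x0 *m Lm.
have AB : A0 *m Bm = 1%:M.
  rewrite /A0 /Bm mulmxA -(mulmxA Lm^T) -/(tangent_proj F x0) -T0E.
  by rewrite (mulmxA Lm^T) LL mul1mx.
have BA : Bm *m A0 = 1%:M.
  rewrite /A0 /Bm mulmxA -(mulmxA _ Lm) T0E (mul_jac_tangent freeF Ux0).
  exact: (mul_jac_coframe freeF Ux0).
have BmE : 'J F x0 *m Lm = Bm by [].
clearbody Bm.
pose sh (z : 'rV[R]_(2 + d)) := x0 + z *m A0.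
pose sh' (x : 'rV[R]_n) := (x - x0) *m Bm.
have shK z : sh' (sh z) = z by rewrite /sh' /sh addrC addKr -mulmxA AB mulmx1.
have sh'K x : sh (sh' x) = x by rewrite /sh' /sh -mulmxA BA mulmx1 addrC subrK.
pose O := [set x | U x /\ (N x *m B3^T *m (N x0 *m B3^T)^T) 0 0 != 0].
have oO : open O.
  rewrite openE => x [Ux Nx] /=.
  have sh1 : smooth_on U (fun x => N x *m (B3^T *m (N x0 *m B3^T)^T)).
    by apply: smooth_mulmx => //; exact: smooth_cst.
  have c1 : {for x, continuous (fun x => (N x *m (B3^T *m (N x0 *m B3^T)^T)) 0 0)}.
    exact: (mx_continuousP _ _).1 (smooth_continuous sh1 Ux) 0 0.
  have N1 : \forall y \near x, U y by apply: open_nbhs_nbhs.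
  have N2 : \forall y \near x, (N y *m (B3^T *m (N x0 *m B3^T)^T)) 0 0 != 0.
    by apply: (c1 [set a | a != 0]); apply: open_nbhs_nbhs; split;
      [exact: open_neq|rewrite /= mulmxA].
  by apply: filterS2 N1 N2 => y Uy; rewrite mulmxA => Ny; split.
have Ox0 : O x0.
  split=> //; rewrite (split_normal_unit B3B (unitN Ux0) (NK Ux0)).
  by rewrite mxE oner_neq0.
have csh z : {for z, continuous sh}.
  exact: smooth_continuous (smooth_affine A0 x0 (openT (T := 'rV[R]_(2 + d)))) I.
have oO' : open (sh @^-1` O) by apply: open_comp => // z _; exact: csh.
pose P (z : 'rV[R]_(2 + d)) := F (sh z) *m Lm.
have sFL : smooth_on U (fun x => F x *m Lm).
  by apply: smooth_mulmx => //; exact: smooth_cst.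
have sP : smooth_on (sh @^-1` O) P.
  apply: (smooth_comp (G := sh)) sFL _ => //; last exact: smooth_affine.
  by move=> z [].
have sh0 : sh 0 = x0 by rewrite /sh mul0mx addr0.
have JP : 'J P 0 = 1%:M.
  have -> : P = (fun x => F x *m Lm) \o sh by [].
  have ssh : smooth_on (sh @^-1` O) sh := smooth_affine A0 x0 oO'.
  have Osh : (sh @^-1` O) 0 by rewrite /= sh0.
  have Ush : U (sh 0) by rewrite sh0.
  rewrite (jacobian_comp sFL ssh Osh Ush) sh0.
  rewrite (jacobian_mulmxr Lm (smooth_differentiable sF Ux0)) BmE.
  by rewrite jacobian_affine AB.
have Osh0 : (sh @^-1` O) 0 by rewrite /= sh0.
have [G [r [e [[r0 e0] eO sG GP PG]]]] := inverse_function oO' sP Osh0 JP.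
have P0 : P 0 = F x0 *m Lm by rewrite /P sh0.
rewrite P0 in sG GP PG.
pose V := [set x | O x /\ (ball 0 e (sh' x) /\ ball (F x0 *m Lm) r (F x *m Lm))].
have csh' x : {for x, continuous sh'}.
  have -> : sh' = fun x => - x0 *m Bm + x *m Bm.
    by apply/funext => y; rewrite /sh' mulmxBl mulNmx addrC.
  exact: smooth_continuous (smooth_affine Bm _ (openT (T := 'rV[R]_n))) I.
exists E, (sh \o G), r, V; split=> //.
- split.
  + rewrite openE => x [Ox [shx Px]]; have [Ux _] := Ox.
    have N1 : \forall y \near x, O y by apply: open_nbhs_nbhs.
    have N2 : \forall y \near x, ball 0 e (sh' y).
      by apply: (csh' x); apply: open_nbhs_nbhs; split => //; exact: ball_open.
    have N3 : \forall y \near x, ball (F x0 *m Lm) r (F y *m Lm).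
      apply: (smooth_continuous sFL Ux); apply: open_nbhs_nbhs; split => //.
      exact: ball_open.
    apply: filterS2 N1 (filterI N2 N3) => y Oy shPy; exact: conj Oy shPy.
  + by move=> x [[]].
  + split=> //; have -> : sh' x0 = 0 by rewrite -sh0 shK.
    by split; exact: ballxx.
- apply: (smooth_comp (F := sh)) (openT) _ _ sG => //.
  + exact: ball_open.
  + exact: smooth_affine openT.
- split=> [w bw|x [Ox [shx Px]]].
    have [bG PGw] := GP w bw; have [UX NX] := eO _ bG.
    split=> //; split; first exact: conj UX NX.
    by rewrite /= shK; split=> //; rewrite -/(P (G w)) PGw.
  split=> //=; have PE : P (sh' x) = F x *m Lm by rewrite /P sh'K.
  by rewrite -PE PG// ?PE// sh'K.
Qed.

End LocalCylinder.

Section Profile.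
Context {R : realType} {n d : nat} (U : set 'rV[R]_n).
Variables (F N : 'rV[R]_n -> 'rV[R]_n.+1).
Hypotheses (oU : open U) (sF : smooth_on U F) (sN : smooth_on U N)
  (freeF : forall x, U x -> row_free ('J F x))
  (unitN : forall x, U x -> N x *m (N x)^T = 1%:M)
  (normalN : forall x, U x -> 'J F x *m (N x)^T = 0).
Variables (K : 'M[R]_n.+1) (B3 : 'M[R]_(3, n.+1)) (B2 : 'M[R]_(d, n.+1)) (t : R).
Hypotheses (NK : forall x, U x -> N x *m K = 0)
  (LK : forall x, U x -> 'J N x *m K = 0) (symK : K^T = K)
  (trA : forall x, U x -> \tr (shape F N x) = t)
  (B3B : B3^T *m B3 = 1%:M - K) (B2B : B2^T *m B2 = K)
  (BB3 : B3 *m B3^T = 1%:M) (BB2 : B2 *m B2^T = 1%:M).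
Variables (E : 'M[R]_(2, 3)) (nn : 'rV[R]_3) (X : 'rV[R]_(2 + d) -> 'rV[R]_n).
Variables (r : R) (a0 : 'rV[R]_2) (b0 : 'rV[R]_d).
Local Notation Lm := (row_mx (B3^T *m E^T) B2^T).
Local Notation B := (ball (row_mx a0 b0) r).
Hypotheses (r0 : 0 < r) (EE : E *m E^T = 1%:M) (EEt : E^T *m E = 1%:M - nn^T *m nn)
  (sX : smooth_on B X) (XU : forall w, B w -> U (X w))
  (FX : forall w, B w -> F (X w) *m Lm = w)
  (NX : forall w, B w -> (N (X w) *m B3^T *m nn^T) 0 0 != 0).

Let oB : open B. Proof. exact: ball_open. Qed.
Let Y := F \o X.
Let sY : smooth_on B Y.
Proof. exact: smooth_comp oB oU XU sF sX. Qed.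

Lemma derive_slice w v : B w -> 'D_v Y w = 'D_v X w *m 'J F (X w).
Proof.
move=> Bw; rewrite (derive_smooth_comp v sF sX Bw (XU Bw)) deriveEjacobian//.
exact: smooth_differentiable sF (XU Bw).
Qed.

Lemma derive_slice_coord w v : B w -> 'D_v Y w *m Lm = v.
Proof.
move=> Bw; have := derive_mulmx v sY (smooth_cst B Lm) Bw.
rewrite derive_cst mulmx0 addr0 => <-.
rewrite (derive_ext v oB Bw FX); exact: derive_id.
Qed.

Lemma derive_slice_flat w (b : 'rV[R]_d) : B w -> 'D_(row_mx 0 b) Y w *m B3^T *m nn^T = 0.
Proof.
move=> Bw; set y := 'D__ Y w.
have yL : y *m Lm = row_mx 0 b := derive_slice_coord _ Bw.
have yN : y *m (N (X w))^T = 0.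
  by rewrite /y derive_slice// -mulmxA (normalN (XU Bw)) mulmx0.
have yE : y *m B3^T *m E^T = 0.
  by move: yL; rewrite mul_mx_row mulmxA => /eq_row_mx[].
have nB := split_normal B3B (NK (XU Bw)).
move: (NX Bw) yN; rewrite -{2}nB; move: (N (X w) *m B3^T) => nb.
rewrite trmx_mul mulmxA; move: (y *m B3^T) yE => z zE nz znb.
have zz : z = (z *m nn^T) *m nn.
  rewrite -[LHS]mulmx1; have -> : 1%:M = E^T *m E + nn^T *m nn by rewrite EEt subrK.
  by rewrite mulmxDr !mulmxA zE mul0mx add0r.
move: znb; rewrite {1}zz -mulmxA [z *m nn^T]mx11_scalar mul_scalar_mx => /eqP.
rewrite scalemx_eq0 => /orP[/eqP->|/eqP nnb]; first by rewrite raddf0.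
by move: nz; rewrite -[nb *m _]trmxK trmx_mul trmxK nnb !mxE eqxx.
Qed.

Lemma slice_indep a b : ball a0 r a -> ball b0 r b ->
  Y (row_mx a b) *m B3^T = Y (row_mx a b0) *m B3^T.
Proof.
move=> ba bb; have inB s : 0 <= s <= 1 -> B (row_mx a b0 + s *: row_mx 0 (b - b0)).
  move=> s01; rewrite scale_row_mx scaler0 add_row_mx addr0.
  by apply/ball_row_mx => //; split=> //; exact: ball_segment.
have B0 : B (row_mx a b0) by apply/ball_row_mx => //; split=> //; exact: ballxx.
have B1 : B (row_mx a b) by apply/ball_row_mx.
pose h w := Y w *m (B3^T *m nn^T).
have sh : smooth_on B h by apply: smooth_mulmx => //; exact: smooth_cst.
have dh s : 0 <= s <= 1 ->
    differentiable (fun w => h w 0 0) (row_mx a b0 + s *: row_mx 0 (b - b0)).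
  move=> s01; apply: (mx_differentiableP _ _).1.
  by apply: smooth_differentiable sh _; exact: inB.
have [s /andP[s0 s1]] := line_MVT ltr01 dh.
have s01 : 0 <= s <= 1 by rewrite !ltW.
move/is_derive_mxP: (smooth_is_derive (row_mx 0 (b - b0)) sh (inB _ s01)) => /(_ 0 0)[_ ->].
have -> : 'D_(row_mx 0 (b - b0)) h (row_mx a b0 + s *: row_mx 0 (b - b0)) = 0.
  have := derive_mulmx (row_mx 0 (b - b0)) sY (smooth_cst B (B3^T *m nn^T)) (inB _ s01).
  rewrite derive_cst mulmx0 addr0 => ->.
  by rewrite mulmxA derive_slice_flat//; exact: inB.
move=> HH; have {HH}hE : h (row_mx a b) 0 0 = h (row_mx a b0) 0 0.
  have pE : row_mx a b0 + 1 *: row_mx 0 (b - b0) = row_mx a b.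
    by rewrite scale1r add_row_mx addr0 subrKC.
  by apply/eqP; rewrite -subr_eq0 -{1}pE HH [X in 1 * X]mxE mulr0.
have hE' : Y (row_mx a b) *m B3^T *m nn^T = Y (row_mx a b0) *m B3^T *m nn^T.
  rewrite -!mulmxA -/(h _) -/(h _); apply/matrixP => i j.
  by rewrite !ord1.
have EE' w : B w -> Y w *m B3^T *m E^T = lsubmx w.
  by move=> Bw; rewrite -[w in RHS]FX// mul_mx_row row_mxKl mulmxA.
have dec (z : 'rV[R]_3) : z = z *m E^T *m E + z *m nn^T *m nn.
  by rewrite -!mulmxA -mulmxDr EEt subrK mulmx1.
rewrite [LHS]dec [RHS]dec; congr (_ *m E + _ *m nn) => //.
by rewrite EE'// EE'// !row_mxKl.
Qed.

Definition profile (a : 'rV[R]_2) := F (X (row_mx a b0)) *m B3^T.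
Definition profile_normal (a : 'rV[R]_2) := N (X (row_mx a b0)) *m B3^T.

Local Notation D := (ball a0 r).
Let oD : open D. Proof. exact: ball_open. Qed.
Let io (a : 'rV[R]_2) : 'rV[R]_(2 + d) := row_mx 0 b0 + a *m row_mx 1%:M 0.
Let ioE a : row_mx a b0 = io a. Proof. exact: row_mx_affine. Qed.
Let ioB a : D a -> B (io a).
Proof. by move=> Da; rewrite -ioE; apply/ball_row_mx => //; split=> //; exact: ballxx. Qed.
Let sio : smooth_on D io. Proof. exact: smooth_affine. Qed.
Let sXi : smooth_on D (X \o io). Proof. exact: smooth_comp oD oB ioB sX sio. Qed.
Let XiU a : D a -> U ((X \o io) a). Proof. by move=> /ioB/XU. Qed.
Let profileE : profile = fun a => (F \o (X \o io)) a *m B3^T.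
Proof. by apply/funext => a; rewrite /profile ioE. Qed.
Let normalE : profile_normal = fun a => (N \o (X \o io)) a *m B3^T.
Proof. by apply/funext => a; rewrite /profile_normal ioE. Qed.
Let sFi : smooth_on D (F \o (X \o io)).
Proof. exact: smooth_comp oD oU XiU sF sXi. Qed.
Let sNi : smooth_on D (N \o (X \o io)).
Proof. exact: smooth_comp oD oU XiU sN sXi. Qed.

Lemma smooth_profile : smooth_on D profile.
Proof. by rewrite profileE; apply: smooth_mulmx => //; exact: smooth_cst. Qed.

Lemma smooth_profile_normal : smooth_on D profile_normal.
Proof. by rewrite normalE; apply: smooth_mulmx => //; exact: smooth_cst. Qed.

Lemma profileK a : D a -> profile a *m E^T = a.
Proof.
move=> Da; have := FX (ioB Da).
by rewrite -ioE mul_mx_row mulmxA => /eq_row_mx[].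
Qed.

Lemma profile_normal_unit a : D a -> profile_normal a *m (profile_normal a)^T = 1%:M.
Proof.
move=> /XiU Ua; rewrite normalE.
exact: (split_normal_unit B3B (unitN Ua) (NK Ua)).
Qed.

Let Jprofile a : D a -> 'J profile a = 'J (X \o io) a *m 'J F ((X \o io) a) *m B3^T.
Proof.
move=> Da; rewrite profileE jacobian_mulmxr; last exact: smooth_differentiable sFi Da.
by rewrite (jacobian_comp sF sXi Da (XiU Da)).
Qed.

Let Jnormal a : D a ->
  'J profile_normal a = 'J (X \o io) a *m 'J N ((X \o io) a) *m B3^T.
Proof.
move=> Da; rewrite normalE jacobian_mulmxr; last exact: smooth_differentiable sNi Da.
by rewrite (jacobian_comp sN sXi Da (XiU Da)).
Qed.

Lemma profile_normal_orth a : D a -> 'J profile a *m (profile_normal a)^T = 0.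
Proof.
move=> Da; rewrite (Jprofile Da) normalE trmx_mul trmxK.
have := split_normal B3B (NK (XiU Da)); have := normalN (XiU Da).
rewrite /comp; move: ('J F _) (N _) => D0 N0 DN nB.
have E1 : B3^T *m (B3 *m N0^T) = N0^T by rewrite -[in RHS]nB !trmx_mul trmxK.
by rewrite -(mulmxA _ B3^T) E1 -mulmxA DN mulmx0.
Qed.

Lemma profile_free a : D a -> row_free ('J profile a).
Proof. exact: section_free oD smooth_profile profileK. Qed.

Lemma profile_curvature a : D a -> \tr (shape profile profile_normal a) = t.
Proof.
move=> Da; set x := (X \o io) a; have Ux : U x := XiU Da.
have A_N := mul_tangent_shape N freeF Ux.
have symA := sym_shape oU sF sN freeF unitN normalN Ux.
have NA : N x *m shape F N x = 0.
  rewrite -A_N mulmxA; have -> : N x *m tangent_proj F x = 0.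
    by rewrite -[LHS]trmxK trmx_mul sym_tangent_proj (mul_tangent_normal normalN Ux) trmx0.
  exact: mul0mx.
have AK : shape F N x *m K = 0 by rewrite /shape mulNmx -mulmxA LK// mulmx0 oppr0.
have KA : K *m shape F N x = 0.
  by rewrite -[LHS]trmxK trmx_mul symA symK AK trmx0.
have LE : 'J profile_normal a = - ('J profile a *m (B3 *m shape F N x *m B3^T)).
  rewrite (Jnormal Da) (Jprofile Da) -/x.
  have -> : 'J N x = - ('J F x *m shape F N x).
    by rewrite (mul_jac_shape N freeF Ux) opprK.
  move: ('J F x) (shape F N x) KA => D0 A0 KA0.
  have {1}-> : A0 = B3^T *m B3 *m A0 by rewrite B3B mulmxBl mul1mx KA0 subr0.
  by rewrite mulmxN mulNmx !mulmxA.
have TE := tangent_normal_split profile_free profile_normal_unit profile_normal_orth Da.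
have nuA : profile_normal a *m (B3 *m shape F N x *m B3^T) = 0.
  rewrite normalE -/x !mulmxA (split_normal B3B (NK Ux)).
  by rewrite NA mul0mx.
have trE : \tr (B3 *m shape F N x *m B3^T) = t.
  rewrite mxtrace_mulC mulmxA B3B mulmxBl mul1mx KA subr0; exact: trA.
rewrite {1}/shape LE mulmxN opprK (mulmxA (coframe profile a)) -/(tangent_proj profile a).
move: TE nuA trE; move: (_ *m B3^T) => A0.
move: (tangent_proj profile a) (profile_normal a) => T0 nu TE nuA trE.
have -> : T0 = 1%:M - nu^T *m nu by rewrite -TE addrK.
by rewrite mulmxBl mul1mx -mulmxA nuA mulmx0 subr0.
Qed.

End Profile.

Record patch (R : realType) (d : nat) (M : Type) := Patch {
  patch_frame : 'M[R]_(2, 3);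
  patch_center : 'rV[R]_2;
  patch_base : 'rV[R]_d;
  patch_radius : R;
  patch_sheet : 'rV[R]_2 -> 'rV[R]_3;
  patch_dom : set M
}.

Section Patches.
Context {R : realType} {d : nat} {M : topologicalType}.
Variables (f3 : M -> 'rV[R]_3) (f2 : M -> 'rV[R]_d) (t : R).
Implicit Type P : patch R d M.

Definition patch_disc P := ball (patch_center P) (patch_radius P).
Definition patch_fiber P := ball (patch_base P) (patch_radius P).

Record is_patch P : Prop := IsPatch {
  patch_open : open (patch_dom P);
  patch_sheet_smooth : smooth_on (patch_disc P) (patch_sheet P);
  patch_sheetK : forall a, patch_disc P a -> patch_sheet P a *m (patch_frame P)^T = a;
  patch_graph : forall q, patch_dom P q -> [/\ patch_disc P (f3 q *m (patch_frame P)^T),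
    patch_fiber P (f2 q) & patch_sheet P (f3 q *m (patch_frame P)^T) = f3 q];
  patch_onto : forall a b, patch_disc P a -> patch_fiber P b ->
    exists q, [/\ patch_dom P q, f3 q = patch_sheet P a & f2 q = b];
  patch_lift : forall q O, patch_dom P q -> nbhs q O ->
    \forall a \near f3 q *m (patch_frame P)^T,
      exists q', [/\ patch_dom P q', O q' & f3 q' = patch_sheet P a];
  patch_normal : exists nu : 'rV[R]_2 -> 'rV[R]_3,
    [/\ smooth_on (patch_disc P) nu,
      forall a, patch_disc P a -> nu a *m (nu a)^T = 1%:M,
      forall a, patch_disc P a -> 'J (patch_sheet P) a *m (nu a)^T = 0 &
      forall a, patch_disc P a -> \tr (shape (patch_sheet P) nu a) = t]
}.

End Patches.

Section PatchExistence.
Context {R : realType} {n d : nat} {M : manifold R n}.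
Variables (f : M -> 'rV[R]_n.+1) (N : chart M -> 'rV[R]_n -> 'rV[R]_n.+1).
Variables (K : 'M[R]_n.+1) (B3 : 'M[R]_(3, n.+1)) (B2 : 'M[R]_(d, n.+1)) (t : R).
Hypotheses (immf : immersion f) (sN : forall c, smooth_on (img c) (N c))
  (normalN : forall (c : chart M) x, img c x -> N c x *m (N c x)^T = 1%:M /\
        'J (local_rep f c) x *m (N c x)^T = 0)
  (curvN : forall (c : chart M) x, img c x -> [/\ \tr (shape (local_rep f c) (N c) x) = t,
        N c x *m K = 0 & 'J (N c) x *m K = 0])
  (symK : K^T = K)
  (B3B : B3^T *m B3 = 1%:M - K) (B2B : B2^T *m B2 = K)
  (BB3 : B3 *m B3^T = 1%:M) (BB2 : B2 *m B2^T = 1%:M).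

Lemma param_img (c : chart M) x : img c x -> dom c (param c x) /\ coord c (param c x) = x.
Proof. by move=> [p cp <-]; rewrite coordK. Qed.

Lemma patch_exists p0 : exists P : patch R d M, patch_dom P p0 /\
  is_patch (fun q => f q *m B3^T) (fun q => f q *m B2^T) t P.
Proof.
have [c cp0] := dom_cover p0; pose F := local_rep f c.
have [sF fF] := immf c; pose x0 := coord c p0.
have Ux0 : img c x0 by exists p0.
have oU : open (img c) := @img_open _ _ M c.
have uN x : img c x -> N c x *m (N c x)^T = 1%:M by case/normalN.
have nN x : img c x -> 'J F x *m (N c x)^T = 0 by case/normalN.
have NK x : img c x -> N c x *m K = 0 by case/curvN.
have LK x : img c x -> 'J (N c) x *m K = 0 by case/curvN.
have trA x : img c x -> \tr (shape F (N c) x) = t by case/curvN.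
have [E [X [r [V /= [r0 [EE EEt] [oV VU Vx0] sX [XP VP]]]]]] :=
  local_chart oU sF (@sN c) fF uN nN NK B3B B2B BB3 BB2 Ux0.
pose a0 := F x0 *m B3^T *m E^T; pose b0 := F x0 *m B2^T.
have w0E : F x0 *m row_mx (B3^T *m E^T) B2^T = row_mx a0 b0.
  by rewrite mul_mx_row mulmxA.
rewrite w0E in sX XP VP.
have XU w : ball (row_mx a0 b0) r w -> img c (X w) by move=> /XP[/VU].
have FX w : ball (row_mx a0 b0) r w -> F (X w) *m row_mx (B3^T *m E^T) B2^T = w.
  by move=> /XP[].
have NX w : ball (row_mx a0 b0) r w -> (N c (X w) *m B3^T *m (N c x0 *m B3^T)^T) 0 0 != 0.
  by move=> /XP[].
pose W := [set q | dom c q /\ V (coord c q)].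
have fE q : dom c q -> f q = F (coord c q) by move=> cq; rewrite /F /local_rep coordK.
have spl a b : ball (row_mx a0 b0) r (row_mx a b) <-> ball a0 r a /\ ball b0 r b.
  exact: ball_row_mx.
have indep a b : ball a0 r a -> ball b0 r b -> F (X (row_mx a b)) *m B3^T = profile F B3 X b0 a.
  exact: (slice_indep oU sF nN NK B3B r0 EEt sX XU FX NX).
have WE q : W q -> [/\ ball a0 r (f q *m B3^T *m E^T), ball b0 r (f q *m B2^T),
    X (row_mx (f q *m B3^T *m E^T) (f q *m B2^T)) = coord c q &
    profile F B3 X b0 (f q *m B3^T *m E^T) = f q *m B3^T].
  move=> [cq Vq]; have [bq Xq] := VP _ Vq.
  move: bq Xq; rewrite -[local_rep f c _](fE q cq) mul_mx_row mulmxA => bq Xq.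
  have [ba bb] := (spl _ _).1 bq; split=> //.
  by rewrite -(indep _ _ ba bb) Xq -fE.
have lift a b : ball a0 r a -> ball b0 r b -> let q := param c (X (row_mx a b)) in
    [/\ W q, f q *m B3^T = profile F B3 X b0 a & f q *m B2^T = b].
  move=> ba bb q; have bw := (spl _ _).2 (conj ba bb).
  have [Vx Fx _] := XP _ bw; have [cq xq] := param_img (VU _ Vx).
  split; first by split=> //; rewrite xq.
    by rewrite fE// xq indep.
  by rewrite fE// xq; move: Fx; rewrite mul_mx_row => /eq_row_mx[].
exists (Patch E a0 b0 r (profile F B3 X b0) W); split=> /=.
  by split.
split=> /=.
- rewrite openE => q [cq Vq].
  have N1 : \forall q' \near q, dom c q'.
    by apply: open_nbhs_nbhs; split; [exact: dom_open|].
  have cc := @Defs.coord_continuous R n M c q cq.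
  have N2 : \forall q' \near q, V (coord c q').
    exact: (cc V (open_nbhs_nbhs (conj oV Vq))).
  by apply: filterS2 N1 N2 => q' ? ?; split.
- exact: (smooth_profile oU sF B3 r0 sX XU).
- move=> a; exact: (profileK r0 FX).
- by move=> q /WE[].
- move=> a b ba bb; exists (param c (X (row_mx a b))); exact: lift.
- move=> q O Wq Oq; have [ba bb Xq _] := WE q Wq; have [cq Vq] := Wq.
  set a := _ *m E^T in ba Xq *; set b := _ *m B2^T in bb Xq.
  have N1 : \forall a' \near a, ball a0 r a'.
    by apply: open_nbhs_nbhs; split=> //; exact: ball_open.
  have bw := (spl _ _).2 (conj ba bb).
  have cp := @param_continuous R n M c _ (XU _ bw).
  have N2 : \forall a' \near a, O (param c (X (row_mx a' b))).
    have s1 : smooth_on setT (fun a' : 'rV[R]_2 => row_mx 0 b + a' *m row_mx 1%:M 0).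
      exact: smooth_affine openT.
    have c1 := smooth_continuous s1 (x := a) I.
    have c2 := smooth_continuous sX bw.
    have O1 : nbhs (X (row_mx a b)) (param c @^-1` O).
      by apply: cp; rewrite Xq coordK.
    have O2 := c2 _ O1; rewrite row_mx_affine in O2.
    have O3 : \forall a' \near a, O (param c (X (row_mx 0 b + a' *m row_mx 1%:M 0))).
      exact: c1 _ O2.
    by apply: filterS O3 => a'; rewrite -row_mx_affine.
  apply: filterS2 N1 N2 => a' ba' Oa'; have [Wq' q3 _] := lift _ _ ba' bb.
  by exists (param c (X (row_mx a' b))).
- exists (profile_normal (N c) B3 X b0); split.
  + exact: (smooth_profile_normal oU (sN c) B3 r0 sX XU).
  + move=> a; exact: (profile_normal_unit uN NK B3B r0 XU).
  + move=> a; exact: (profile_normal_orth oU sF nN NK B3B r0 sX XU).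
  + move=> a; exact: (profile_curvature oU sF (@sN c) fF uN nN NK LK symK trA B3B r0 sX XU FX).
Qed.

End PatchExistence.

(** * Gluing the profile surfaces *)

Lemma covering_walk (X : topologicalType) (V : nat -> set X) :
  (forall i, open (V i)) -> (forall i, V i !=set0) -> (forall p, exists i, V i p) ->
  connected [set: X] ->
  exists w : nat -> nat, (forall i, exists k, w k = i) /\
    forall k, V (w k) `&` V (w k.+1) !=set0.
Proof.
move=> oV V0 covV cX; pose e := [rel i j | `[< V i `&` V j !=set0 >]].
have eP i j : reflect (V i `&` V j !=set0) (e i j) by exact: asboolP.
pose reach i j := exists2 s, path e i s & last i s = j.
have reachT i j k p : V j p -> V k p -> reach i j -> reach i k.
  move=> Vj Vk [s es sj]; exists (rcons s k); last by rewrite last_rcons.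
  by rewrite rcons_path es sj; apply/eP; exists p.
have reachA i j : reach i j.
  pose h p := `[< exists2 k, V k p & reach i k >].
  have hE p k : V k p -> h p = `[< reach i k >].
    move=> Vk; apply/asboolP/asboolP => [[l Vl il]|ik]; last by exists k.
    exact: reachT Vl Vk il.
  have hC : forall p q, h p = h q.
    apply: connected_locally_const => // p; have [k Vk] := covV p.
    have N1 : \forall q \near p, V k q by apply: open_nbhs_nbhs.
    by apply: filterS N1 => q Vq; rewrite (hE _ _ Vq) (hE _ _ Vk).
  have [p Vp] := V0 i; have [q Vq] := V0 j.
  have : h p by rewrite (hE _ _ Vp); apply/asboolP; exists [::].
  by rewrite (hC p q) (hE _ _ Vq) => /asboolP.
have [s sP] : {s : nat -> seq nat & forall i, path e i (s i) /\ last i (s i) = i.+1}.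
  by apply: (@choice nat (seq nat) (fun i s => path e i s /\ last i s = i.+1)) => i;
    have [l ? ?] := reachA i i.+1; exists l.
(* A state consists of the current node, the node aimed at, and the rest of
   the route to it. *)
pose step (x : nat * nat * seq nat) := if x.2 is j :: l then (j, x.1.2, l)
  else (x.1.1, x.1.2.+1, s x.1.2).
pose st k := iter k step (0%N, 0%N, [::]).
have inv k : path e (st k).1.1 (st k).2 /\ last (st k).1.1 (st k).2 = (st k).1.2.
  elim: k => [//|k]; rewrite /st iterS -/(st k).
  case: (st k) => [[x y] [|j l]] /= [].
    by move=> _ ->; exact: sP.
  by move=> /andP[_ jl] lE.
exists (fun k => (st k).1.1); split=> [i|k]; last first.
  have [] := inv k; rewrite [st k.+1]iterS -/(st k).
  case: (st k) => [[x y] [|j l]] /=; last by move=> /andP[/eP].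
  by move=> _ _; have [p Vp] := V0 x; exists p.
suff [k kE] : exists k, st k = (i, i, [::]) by exists k; rewrite kE.
have finish k : exists m, st m = ((st k).1.2, (st k).1.2, [::]).
  have [m sz] := ubnP (size (st k).2); elim: m k sz => // m IH k.
  case: (inv k); case E : (st k) => [[x y] [|j l]] /=.
    by move=> _ xy _; exists k; rewrite E xy.
  move=> _ lE sz; have Ek : st k.+1 = (j, y, l) by rewrite /st iterS -/(st k) E.
  have [] := IH k.+1; rewrite Ek //= => m' m'E; by exists m'.
elim: i => [|i [k kE]]; first by exists 0%N.
have Ek : st k.+1 = (i, i.+1, s i) by rewrite /st iterS -/(st k) kE.
by have [m mE] := finish k.+1; exists m; rewrite mE Ek.
Qed.

Lemma countable_subcover (X : topologicalType) (V : X -> set X) (p0 : X) :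
  @second_countable X -> (forall p, open (V p) /\ V p p) ->
  exists v : nat -> X, forall p, exists i, V (v i) p.
Proof.
move=> [B /countable_injP[f finj] [_ Bnbhs]] VP.
pose Q k p := exists2 U, B U & U `<=` V p /\ f U = k.
have [v vP] : {v : nat -> X & forall k, (exists p, Q k p) -> Q k (v k)}.
  apply: (@choice nat X (fun k p => (exists p, Q k p) -> Q k p)) => k.
  have [[p Qp]|nQ] := pselect (exists p, Q k p); first by exists p.
  by exists p0 => /nQ.
exists v => p; have [oVp Vpp] := VP p.
have [U [BU Up] UV] := Bnbhs p _ (open_nbhs_nbhs (conj oVp Vpp)).
have [] := vP (f U); first by exists p, U.
move=> U' BU' [U'V fE]; exists (f U); apply: U'V.
by have -> : U' = U by apply: finj; rewrite ?inE.
Qed.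

Lemma connected_image (X Y : topologicalType) (A : set X) (h : X -> Y) :
  connected A -> (forall x, A x -> {for x, continuous h}) -> connected (h @` A).
Proof.
move=> cA ch; apply: connected_continuous_connected => //.
by apply: continuous_in_subspaceT => x; rewrite inE => /ch.
Qed.

Lemma compact_image (X Y : topologicalType) (A : set X) (h : X -> Y) :
  compact A -> (forall x, A x -> {for x, continuous h}) -> compact (h @` A).
Proof.
move=> cA ch; apply: continuous_compact => //.
by apply: continuous_in_subspaceT => x; rewrite inE => /ch.
Qed.

Lemma connected_union2 (X : topologicalType) (A B : set X) :
  A `&` B !=set0 -> connected A -> connected B -> connected (A `|` B).
Proof.
move=> [x [Ax Bx]] cA cB.
have -> : A `|` B = \bigcup_(i in [set: bool]) (if i then A else B).
  apply/seteqP; split=> y; first by move=> [Ay|By]; [exists true|exists false].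
  by move=> [[] _ Hy]; [left|right].
by apply: bigcup_connected => [|[]]//; exists x => -[].
Qed.

Lemma connected_setD (X : topologicalType) (A U C : set X) :
  connected A -> open U -> U `<=` A -> closed C -> C `<=` U ->
  connected (U `\` C) -> connected (A `\` C).
Proof.
move=> cA oU UA cC CU cUC G [g Gg] [W oW GW] [F cF GF].
have GA x : G x -> [/\ A x, ~ C x, W x & F x].
  by move=> Gx; move: (Gx); rewrite {1}GW => -[[Ax Cx] Wx]; move: Gx; rewrite GF => -[].
have oC : open (~` C) by exact: closed_openC.
have oF : open (~` F) by exact: closed_openC.
have [[u [[Uu Cu] Gu]]|UG] := pselect ((U `\` C) `&` G !=set0).
  have UCG : U `\` C `<=` G.
    have -> : U `\` C = (U `\` C) `&` G; last by move=> x [].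
    apply/esym/cUC; first by exists u; split.
      by exists W => //; apply/seteqP; split=> x [[Ux Cx]]; [move=> /GA[]//|];
        move=> Wx; split=> //; rewrite GW; split=> //; split=> //; exact: UA.
    by exists F => //; apply/seteqP; split=> x [[Ux Cx]]; [move=> /GA[]//|];
      move=> Wx; split=> //; rewrite GF; split=> //; split=> //; exact: UA.
  have E : G `|` C = A.
    apply: cA; first by exists g; left.
      exists ((W `&` ~` C) `|` U); first by apply: openU => //; exact: openI.
      apply/seteqP; split=> x.
        move=> [/GA[Ax Cx Wx _]|Cx]; first by split=> //; left.
        by split; [exact/UA/CU|right; exact: CU].
      move=> [Ax [[Wx Cx]|Ux]]; first by left; rewrite GW.
      by have [Cx|Cx] := pselect (C x); [right|left; exact: UCG].
    exists (F `|` C); first exact: closedU.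
    apply/seteqP; split=> x.
      move=> [/GA[Ax _ _ Fx]|Cx]; first by split=> //; left.
      by split; [exact/UA/CU|right].
    move=> [Ax [Fx|Cx]]; last by right.
    by have [Cx|Cx] := pselect (C x); [right|left; rewrite GF].
  apply/seteqP; split=> x; first by move=> /GA[].
  by move=> [Ax Cx]; move: Ax; rewrite -E => -[].
have UnG x : U x -> ~ G x.
  by move=> Ux Gx; apply: UG; exists x; split=> //; split=> //; have [] := GA _ Gx.
have E : G = A.
  apply: cA; first by exists g.
    exists (W `&` ~` C); first exact: openI.
    by rewrite GW; apply/seteqP; split=> x; [move=> [[? ?] ?]|move=> [? [? ?]]].
  exists (F `&` ~` U).
    by apply: closedI => //; exact: open_closedC.
  apply/seteqP; split=> x.
    by move=> Gx; have [Ax _ _ Fx] := GA _ Gx; split=> //; split=> // /UnG.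
  by move=> [Ax [Fx Ux]]; rewrite GF; split=> //; split=> // /CU.
apply/seteqP; split=> x; first by move=> /GA[].
by move=> [Ax _]; rewrite E.
Qed.

Section PlaneConvexity.
Context {R : realType}.
Implicit Types A : set 'rV[R]_2.

Definition star_convex A := forall u v s, A u -> A v -> 0 <= s <= 1 -> A (u + s *: (v - u)).

Lemma star_convex_connected A : star_convex A -> connected A.
Proof.
move=> cA; have [[u Au]|A0] := pselect (A !=set0); last first.
  suff -> : A = set0 by exact: connected0.
  by apply/seteqP; split=> x // Ax; apply: A0; exists x.
have -> : A = \bigcup_(v in A) ((fun s : R => u + s *: (v - u)) @` `[0, 1]).
  apply/seteqP; split=> [v Av|_ [v Av [s /= s01 <-]]].
    by exists v => //; exists 1; rewrite /= ?in_itv/= ?ler01 ?lexx// scale1r subrKC.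
  by apply: cA => //; move: s01; rewrite in_itv.
apply: bigcup_connected => [|v Av].
  by exists u => v _; exists 0; rewrite /= ?in_itv/= ?ler01 ?lexx// scale0r addr0.
apply: connected_image; first exact: segment_connected.
move=> s _; apply: continuousD; first exact: cvg_cst.
by apply: continuousZr_tmp; exact: cvg_id.
Qed.

Lemma star_convexI A B : star_convex A -> star_convex B -> star_convex (A `&` B).
Proof. by move=> cA cB u v s [Au Bu] [Av Bv] s01; split; [exact: cA|exact: cB]. Qed.

Lemma star_convex_half (i : 'I_2) (a b : R) : star_convex [set v | a * v 0 i < b].
Proof.
move=> u v s /= au av /andP[s0 s1]; rewrite !mxE.
have -> : a * (u 0 i + s * (v 0 i - u 0 i)) = (1 - s) * (a * u 0 i) + s * (a * v 0 i).
  by ring.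
move: (a * u 0 i) (a * v 0 i) au av => x y xb yb.
by have [->|s'] := eqVneq s 0; [lra|nra].
Qed.

Definition in_sq (c : R) : set 'rV[R]_2 := [set v | `|v 0 0| < c /\ `|v 0 1| < c].
Definition in_csq : set 'rV[R]_2 := [set v | `|v 0 0| <= 1 /\ `|v 0 1| <= 1].
(* The side [s * v 0 0 = -1] of the square is the one that can be crossed. *)
Definition slit (s : R) : set 'rV[R]_2 :=
  [set v | in_csq v /\ (s * v 0 0 = 1 \/ `|v 0 1| = 1)].

Lemma star_convex_sq c : star_convex (in_sq c).
Proof.
have -> : in_sq c = [set v | 1 * v 0 0 < c] `&` [set v | -1 * v 0 0 < c] `&`
    ([set v | 1 * v 0 1 < c] `&` [set v | -1 * v 0 1 < c]).
  apply/seteqP; split=> v; rewrite /in_sq /= !ltr_norml !mul1r !mulN1r.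
    by move=> [/andP[? ?] /andP[? ?]]; split; split=> //; rewrite ltrNl.
  by move=> [[? ?] [? ?]]; split; apply/andP; split=> //; rewrite ltrNl.
by do 2?apply: star_convexI; exact: star_convex_half.
Qed.

Definition pt (x y : R) : 'rV[R]_2 := \row_(i < 2) if i == 0 then x else y.
Lemma pt0 x y : pt x y 0 0 = x. Proof. by rewrite mxE. Qed.
Lemma pt1 x y : pt x y 0 1 = y. Proof. by rewrite mxE. Qed.

Lemma slit_complement_connected (s : R) : s = 1 \/ s = -1 ->
  connected (in_sq 2 `&` ~` slit s).
Proof.
move=> s1; have ss : s * s = 1 by case: s1 => ->; rewrite ?mulr1 ?mulrNN ?mulr1.
pose H (i : 'I_2) (a b : R) : set 'rV[R]_2 := [set v : 'rV[R]_2 | a * v 0 i < b] `&` in_sq 2.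
have cH i a b : star_convex (H i a b).
  by apply: star_convexI; [exact: star_convex_half|exact: star_convex_sq].
pose A1 := H 0 s 1 `&` (H 1 1 1 `&` H 1 (-1) 1); pose A2 := H 0 s (-1).
pose A3 := H 1 (-1) (-1); pose A4 := H 1 1 (-1); pose A5 := H 0 (- s) (-1).
have sq x y : `|x| < 2 -> `|y| < 2 -> in_sq 2 (pt x y) by rewrite /in_sq /= pt0 pt1.
have b0 : `|0 : R| < 2 by rewrite normr0.
have b1 : `|3 / 2 : R| < 2 by rewrite ger0_norm; lra.
have bs : `|- s * (3 / 2) : R| < 2 by case: s1 => ->; rewrite ?opprK ?mul1r ?mulN1r ?normrN.
have bs' : `|s * (3 / 2) : R| < 2 by case: s1 => ->; rewrite ?mul1r ?mulN1r ?normrN.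
have b1' : `|- (3 / 2) : R| < 2 by rewrite normrN.
have -> : in_sq 2 `&` ~` slit s = (((A2 `|` A1) `|` A3) `|` A4) `|` A5.
  apply/seteqP; split=> v.
    move=> [sv nv]; rewrite /A1 /A2 /A3 /A4 /A5 /H /setI /setU /=.
    have [h1|h1] := ltP (s * v 0 0) (-1); first by do 4 left.
    have [h2|h2] := ltP (-1 * v 0 1) (-1); first by left; left; right.
    have [h3|h3] := ltP (1 * v 0 1) (-1); first by left; right.
    have [h5|h5] := ltP (- s * v 0 0) (-1); first by right.
    do 3 left; right; move: h2 h3; rewrite mulN1r mul1r => h2 h3.
    have csq : in_csq v.
      split; last by rewrite ler_norml; lra.
      by case: s1 h1 h5 => ->; rewrite ?opprK ?mulN1r ?mul1r => h1 h5; rewrite ler_norml; lra.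
    have nx : s * v 0 0 != 1 by apply/eqP => E; apply: nv; split=> //; left.
    have ny : `|v 0 1| != 1 by apply/eqP => E; apply: nv; split=> //; right.
    have ly : `|v 0 1| < 1 by rewrite lt_neqAle ny; case: csq.
    move: ly; rewrite ltr_norml => /andP[ly1 ly2].
    have lx : s * v 0 0 < 1 by rewrite lt_neqAle nx; lra.
    by repeat split=> //=; try (by case: sv); lra.
  have nslit : [\/ s * v 0 0 > 1, s * v 0 0 < -1, `|v 0 1| > 1 |
      s * v 0 0 < 1 /\ `|v 0 1| < 1] -> ~ slit s v.
    move=> h [[cx cy] e].
    have cx' : `|s * v 0 0| <= 1 by case: s1 => ->; rewrite ?mul1r ?mulN1r ?normrN.
    move: cx'; rewrite ler_norml => /andP[c1 c2].
    case: h => [h|h|h|[h h']]; try lra.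
  rewrite /A1 /A2 /A3 /A4 /A5 /H /setI /setU /=.
  move=> [[[[h|h]|h]|h]|h]; split; try (by case: h => // -[]); apply: nslit.
  - by constructor 2; case: h.
  - case: h => -[h _] [[h1 _] [h2 _]]; constructor 4; split=> //.
    by rewrite ltr_norml; lra.
  - constructor 3; case: h => h _; apply: lt_le_trans (ler_norm _); lra.
  - constructor 3; case: h => h _; rewrite -normrN; apply: lt_le_trans (ler_norm _); lra.
  - by constructor 1; case: h => h _; lra.
have c1 : connected A1.
  apply: star_convex_connected; apply: star_convexI; first exact: cH.
  by apply: star_convexI; exact: cH.
have c2 : connected A2 by exact: star_convex_connected (cH _ _ _).
have c3 : connected A3 by exact: star_convex_connected (cH _ _ _).
have c4 : connected A4 by exact: star_convex_connected (cH _ _ _).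
have c5 : connected A5 by exact: star_convex_connected (cH _ _ _).
have sns : s * (- s * (3 / 2)) = - (3 / 2) by rewrite mulrA mulrN ss mulN1r.
have ssp : s * (s * (3 / 2)) = 3 / 2 by rewrite mulrA ss mul1r.
have snp : - s * (s * (3 / 2)) = - (3 / 2) by rewrite mulrA mulNr ss mulN1r.
apply: connected_union2 => //.
  exists (pt (s * (3 / 2)) (3 / 2)); split; last first.
    by split; [rewrite /= pt0 snp; lra|exact: sq].
  by left; right; split; [rewrite /= pt1; lra|exact: sq].
apply: connected_union2 => //.
  exists (pt (- s * (3 / 2)) (- (3 / 2))); split; last first.
    by split; [rewrite /= pt1; lra|exact: sq].
  by left; left; split; [rewrite /= pt0 sns; lra|exact: sq].
apply: connected_union2 => //.
  exists (pt (- s * (3 / 2)) (3 / 2)); split; last first.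
    by split; [rewrite /= pt1; lra|exact: sq].
  by left; split; [rewrite /= pt0 sns; lra|exact: sq].
apply: connected_union2 => //.
exists (pt (- s * (3 / 2)) 0); split.
  by split; [rewrite /= pt0 sns; lra|exact: sq].
by split; [|split]; (split; [rewrite /= ?pt0 ?pt1 ?sns; lra|exact: sq]).
Qed.

End PlaneConvexity.

Section Subtype.
Context {R : realType} {p : nat}.
Local Notation T := ('rV[R]_p * R)%type.
Variable A : set T.

Lemma continuous_set_val (x : A) : {for x, continuous (set_val : A -> T)}.
Proof. exact: initial_continuous. Qed.

Lemma set_type_hausdorff : hausdorff_space A.
Proof.
move=> x y xy; apply/val_inj; apply: (@norm_hausdorff R T) => B C Bx Cy.
have [z [Bz Cz]] := xy _ _ (continuous_set_val Bx) (continuous_set_val Cy).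
by exists (set_val z).
Qed.

Lemma set_type_nbhs_ball (x : A) (U : set A) : nbhs x U ->
  exists2 e : R, 0 < e & forall y : A, ball (set_val x) e (set_val y) -> U y.
Proof. by move=> /nbhs_ballP[e /= e0 eU]; exists e => // y xy; exact: eU. Qed.

Lemma set_type_second_countable : @second_countable A.
Proof.
pose q (i : 'rV[rat]_p * rat) : T := (map_mx ratr i.1, ratr i.2).
pose b (i : 'rV[rat]_p * rat * nat) : set A := set_val @^-1` ball (q i.1) (i.2.+1%:R^-1).
exists (range b).
  apply: (@card_le_trans _ _ _ [set: 'rV[rat]_p * rat * nat]); first exact: card_image_le.
  exact: countableP.
split=> [_ [i _ <-]|x U Ux].
  by apply: open_comp => [y _|]; [exact: continuous_set_val|exact: ball_open].
have [e e0 eU] := set_type_nbhs_ball Ux.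
have [m me] : exists m : nat, 2 * m.+1%:R^-1 < e.
  have [m _ /(_ m (leqnn m)) /= H] := near_infty_natSinv_lt (PosNum (divr_gt0 e0 (ltr0n R 2))).
  by exists m; rewrite mulrC -ltr_pdivlMr.
have m0 : 0 < m.+1%:R^-1 :> R by rewrite invr_gt0.
have rt (d a : R) : 0 < d -> exists c : rat, `|ratr c - a| < d.
  move=> d0; have [|c] := @rat_in_itvoo R (a - d) (a + d); first by lra.
  by rewrite in_itv/= => /andP[c1 c2]; exists c; rewrite ltr_norml; apply/andP; split; lra.
have [u uP] := choice (fun i : 'I_p => rt _ ((set_val x).1 0 i) m0).
have [v vP] := rt _ (set_val x).2 m0.
have qx : ball (q (\row_i u i, v)) (m.+1%:R^-1) (set_val x).
  split=> /=; last by rewrite -ball_normE.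
  by split=> // i j; rewrite ord1 !mxE -ball_normE /=; exact: uP.
exists (b ((\row_i u i, v), m)); first by split=> //; exists ((\row_i u i, v), m).
move=> y /= qy; apply: eU; apply: (le_ball (ltW me)).
by rewrite mulr_natl mulr2n; apply: ball_triangle qy; exact: ball_sym.
Qed.

End Subtype.

Lemma continuous_cutoff (R : realType) (X : topologicalType) (h : X -> R) (D : set X) (a : X) :
  {for a, continuous h} ->
  (\forall b \near a, D b) \/ (\forall b \near a, ~ D b) \/ h a = 0 ->
  {for a, continuous (fun b => if `[< D b >] then h b else 0)}.
Proof.
move=> ch H; pose g b := if `[< D b >] then h b else 0.
suff : g @ a --> g a by [].
case: H => [ND|[ND|h0]].
- have -> : g a = h a by rewrite /g asboolT//; exact: nbhs_singleton ND.
  apply: (cvg_trans _ ch); apply: near_eq_cvg.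
  by apply: filterS ND => b Db; rewrite /g asboolT.
- have -> : g a = 0 by rewrite /g asboolF//; exact: nbhs_singleton ND.
  have c0 : (fun _ : X => 0 : R) @ a --> (0 : R) by exact: cvg_cst.
  apply: (cvg_trans _ c0); apply: near_eq_cvg.
  by apply: filterS ND => b Db; rewrite /g asboolF.
- have -> : g a = 0 by rewrite /g h0; case: ifP.
  have /cvgrPdist_lt ch' : h @ a --> 0 by rewrite -h0.
  apply/cvgrPdist_lt => e e0; apply: filterS (ch' e e0) => b; rewrite /g; case: ifP => // _ _.
  by rewrite subrr normr0.
Qed.

Lemma continuous_mulmxr (R : realType) p q r (L : 'M[R]_(q, r))
    (h : 'rV[R]_p -> 'rV[R]_q) (a : 'rV[R]_p) :
  {for a, continuous h} -> {for a, continuous (fun b => h b *m L)}.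
Proof.
move=> ch.
have cL : {for h a, continuous (fun y : 'rV[R]_q => y *m L)}.
  exact: smooth_continuous (smooth_linear L setT) I.
exact: (@continuous_comp _ _ _ h (fun y => y *m L) a ch cL).
Qed.

Section Links.
Context {R : realType}.
Variables (ps : nat -> 'rV[R]_2 -> 'rV[R]_3) (E : nat -> 'M[R]_(2, 3)).
Variables (cc : nat -> 'rV[R]_2) (rr : nat -> R).
Local Notation B k := (ball (cc k) (rr k)).
Hypotheses (psC : forall k a, B k a -> {for a, continuous (ps k)})
  (psK : forall k a, B k a -> ps k a *m (E k)^T = a).

Definition linked k a := [/\ B k a,
  \forall a' \near a, B k.+1 (ps k a' *m (E k.+1)^T) /\
    ps k.+1 (ps k a' *m (E k.+1)^T) = ps k a' &
  \forall b \near ps k a *m (E k.+1)^T, B k (ps k.+1 b *m (E k)^T) /\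
    ps k (ps k.+1 b *m (E k)^T) = ps k.+1 b].

Lemma near_linked k a : linked k a -> \forall a' \near a, linked k a'.
Proof.
move=> [Ba N1 N2]; have ct := continuous_mulmxr (L := (E k.+1)^T) (psC Ba).
have M0 : \forall a' \near a, B k a' by apply: open_nbhs_nbhs; split=> //; exact: ball_open.
have M1 := near_join N1.
have M2 := ct _ (near_join N2).
by apply: filterS2 M0 (filterI M1 M2) => a' ? [? ?]; split.
Qed.

Lemma nbhs_avoid (l : seq 'rV[R]_2) (U : set 'rV[R]_2) (a : 'rV[R]_2) : nbhs a U ->
  exists2 a', U a' & a' \notin l.
Proof.
elim: l U a => [|z l IH] U a Ua; first by exists a => //; exact: nbhs_singleton.
have [a1 [Ua1 a1z]] : exists a1, nbhs a1 U /\ a1 != z.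
  have [az|az] := eqVneq a z; last by exists a.
  have /nbhs_ballP[e /= e0 eU] := near_join Ua.
  exists (a + const_mx (e / 2)); split.
    have : ball a e (a + const_mx (e / 2)).
      split=> // i j; rewrite !mxE -ball_normE /= opprD addNKr normrN ger0_norm; lra.
    by move/eU.
  apply/eqP => /rowP/(_ 0); rewrite !mxE az => /eqP.
  by move=> /eqP; lra.
have [|a' [Ua' a'z] a'l] := IH (U `&` [set x | x <> z]) a1.
  apply: filterI => //; apply: open_nbhs_nbhs; split; last exact/eqP.
  have -> : [set x | x <> z] = ~` [set z] by apply/seteqP; split.
  apply: closed_openC; exact/accessible_closed_set1/hausdorff_accessible/norm_hausdorff.
by exists a' => //; rewrite inE negb_or a'l andbT; apply/eqP.
Qed.

Hypothesis links : forall k, exists a, linked k a.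

Let link_avoid k (l : seq 'rV[R]_3) : exists a, linked k a /\ ps k a \notin l.
Proof.
have [a la] := links k.
have [a' la' a'l] := nbhs_avoid [seq z *m (E k)^T | z <- l] (near_linked la).
exists a'; split=> //; apply: contra a'l => zl; have [Ba' _ _] := la'.
by apply/mapP; exists (ps k a') => //; rewrite psK.
Qed.

Lemma choose_link_points : exists e : nat -> 'rV[R]_2,
  (forall k, linked k (e k)) /\ forall j k, (j < k)%N -> ps j (e j) != ps k (e k).
Proof.
have [pick pickP] := choice (fun kl : nat * seq 'rV[R]_3 => link_avoid kl.1 kl.2).
pose st := fix st k := if k is j.+1 then ps j (pick (j, st j)) :: st j else [::].
exists (fun k => pick (k, st k)); split=> [k|j k jk]; first by have [] := pickP (k, st k).
have [_ /= nk] := pickP (k, st k); apply: contra nk => /eqP <-.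
elim: k jk => // k IH; rewrite ltnS leq_eqVlt => /orP[/eqP->|/IH]; rewrite inE ?eqxx//.
by move=> ->; rewrite orbT.
Qed.

Lemma choose_links : exists (e : nat -> 'rV[R]_2) (eps : nat -> R),
  [/\ forall k, 0 < eps k,
      forall k v, in_sq 3 v -> linked k (e k + eps k *: v) &
      forall j k v v', (j < k)%N -> (k <= j.+2)%N -> in_sq 3 v -> in_sq 3 v' ->
        ps j (e j + eps j *: v) <> ps k (e k + eps k *: v')].
Proof.
have [e [le de]] := choose_link_points; exists e.
pose z k := ps k (e k).
have [d dP] : {d : nat -> R & forall k, 0 < d k /\ forall j, (j < k.+3)%N -> j != k -> d k <= `|z k - z j|}.
  apply: (@choice nat R (fun k d => 0 < d /\ forall j, (j < k.+3)%N -> j != k -> d <= `|z k - z j|)) => k.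
  elim: k.+3 => [|m [d [d0 IH]]]; first by exists 1.
  have [mk|mk] := eqVneq m k.
    exists d; split=> // j; rewrite ltnS leq_eqVlt => /orP[/eqP->|/IH //].
    by rewrite mk eqxx.
  have zm : 0 < `|z k - z m|.
    rewrite normr_gt0 subr_eq0; case: (ltngtP m k) mk => // h _.
      by rewrite eq_sym; exact: de.
    exact: de.
  exists (Num.min d `|z k - z m|); split; first by rewrite lt_min d0 zm.
  move=> j; rewrite ltnS leq_eqVlt => /orP[/eqP-> _|jm jk]; rewrite ge_min ?lexx ?orbT//.
  by rewrite IH.
have [eps epsP] : {eps : nat -> R & forall k, 0 < eps k /\ forall v, in_sq 3 v ->
    linked k (e k + eps k *: v) /\ `|z k - ps k (e k + eps k *: v)| < d k / 2}.
  apply: (@choice nat R (fun k eps => 0 < eps /\ forall v, in_sq 3 v ->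
    linked k (e k + eps *: v) /\ `|z k - ps k (e k + eps *: v)| < d k / 2)) => k.
  have [Bk _ _] := le k; have [d0 _] := dP k; have d2 : 0 < d k / 2 by lra.
  have /cvgrPdist_lt/(_ _ d2) N2 := psC Bk.
  have N3 : nbhs (e k) [set a | linked k a /\ `|z k - ps k a| < d k / 2].
    exact: filterI (near_linked (le k)) N2.
  have [r /= r0 rP] := (nbhs_ballP _ _).1 N3.
  exists (r / 3); split; first by lra.
  move=> v [v0 v1]; apply: rP; split=> // i j; rewrite !mxE -ball_normE /= opprD addNKr normrN.
  rewrite normrM gtr0_norm; last by lra.
  have : `|v i j| < 3.
    by rewrite ord1; case: j => -[|[|//]] jl; [move: v0|move: v1];
      congr (`|v 0 _| < 3); exact: val_inj.
  by move: (`|v i j|) => x x3; nra.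
exists eps; split=> [k|k v|j k v v' jk kj sv sv' E0].
- by have [] := epsP k.
- by have [_ H] := epsP k => /H[].
- have [_ /(_ v sv)[_ Hj]] := epsP j; have [_ /(_ v' sv')[_ Hk]] := epsP k.
  have [_ /(_ k) dj] := dP j; have [_ /(_ j) dk] := dP k.
  have {}dj : d j <= `|z j - z k| by apply: dj; [rewrite ltnS|rewrite gtn_eqF].
  have {}dk : d k <= `|z j - z k|.
    rewrite distrC; apply: dk; last by rewrite ltn_eqF.
    by apply: (ltn_trans jk); rewrite ltnS -addn2 leq_addr.
  have tri := ler_distD (ps j (e j + eps j *: v)) (z j) (z k).
  move: Hk; rewrite -E0 distrC => Hk.
  have fin (x y w d1 d2 : R) : d1 <= x -> d2 <= x -> y < d1 / 2 -> w < d2 / 2 ->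
    x <= y + w -> False by lra.
  exact: fin dj dk Hj Hk tri.
Qed.

End Links.

Lemma near_preimage (X Y : topologicalType) (h : X -> Y) (a : X) (V : set Y) :
  {for a, continuous h} -> open V -> V (h a) -> \forall b \near a, V (h b).
Proof. by move=> ch oV Va; exact: ch _ (open_nbhs_nbhs (conj oV Va)). Qed.

Lemma near_ball (R : realType) (X : topologicalType) (Y : pseudoMetricType R)
    (h : X -> Y) (a : X) (r : R) :
  {for a, continuous h} -> 0 < r -> \forall b \near a, ball (h a) r (h b).
Proof. by move=> ch r0; exact: ch _ (nbhsx_ballx (h a) r r0). Qed.

Section Gluing.
Context {R : realType}.
Variables (ps : nat -> 'rV[R]_2 -> 'rV[R]_3) (E : nat -> 'M[R]_(2, 3)).
Variables (cc : nat -> 'rV[R]_2) (rr : nat -> R).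
Local Notation B k := (ball (cc k) (rr k)).
Hypotheses (psS : forall k, smooth_on (B k) (ps k))
  (psK : forall k a, B k a -> ps k a *m (E k)^T = a).
Variables (e : nat -> 'rV[R]_2) (eps : nat -> R).
Hypotheses (eps_gt0 : forall k, 0 < eps k)
  (lk : forall k v, in_sq 3 v -> linked ps E cc rr k (e k + eps k *: v))
  (disj : forall j k v v', (j < k)%N -> (k <= j.+2)%N -> in_sq 3 v -> in_sq 3 v' ->
        ps j (e j + eps j *: v) <> ps k (e k + eps k *: v')).

Let at_ k v := e k + eps k *: v.
Let node k v := ps k (at_ k v).
Let lam k (z : 'rV[R]_3) : 'rV[R]_2 := (eps k)^-1 *: (z *m (E k)^T - e k).
Let cell c k : set 'rV[R]_3 := node k @` in_sq c.
Let wall s k : set 'rV[R]_3 := node k @` slit s.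
Let ramp s k z := if `[< cell 1 k z >] then (1 + s * lam k z 0 0) / 2 else 0.
Let inramp k z := if k is j.+1 then ramp (-1) j z else 0.
Let inwall k z := if k is j.+1 then wall (-1) j z else False.
Let theta k z := k%:R + ramp 1 k z - inramp k z.
Let piece k : set 'rV[R]_3 :=
  [set z | [/\ (ps k @` B k) z, ~ wall 1 k z & ~ inwall k z]].

Let psC k a : B k a -> {for a, continuous (ps k)}.
Proof. by move=> Ba; exact: smooth_continuous (@psS k) Ba. Qed.

Lemma in_sq_le (c c' : R) v : c <= c' -> in_sq c v -> in_sq c' v.
Proof. by move=> cc' [v0 v1]; split; apply: lt_le_trans cc'. Qed.

Lemma slit_sq s (v : 'rV[R]_2) : slit s v -> in_sq 2 v.
Proof. by move=> [[v0 v1] _]; split; [move: v0|move: v1] => /le_lt_trans; apply; lra. Qed.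

Lemma slit_not_sq s (v : 'rV[R]_2) : s = 1 \/ s = -1 -> slit s v -> ~ in_sq 1 v.
Proof.
move=> s1 [_ h] [/ltr_normlP[v0 v0'] v1].
by case: h => h; [case: s1 h => ->; lra|move: v1; rewrite h ltxx].
Qed.

Let at_B k v : in_sq 3 v -> B k (at_ k v).
Proof. by move=> sv; have [] := @lk k v sv. Qed.

Let lamK k v : in_sq 3 v -> lam k (node k v) = v.
Proof.
move=> sv; rewrite /lam /node psK; last exact: at_B.
rewrite /at_ addrC addKr scalerA mulVf ?scale1r//; exact: lt0r_neq0.
Qed.

Let node_inj k v v' : in_sq 3 v -> in_sq 3 v' -> node k v = node k v' -> v = v'.
Proof. by move=> sv sv' vv'; rewrite -(lamK k sv) vv' lamK. Qed.

Let in_sq13 v : in_sq 1 v -> in_sq (3 : R) v. Proof. by apply: in_sq_le; lra. Qed.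
Let in_sq23 v : in_sq 2 v -> in_sq (3 : R) v. Proof. by apply: in_sq_le; lra. Qed.
Let slit3 s v : slit s v -> in_sq (3 : R) v. Proof. by move/slit_sq/in_sq23. Qed.

Let cell_le c c' k z : c <= c' -> cell c k z -> cell c' k z.
Proof. by move=> h [v sv <-]; exists v => //; exact: in_sq_le sv. Qed.

Let wall_cell s k z : wall s k z -> cell 3 k z.
Proof. by move=> [v sv <-]; exists v => //; exact: slit3 sv. Qed.

Let cell_disj j k z : (j < k)%N -> (k <= j.+2)%N -> cell 3 j z -> cell 3 k z -> False.
Proof. by move=> jk kj [v sv <-] [v' sv' E0]; exact: disj jk kj sv sv' (esym E0). Qed.

Let cell_wall s k z : s = 1 \/ s = -1 -> cell 1 k z -> ~ wall s k z.
Proof.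
move=> s1 [v sv <-] [v' sv' vv'].
have E0 := node_inj (slit3 sv') (in_sq13 sv) vv'.
by move: sv' sv; rewrite E0 => sv' sv; exact: slit_not_sq s1 sv' sv.
Qed.

Let s1p : (1 : R) = 1 \/ (1 : R) = -1. Proof. by left. Qed.
Let s1n : (-1 : R) = 1 \/ (-1 : R) = -1. Proof. by right. Qed.

Let ramp_cell s k z : s = 1 \/ s = -1 -> cell 1 k z ->
  ramp s k z = (1 + s * lam k z 0 0) / 2 /\ 0 < ramp s k z < 1.
Proof.
move=> s1 cz; have E0 : ramp s k z = (1 + s * lam k z 0 0) / 2 by rewrite /ramp asboolT.
split=> //; rewrite E0; case: cz => v sv <-; rewrite lamK; last exact: in_sq13.
case: sv => /ltr_normlP[v0 v1] _.
by case: s1 => ->; apply/andP; split; lra.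
Qed.

Let ramp_ncell s k z : ~ cell 1 k z -> ramp s k z = 0.
Proof. by move=> nc; rewrite /ramp asboolF. Qed.

Let ramp_bd s k z : s = 1 \/ s = -1 -> 0 <= ramp s k z < 1.
Proof.
move=> s1; have [/(ramp_cell s1)[_ /andP[/ltW-> ->]]//|/ramp_ncell->] := pselect (cell 1 k z).
by rewrite lexx ltr01.
Qed.

Let ramp_sum k z : cell 1 k z -> ramp 1 k z + ramp (-1) k z = 1.
Proof.
move=> cz; have [-> _] := ramp_cell s1p cz; have [-> _] := ramp_cell s1n cz.
by move: (lam k z 0 0) => x; lra.
Qed.

Let inramp_bd k z : 0 <= inramp k z < 1.
Proof. by case: k => [|k] /=; [rewrite lexx ltr01|exact: ramp_bd]. Qed.

Let theta_bd k z : k%:R - 1 < theta k z < k%:R + 1.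
Proof.
have /andP[r0 r1] := ramp_bd k z s1p; have /andP[i0 i1] := inramp_bd k z.
by rewrite /theta; apply/andP; split; lra.
Qed.

Let cell13 k z : cell 1 k z -> cell 3 k z. Proof. by apply: cell_le; lra. Qed.

Let inramp_out k z : cell 3 k z -> inramp k z = 0.
Proof.
case: k => //= k ck; apply: ramp_ncell => /cell13 ck'.
exact: cell_disj (ltnSn k) (leqnSn k.+1) ck' ck.
Qed.

Let inwall_out k z : cell 3 k z -> ~ inwall k z.
Proof.
case: k => [_ []|k /= ck /wall_cell ck'].
exact: cell_disj (ltnSn k) (leqnSn k.+1) ck' ck.
Qed.

Let cell_mid k z : cell 1 k z ->
  [/\ piece k z, piece k.+1 z, theta k z = theta k.+1 z & k%:R < theta k z < k%:R + 1].
Proof.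
move=> cz; have c3 := cell13 cz; have ir := inramp_out c3.
have nS : ~ cell 3 k.+1 z.
  by move=> c'; exact: cell_disj (ltnSn k) (leqnSn k.+1) c3 c'.
have rS : ramp 1 k.+1 z = 0 by apply: ramp_ncell => /cell13.
have rk := ramp_sum cz; have [_ /andP[r0 r1]] := ramp_cell s1p cz.
have [v sv vz] := c3; have [Bv N1 _] := @lk k v sv.
have [Bt pt] := nbhs_singleton N1.
split.
- split; [by exists (at_ k v)|exact: cell_wall|exact: inwall_out].
- split; [by exists (ps k (at_ k v) *m (E k.+1)^T) => //; rewrite pt|by move/wall_cell|].
  exact: cell_wall.
- rewrite /theta ir rS /= -natr1; lra.
- by rewrite /theta ir; apply/andP; split; lra.
Qed.

(* Sheet k lies at height k in R^3 x R, except over the square cells of its two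
   links: over the cell shared with sheet k + 1 both sheets climb from height k
   to height k + 1. Sheet k is slit along three sides of that cell, sheet k + 1
   along the three sides obtained by exchanging entrance and exit, so that the
   heights are continuous on the pieces left and the union is embedded. *)
Let S0 : set ('rV[R]_3 * R) := [set p | exists2 k, piece k p.1 & p.2 = theta k p.1].
Let dm k : set S0 := [set x : S0 | k%:R - 1 < (set_val x).2 < k%:R + 1].

Let dmP k (x : S0) : dm k x -> piece k (set_val x).1 /\ (set_val x).2 = theta k (set_val x).1.
Proof.
rewrite /dm /=; case: x => [[z t] /= zt]; have [j pj /= ->] := set_mem zt.
move=> /andP[h1 h2]; have /andP[t1 t2] := theta_bd j z.
have jk : (j < k.+2)%N by rewrite -(ltr_nat R) -!natr1; lra.
have kj : (k < j.+2)%N by rewrite -(ltr_nat R) -!natr1; lra.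
have [jk'|jk'|jk'] := ltngtP j k; last by move: pj; rewrite jk'.
  have {jk' kj}E0 : k = j.+1 by apply/eqP; rewrite eqn_leq jk' -ltnS kj.
  have cz : cell 1 j z.
    apply: contrapT => /(ramp_ncell 1) r0; move: h1; rewrite E0 /theta r0 -natr1.
    by have /andP[i0 _] := inramp_bd j z; lra.
  by rewrite E0; have [_ ? -> _] := cell_mid cz.
have {jk' jk}E0 : j = k.+1 by apply/eqP; rewrite eqn_leq jk' -ltnS jk.
have cz : cell 1 k z.
  apply: contrapT => /(ramp_ncell (-1)) r0; move: h2; rewrite E0 /theta /= r0 -natr1.
  by have /andP[i0 _] := ramp_bd k.+1 z s1p; lra.
by rewrite E0; have [? _ -> _] := cell_mid cz.
Qed.

Let in_sq0 (c : R) : 0 < c -> in_sq c 0.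
Proof. by move=> c0; split; rewrite mxE normr0. Qed.

Let S0_mid k : exists x : S0, dm k x /\ dm k.+1 x.
Proof.
have cz : cell 1 k (node k 0) by exists 0 => //; exact: in_sq0.
have [p1 _ _ /andP[t0 t1]] := cell_mid cz.
have Sz : S0 (node k 0, theta k (node k 0)) by exists k.
exists (exist (fun x => x \in S0) (node k 0, theta k (node k 0)) (mem_set Sz)).
rewrite /dm /= -natr1.
by split; apply/andP; split; lra.
Qed.

Let x0 : S0 := projT1 (cid (S0_mid 0)).

Let mk k a : S0 := match pselect (piece k (ps k a)) with
  | left H => exist (fun x => x \in S0) (ps k a, theta k (ps k a))
      (mem_set (ex_intro2 _ _ k H erefl))
  | right _ => x0 end.
Let cd k (x : S0) := (set_val x).1 *m (E k)^T.
Let pset k : set 'rV[R]_2 := [set a | B k a /\ piece k (ps k a)].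

Let mk_val k a : pset k a -> set_val (mk k a) = (ps k a, theta k (ps k a)).
Proof. by move=> [_ pa]; rewrite /mk; case: pselect. Qed.

Let dm_mk k a : pset k a -> dm k (mk k a).
Proof. by move=> pa; rewrite /dm /= mk_val//=; exact: theta_bd. Qed.

Let cd_dm k x : dm k x -> pset k (cd k x) /\ mk k (cd k x) = x.
Proof.
move=> /dmP[pz tE]; have [[a Ba az] _ _] := pz.
have E0 : cd k x = a by rewrite /cd -az psK.
have pa : pset k a by split=> //; rewrite az.
have V : set_val (mk k a) = set_val x.
  by rewrite mk_val//; case: (set_val x) az tE => z t /= -> ->.
by rewrite E0; split=> //; exact: val_inj V.
Qed.

Let cd_mk k a : pset k a -> cd k (mk k a) = a.
Proof. by move=> pa; rewrite /cd mk_val//=; case: pa => Ba _; exact: psK. Qed.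

Let imgE k : cd k @` dm k = pset k.
Proof.
apply/seteqP; split=> [_ [x /cd_dm[? _] <-]//|a pa].
by exists (mk k a); [exact: dm_mk|exact: cd_mk].
Qed.

Let at_C k v : {for v, continuous (at_ k)}.
Proof.
have -> : at_ k = fun v => e k + v *m (eps k)%:M.
  by apply/funext => u; rewrite /at_ mul_mx_scalar.
exact: smooth_continuous (smooth_affine _ _ (openT (T := 'rV[R]_2))) I.
Qed.

Let nodeC k v : in_sq 3 v -> {for v, continuous (node k)}.
Proof.
move=> sv; have c1 := psC (at_B k sv).
exact: (@continuous_comp _ _ _ (at_ k) (ps k) v (@at_C k v) c1).
Qed.

Let lamC j k a : B j a -> {for a, continuous (fun b => lam k (ps j b))}.
Proof.
move=> Ba; have c1 := continuous_mulmxr (L := (E k)^T) (psC Ba).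
have c2 (x : 'rV[R]_2) : {for x, continuous (fun x : 'rV[R]_2 => (eps k)^-1 *: (x - e k))}.
  have -> : (fun x : 'rV[R]_2 => (eps k)^-1 *: (x - e k)) =
      fun x => (- ((eps k)^-1 *: e k)) + x *m ((eps k)^-1)%:M.
    by apply/funext => u; rewrite mul_mx_scalar scalerBr addrC.
  exact: smooth_continuous (smooth_affine _ _ (openT (T := 'rV[R]_2))) I.
exact: (@continuous_comp _ _ _ (fun b => ps j b *m (E k)^T) _ a c1 (@c2 _)).
Qed.

Let open_sq (c : R) : open (in_sq c).
Proof.
have -> : in_sq c = (fun v : 'rV[R]_2 => `|v 0 0|) @^-1` [set x | x < c] `&`
    (fun v : 'rV[R]_2 => `|v 0 1|) @^-1` [set x | x < c] by [].
have co (j : 'I_2) : continuous (fun v : 'rV[R]_2 => `|v 0 j|).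
  move=> v; apply: (@continuous_comp _ _ _ (fun v : 'rV[R]_2 => v 0 j) Num.norm).
    exact: coord_continuous.
  exact: norm_continuous.
by apply: openI; apply: open_comp => [v _|]; [exact: co|exact: open_lt|exact: co|exact: open_lt].
Qed.

Let compact_csq : compact (@in_csq R).
Proof.
have -> : @in_csq R = [set v : 'rV[R]_2 | forall i, `[-1, 1]%classic (v ord0 i)].
  apply/seteqP; split=> v; rewrite /in_csq /=.
    move=> [v0 v1] i; rewrite in_itv/= -ler_norml.
    by case: i => -[|[|//]] il; [move: v0|move: v1]; congr (`|v 0 _| <= 1); exact: val_inj.
  by move=> H; split; rewrite ler_norml; [have := H 0|have := H 1]; rewrite in_itv.
by apply: (@rV_compact R 2 (fun=> `[-1, 1]%classic)) => _; exact: segment_compact.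
Qed.

Let compact_slit s : compact (@slit R s).
Proof.
have -> : @slit R s = @in_csq R `&` ((fun v : 'rV[R]_2 => s * v 0 0) @^-1` [set 1]
    `|` (fun v : 'rV[R]_2 => `|v 0 1|) @^-1` [set 1]) by [].
apply: compact_closedI => //; apply: closedU; apply: closed_comp; try exact: closed_eq.
  move=> v _; apply: (@continuousM R _ (fun=> s)); first exact: cst_continuous.
  exact: coord_continuous.
move=> v _; apply: (@continuous_comp _ _ _ (fun v : 'rV[R]_2 => v 0 1) Num.norm).
  exact: coord_continuous.
exact: norm_continuous.
Qed.

Let closed_wall s k : closed (wall s k).
Proof.
apply: compact_closed; first exact: norm_hausdorff.
apply: compact_image; first exact: compact_slit.
by move=> v sv; exact: (@nodeC k v (slit3 sv)).
Qed.

Let block k : set 'rV[R]_3 := node k @` @in_csq R.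

Let closed_block k : closed (block k).
Proof.
apply: compact_closed; first exact: norm_hausdorff.
apply: compact_image; first exact: compact_csq.
move=> v [v0 v1]; apply: (@nodeC k v).
by split; [move: v0|move: v1] => /le_lt_trans; apply; lra.
Qed.

Let cell_open j k c a : j = k \/ j = k.+1 -> c <= 3 -> B j a -> cell c k (ps j a) ->
  \forall b \near a, cell c k (ps j b).
Proof.
move=> jk c3 Ba [v sv vE].
have sv3 : in_sq 3 v by exact: in_sq_le sv.
have N1 : \forall b \near a, in_sq c (lam k (ps j b)).
  have sl : in_sq c (lam k (ps j a)) by rewrite -vE lamK.
  have cl := @lamC j k a Ba.
  exact: (near_preimage cl (open_sq (c := c)) sl).
have N2 : \forall b \near a, ps k (ps j b *m (E k)^T) = ps j b.
  case: jk => jE.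
    have N0 : \forall b \near a, B j b by apply: open_nbhs_nbhs; split=> //; exact: ball_open.
    by apply: filterS N0 => b Bb; rewrite -jE psK.
  have [_ _ N0] := @lk k v sv3.
  have aE : ps k (e k + eps k *: v) *m (E k.+1)^T = a by rewrite -jE -/(node k v) vE psK.
  by rewrite aE in N0; apply: filterS N0 => b [_]; rewrite jE.
apply: filterS2 N1 N2 => b sb bE; exists (lam k (ps j b)) => //.
rewrite /node -[RHS]bE; congr (ps k _); rewrite /at_ /lam scalerA mulfV ?scale1r ?subrKC//.
exact: lt0r_neq0.
Qed.

Let ramp_cont j k s a : s = 1 \/ s = -1 -> j = k \/ j = k.+1 -> B j a ->
  ~ wall s k (ps j a) -> {for a, continuous (fun b => ramp s k (ps j b))}.
Proof.
move=> s1 jk Ba nw; apply: (@continuous_cutoff R _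
    (fun b => (1 + s * lam k (ps j b) 0 0) / 2) (fun b => cell 1 k (ps j b))).
  have c1 := (mx_continuousP _ _).1 (@lamC j k a Ba) 0 0.
  have -> : (fun b => (1 + s * lam k (ps j b) 0 0) / 2) =
      (fun b => 2^-1 + (s / 2) * lam k (ps j b) 0 0).
    by apply/funext => b; move: (lam k _ _ _) => x; field.
  apply: continuousD; first exact: cst_continuous.
  by apply: continuousM; first exact: cst_continuous.
have [cz|ncz] := pselect (cell 1 k (ps j a)).
  by left; apply: cell_open => //; lra.
right; have [[v [v0 v1] vE]|nb] := pselect (block k (ps j a)).
  right; rewrite -vE lamK; last by split; [move: v0|move: v1] => /le_lt_trans; apply; lra.
  have nsl : ~ slit s v by move=> sv; apply: nw; exists v.
  have nsq : ~ in_sq 1 v by move=> sv; apply: ncz; exists v.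
  have y1 : `|v 0 1| < 1.
    by rewrite lt_neqAle v1 andbT; apply/eqP => h; apply: nsl; split=> //; right.
  have x1 : `|v 0 0| = 1.
    by apply: le_anti; rewrite v0 /= leNgt; apply/negP => h; apply: nsq; split.
  have nx : s * v 0 0 <> 1 by move=> h; apply: nsl; split=> //; left.
  have : s * v 0 0 = -1.
    by move/eqP: x1; rewrite eqr_norml => /andP[/orP[]/eqP x1 _]; case: s1 nx => ->;
      rewrite x1 ?mulrNN ?mulr1 ?mulN1r ?mul1r.
  by move=> ->; rewrite subrr mul0r.
left; have N2 : \forall b \near a, ~ block k (ps j b).
  exact: (near_preimage (psC Ba) (closed_openC (@closed_block k)) nb).
apply: filterS N2 => b nb' [v [v0 v1] vE]; apply: nb'.
by exists v => //; split; exact: ltW.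
Qed.

Let theta_cont k a : pset k a -> {for a, continuous (fun b => theta k (ps k b))}.
Proof.
move=> [Ba [_ nw niw]]; rewrite /theta.
have c1 : {for a, continuous (fun b => ramp 1 k (ps k b))}.
  by apply: ramp_cont => //; left.
have c2 : {for a, continuous (fun b => inramp k (ps k b))}.
  case: k Ba nw niw c1 => [|k] Ba nw niw c1; first exact: cst_continuous.
  by apply: ramp_cont => //; right.
apply: continuousB => //; apply: continuousD => //; exact: cst_continuous.
Qed.

Let open_pset k : open (pset k).
Proof.
rewrite openE => a [Ba [_ nw niw]] /=.
have N0 : \forall b \near a, B k b by apply: open_nbhs_nbhs; split=> //; exact: ball_open.
have N1 : \forall b \near a, ~ wall 1 k (ps k b).
  exact: (near_preimage (psC Ba) (closed_openC (@closed_wall 1 k)) nw).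
have N2 : \forall b \near a, ~ inwall k (ps k b).
  case: k Ba nw niw {N0 N1} => [|k] Ba nw niw; first by apply: filterE => b [].
  exact: (near_preimage (psC Ba) (closed_openC (@closed_wall (-1) k)) niw).
apply: filterS2 N0 (filterI N1 N2) => b Bb [n1 n2]; split=> //; split=> //.
Qed.

Let mk_cont k a : pset k a -> {for a, continuous (mk k)}.
Proof.
move=> pa U /set_type_nbhs_ball[r r0 rU].
have N0 : \forall b \near a, pset k b by apply: open_nbhs_nbhs; split=> //; exact: open_pset.
have [Ba _] := pa.
have N1 : \forall b \near a, ball (ps k a) r (ps k b).
  exact: (near_ball (psC Ba) r0).
have N2 : \forall b \near a, ball (theta k (ps k a)) r (theta k (ps k b)).
  exact: (near_ball (theta_cont pa) r0).
apply: filterS2 N0 (filterI N1 N2) => b pb [b1 b2].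
by apply: rU; rewrite mk_val// mk_val.
Qed.

Let cd_cont k x : {for x, continuous (cd k)}.
Proof.
have c1 : {for x, continuous (fun y : S0 => (set_val y).1)}.
  apply: (@continuous_comp _ _ _ (set_val : S0 -> _) fst); last exact: cvg_fst.
  exact: continuous_set_val.
have c2 (z : 'rV[R]_3) : {for z, continuous (fun z : 'rV[R]_3 => z *m (E k)^T)}.
  exact: smooth_continuous (smooth_linear (E k)^T setT) I.
exact: (@continuous_comp _ _ _ (fun y : S0 => (set_val y).1) _ x c1 (@c2 _)).
Qed.

Let dm_open k : open (dm k).
Proof.
have -> : dm k = (fun y : S0 => (set_val y).2) @^-1` `]k%:R - 1, k%:R + 1[.
  by apply/seteqP; split=> x; rewrite /dm /= in_itv.
apply: open_comp; last exact: interval_open.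
move=> x _; apply: (@continuous_comp _ _ _ (set_val : S0 -> _) snd); last exact: cvg_snd.
exact: continuous_set_val.
Qed.

Let slit_square_connected s (h : 'rV[R]_2 -> 'rV[R]_2) : s = 1 \/ s = -1 ->
  (forall v, in_sq 2 v -> {for v, continuous h}) ->
  connected (h @` (in_sq 2 `&` ~` slit s)).
Proof.
by move=> s1 ch; apply: connected_image; [exact: slit_complement_connected|move=> v [/ch]].
Qed.

Let ball_connected k : connected (B k).
Proof.
apply: star_convex_connected => u v s [r0 Bu] [_ Bv] /andP[s0 s1]; split=> // i j.
have := Bu i j; have := Bv i j; rewrite -!ball_normE /= !mxE.
move: (cc k i j) (u i j) (v i j) => c x y.
rewrite !ltr_norml => /andP[y1 y2] /andP[x1 x2].
have -> : c - (x + s * (y - x)) = (1 - s) * (c - x) + s * (c - y) by ring.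
move: (c - x) (c - y) x1 x2 y1 y2 => a b a1 a2 b1 b2.
have [->|sn] := eqVneq s 0; first by apply/andP; split; lra.
by apply/andP; split; nra.
Qed.

Let pset_connected k : connected (pset k).
Proof.
pose C1 := at_ k @` slit 1; pose U1 := at_ k @` in_sq 2.
have oU1 : open U1.
  have -> : U1 = (fun a => (eps k)^-1 *: (a - e k)) @^-1` in_sq 2.
    apply/seteqP; split=> [_ [v sv <-]|a sa] /=.
      by rewrite /at_ addrC addKr scalerA mulVf ?scale1r//; exact: lt0r_neq0.
    exists ((eps k)^-1 *: (a - e k)) => //.
    by rewrite /at_ scalerA mulfV ?scale1r ?subrKC//; exact: lt0r_neq0.
  apply: open_comp; last exact: open_sq.
  move=> x _; have -> : (fun x : 'rV[R]_2 => (eps k)^-1 *: (x - e k)) =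
      fun x => (- ((eps k)^-1 *: e k)) + x *m ((eps k)^-1)%:M.
    by apply/funext => u; rewrite mul_mx_scalar scalerBr addrC.
  exact: smooth_continuous (smooth_affine _ _ (openT (T := 'rV[R]_2))) I.
have at_inj : injective (at_ k).
  by move=> v v' /addrI/(scalerI (lt0r_neq0 (eps_gt0 k))).
have cC1 : closed C1.
  apply: compact_closed; first exact: norm_hausdorff.
  by apply: compact_image => [|v _]; [exact: compact_slit|exact: at_C].
have CU1 : C1 `<=` U1 by move=> _ [v /slit_sq sv <-]; exists v.
have cD1 : connected (B k `\` C1).
  apply: (connected_setD (@ball_connected k) oU1 _ cC1 CU1).
    by move=> _ [v sv <-]; apply: at_B; exact: in_sq23.
  have -> : U1 `\` C1 = at_ k @` (in_sq 2 `&` ~` slit 1).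
    apply/seteqP; split=> [_ [[v sv <-] nv]|_ [v [sv nv] <-]].
      by exists v => //; split=> // sl; apply: nv; exists v.
    by split; [exists v|move=> [v' sl /at_inj E0]; apply: nv; rewrite -E0].
  apply: slit_square_connected; first exact: s1p.
  by move=> v _; exact: at_C.
have wallE a : B k a -> wall 1 k (ps k a) <-> C1 a.
  move=> Ba; split=> [[v sv vE]|[v sv <-]]; exists v => //.
  by rewrite -[a in RHS](psK Ba) -vE psK//; apply: at_B; exact: slit3 sv.
clear oU1 at_inj cC1 CU1; clear U1; clearbody C1.
case: k cD1 wallE => [|k] cD1 wallE.
  have -> : pset 0 = B 0 `\` C1.
    apply/seteqP; split=> [a [Ba [_ nw _]]|a [Ba nC]].
      by split=> // /(wallE _ Ba).
    by split; [exact: Ba|split; [by exists a|by move/(wallE _ Ba)|by case]].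
  exact: cD1.
pose h v := node k v *m (E k.+1)^T.
have hB v : in_sq 3 v -> B k.+1 (h v) /\ ps k.+1 (h v) = node k v.
  by move=> sv; have [_ N1 _] := @lk k v sv; exact: nbhs_singleton N1.
have hC v : in_sq 3 v -> {for v, continuous h}.
  by move=> sv; exact: continuous_mulmxr (nodeC sv).
have h_inj v v' : in_sq 3 v -> in_sq 3 v' -> h v = h v' -> v = v'.
  move=> sv sv' hE; apply: (node_inj (k := k)) => //.
  by rewrite -(hB v sv).2 -(hB v' sv').2 hE.
pose C2 := h @` slit (-1); pose U2 := [set b | B k.+1 b /\ cell 2 k (ps k.+1 b)].
have UE : U2 = h @` in_sq 2.
  apply/seteqP; split=> [b [Bb [v sv vE]]|_ [v sv <-]].
    by exists v => //; rewrite /h vE psK.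
  have [? hE] := hB v (in_sq23 sv).
  by split=> //; rewrite hE; exists v.
have oU2 : open U2.
  rewrite openE => b [Bb cb] /=.
  have N0 : \forall b' \near b, B k.+1 b'.
    by apply: open_nbhs_nbhs; split=> //; exact: ball_open.
  have N1 : \forall b' \near b, cell 2 k (ps k.+1 b').
    by apply: cell_open => //; [right|lra].
  by apply: filterS2 N0 N1 => b' ? ?; split.
have cC2 : closed C2.
  apply: compact_closed; first exact: norm_hausdorff.
  by apply: compact_image => [|v sv]; [exact: compact_slit|apply: hC; exact: slit3 sv].
have CU2 : C2 `<=` U2 by rewrite UE => _ [v /slit_sq sv <-]; exists v.
have -> : pset k.+1 = (B k.+1 `\` C1) `\` C2.
  apply/seteqP; split=> [a [Ba [_ nw niw]]|a [[Ba nC1] nC2]].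
    split; first by split=> // /(wallE _ Ba).
    move=> [v sv vE]; apply: niw; exists v => //.
    by rewrite -vE (hB v (slit3 sv)).2.
  split; first exact: Ba.
  split; [by exists a|by move/(wallE _ Ba)|].
  by move=> [v sv vE]; apply: nC2; exists v => //; rewrite /h vE psK.
apply: (connected_setD cD1 oU2 _ cC2 CU2).
  move=> b [Bb cb]; split=> // /(wallE _ Bb)/wall_cell c'.
  apply: (@cell_disj k k.+1 (ps k.+1 b)) => //.
  by apply: cell_le cb; lra.
have -> : U2 `\` C2 = h @` (in_sq 2 `&` ~` slit (-1)).
  rewrite UE; apply/seteqP; split=> [_ [[v sv <-] nv]|_ [v [sv nv] <-]].
    by exists v => //; split=> // sl; apply: nv; exists v.
  split; first by exists v.
  move=> [v' sl hE]; apply: nv.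
  by rewrite -(h_inj _ _ (slit3 sl) (in_sq23 sv) hE).
apply: slit_square_connected; first exact: s1n.
by move=> v sv; exact: (@hC v (in_sq23 sv)).
Qed.

Let dm_connected k : connected (dm k).
Proof.
have -> : dm k = mk k @` pset k.
  apply/seteqP; split=> [x /cd_dm[px xE]|_ [a pa <-]]; last exact: dm_mk.
  by exists (cd k x).
by apply: connected_image => // a; exact: mk_cont.
Qed.

Let S0_cover (x : S0) : exists k, dm k x.
Proof.
case: x => -[z t] zt; have [k pk /= tE] := set_mem zt; exists k.
by rewrite /dm /= tE; exact: theta_bd.
Qed.

Let S0_connected : connected [set: S0].
Proof.
pose G k := \bigcup_(i in [set i | (i <= k)%N]) dm i.
have cG k : connected (G k).
  elim: k => [|k IH].
    have -> : G 0 = dm 0.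
      apply/seteqP; split=> [x [i /= i0]|x dx]; last by exists 0.
      by move: i0; rewrite leqn0 => /eqP->.
    exact: dm_connected.
  have -> : G k.+1 = G k `|` dm k.+1.
    apply/seteqP; split=> [x [i /= ik dx]|x [[i /= ik dx]|dx]].
    - by move: ik; rewrite leq_eqVlt => /orP[/eqP E0|ik];
        [right; rewrite -E0|left; exists i].
    - by exists i => //=; exact: leqW.
    - by exists k.+1 => /=.
  apply: connected_union2 => //.
  by have [x [x1 x2]] := S0_mid k; exists x; split=> //; exists k => /=.
have -> : [set: S0] = \bigcup_(k in setT) G k.
  apply/seteqP; split=> // x _; have [k dk] := S0_cover x.
  by exists k => //; exists k => /=.
apply: bigcup_connected => [|k _]; last exact: cG.
by have [x [x1 _]] := S0_mid 0; exists x => k _; exists 0.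
Qed.

Let transition_S0 k k' : smooth_on (cd k @` (dm k `&` dm k')) (fun a => cd k' (mk k a)).
Proof.
pose O' := [set a | pset k a /\ dm k' (mk k a)].
have -> : cd k @` (dm k `&` dm k') = O'.
  apply/seteqP; split=> [_ [x [/cd_dm[px xE] dx'] <-]|a [pa da]].
    by split=> //; rewrite xE.
  by exists (mk k a); [split=> //; exact: dm_mk|exact: cd_mk].
have oO : open O'.
  rewrite openE => a [pa da] /=.
  have N0 : \forall b \near a, pset k b by apply: open_nbhs_nbhs; split=> //; exact: open_pset.
  have N1 : \forall b \near a, dm k' (mk k b).
    exact: (near_preimage (mk_cont pa) (@dm_open k') da).
  by apply: filterS2 N0 N1 => b ? ?; split.
apply: (smooth_ext (F := fun a => ps k a *m (E k')^T)) => //.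
  by move=> a; rewrite inE => -[pa _]; rewrite /cd mk_val.
apply: smooth_mulmx => //; last exact: smooth_cst.
by apply: smooth_subset (@psS k) => a [[]].
Qed.

Lemma glue_sheets : exists (S : manifold R 2) (s : S -> 'rV[R]_3) (idx : chart S -> nat),
  (forall c x, img c x -> B (idx c) x /\ s (param c x) = ps (idx c) x) /\
  (forall k a, B k a ->
    (forall j, (k < j <= k.+2)%N -> [/\ ps j = ps k, cc j = cc k & rr j = rr k]) ->
    exists c, img c a /\ (k <= idx c <= k.+2)%N).
Proof.
pose S := @Manifold R 2 S0 nat dm cd mk dm_open S0_cover
  (fun k => eq_ind_r open (@open_pset k) (imgE k))
  (fun k x dx => (cd_dm dx).2) (fun k x _ => @cd_cont k x)
  (fun k a ia => mk_cont (eq_ind _ (fun X => X a) ia _ (imgE k)))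
  transition_S0 (@set_type_hausdorff R 3 S0) (@set_type_second_countable R 3 S0)
  S0_connected.
have iE (j : nat) : @img R 2 S j = pset j := imgE j.
exists S, (fun x : S0 => (set_val x).1), (fun k : nat => k); split=> [k a|k a Ba same].
  rewrite (iE k) => pa; split; first by case: pa.
  by rewrite [param k a]/(mk k a) mk_val.
have cover j : (k <= j <= k.+2)%N -> piece j (ps k a) -> exists c : chart S,
    img c a /\ (k <= c <= k.+2)%N.
  move=> kj pj; exists j; split=> //; rewrite (iE j).
  have [jk|jk] := eqVneq k j; first by rewrite -jk in pj *.
  have [|pE cE rE] := same j; first by rewrite ltn_neqAle jk.
  by split; [rewrite cE rE|rewrite pE].
have inB j : (k <= j <= k.+2)%N -> (ps j @` B j) (ps k a).
  move=> kj; have [jk|jk] := eqVneq k j; first by rewrite -jk; exists a.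
  have [|pE cE rE] := same j; first by rewrite ltn_neqAle jk.
  by exists a; [rewrite cE rE|rewrite pE].
have nwall j s : ~ cell 3 j (ps k a) -> ~ wall s j (ps k a) by move=> nc /wall_cell.
have [ck|nk] := pselect (cell 3 k (ps k a)).
  have n1 : ~ cell 3 k.+1 (ps k a) by move=> c'; exact: (cell_disj _ _ ck c').
  have n2 : ~ cell 3 k.+2 (ps k a) by move=> c'; exact: (cell_disj _ _ ck c').
  apply: (cover k.+2); first by rewrite leqnn -addn2 leq_addr.
  split; [by apply: inB; rewrite leqnn -addn2 leq_addr|exact: nwall|exact: nwall].
have [iw|niw] := pselect (inwall k (ps k a)); last first.
  apply: (cover k); first by rewrite leqnn -addn2 leq_addr.
  by split; [exists a|exact: nwall|exact: niw].
case: k Ba same cover inB nwall nk iw => [//|k] Ba same cover inB nwall nk /= /wall_cell ck.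
have n1 : ~ cell 3 k.+2 (ps k.+1 a) by move=> c'; exact: (cell_disj _ _ ck c').
apply: (cover k.+2); first by rewrite !leqnSn.
by split; [apply: inB; rewrite !leqnSn|exact: nwall|exact: nwall].
Qed.

End Gluing.

(** * The global cylinder *)

Lemma induced_metric (R : realType) n (S : manifold R n) m (s : S -> 'rV[R]_m) :
  immersion s -> exists h : riemannian_metric S, isometric_immersion h s.
Proof.
move=> imm; have oU (c : chart S) : open (img c) := @img_open _ _ S c.
have sD (c : chart S) : smooth_on (img c) (jacobian (local_rep s c)).
  exact: smooth_jacobian (oU c) (imm c).1.
pose h (c : chart S) x := 'J (local_rep s c) x *m ('J (local_rep s c) x)^T.
have h1 c : smooth_on (img c) (h c).
  exact: smooth_mulmx (oU c) (sD c) (smooth_trmx (oU c) (sD c)).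
have h2 c x : img c x -> (h c x)^T = h c x by rewrite /h trmx_mul trmxK.
have h3 c x : img c x -> forall u : 'rV[R]_n, u != 0 -> 0 < (u *m h c x *m u^T) 0 0.
  move=> Ux u u0; rewrite /h; have := (imm c).2 x Ux; move: ('J _ x) => D fD.
  have -> : u *m (D *m D^T) *m u^T = (u *m D) *m (u *m D)^T by rewrite trmx_mul !mulmxA.
  have : u *m D != 0.
    apply: contra u0 => /eqP uD; apply/eqP; apply: (row_free_inj fD).
    by rewrite uD mul0mx.
  move: (u *m D) => v v0; rewrite eucl_norm_sqr mxE mulr1n lt0r sqr_ge0 andbT.
  apply: contra v0 => /eqP n0; apply/eqP; apply: trmx_mul_trace_eq0.
  by rewrite eucl_norm_sqr n0 raddf0 mxtrace0.
have h4 c c' x : overlap c c' x -> h c x = 'J (transition c c') x *m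
    h c' (transition c c' x) *m ('J (transition c c') x)^T.
  by move=> Ox; rewrite /h (jac_transition imm Ox) trmx_mul !mulmxA.
exists (RiemannianMetric h1 h2 h3 h4); split=> // c x Ux.
Qed.

Section PatchLinks.
Context {R : realType} {d : nat} {M : topologicalType}.
Variables (f3 : M -> 'rV[R]_3) (f2 : M -> 'rV[R]_d) (t : R).

Lemma patch_overlap (P P' : patch R d M) p : is_patch f3 f2 t P -> is_patch f3 f2 t P' ->
  patch_dom P p -> patch_dom P' p ->
  \forall a \near f3 p *m (patch_frame P)^T,
    patch_disc P' (patch_sheet P a *m (patch_frame P')^T) /\
    patch_sheet P' (patch_sheet P a *m (patch_frame P')^T) = patch_sheet P a.
Proof.
move=> iP iP' Pp P'p.
have N1 := patch_lift iP Pp (open_nbhs_nbhs (conj (patch_open iP') P'p)).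
apply: filterS N1 => a [q [_ P'q <-]].
by have [? _ ?] := patch_graph iP' P'q.
Qed.

Lemma patch_linked (P : nat -> patch R d M) k p :
  (forall k, is_patch f3 f2 t (P k)) -> patch_dom (P k) p -> patch_dom (P k.+1) p ->
  linked (fun k => patch_sheet (P k)) (fun k => patch_frame (P k))
    (fun k => patch_center (P k)) (fun k => patch_radius (P k)) k
    (f3 p *m (patch_frame (P k))^T).
Proof.
move=> iP kp kp'; have [Ba _ aE] := patch_graph (iP k) kp.
split; [exact: Ba|exact: patch_overlap|].
by rewrite aE; exact: patch_overlap.
Qed.

End PatchLinks.

Theorem theorem10 (R : realType) (n : nat) (n_ge4 : (4 <= n)%N)
  (M : manifold R n) (g : riemannian_metric M) (f : M -> 'rV[R]_n.+1)
  (f_isometric : isometric_immersion g f)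
  (f_cmc : constant_mean_curvature g f)
  (M_kaehler : kaehler g) :
  minimal g f \/
  exists (S : manifold R 2) (h : riemannian_metric S) (s : S -> 'rV[R]_3),
    [/\ isometric_immersion h s,
        constant_mean_curvature h s &
        image_open_in_cylinder f s].
Proof.
have n0 : (0 < n)%N by exact: leq_trans n_ge4.
have n2 : (2 <= n)%N by exact: leq_trans n_ge4.
have [|[t [N [K [t0 [symK KK trK] sN nN cN]]]]] :=
  cmc_kaehler_splitting n0 f_isometric f_cmc M_kaehler; first by left.
have [[p0 _]|M0] := pselect (exists p : M, True); last first.
  by left => c x [p]; case: M0; exists p.
right.
have [B2 [B2B BB2]] : exists B : 'M[R]_(n - 2, n.+1), B^T *m B = K /\ B *m B^T = 1%:M.
  by apply: sym_idem_factor => //; rewrite natrB.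
have [B3 [B3B BB3]] : exists B : 'M[R]_(3, n.+1), B^T *m B = 1%:M - K /\ B *m B^T = 1%:M.
  apply: sym_idem_factor.
  - by rewrite trmx_B trmx1 symK.
  - by rewrite mulmxBl mul1mx mulmxBr mulmx1 KK subrr subr0.
  - by rewrite mxtrace_B mxtrace1 trK -natr1; ring.
pose f3 q := f q *m B3^T; pose f2 q := f q *m B2^T.
have imf := f_isometric.1.
have [Pt PtP] := choice (patch_exists imf sN nN cN symK B3B B2B BB3 BB2).
have isP p : is_patch f3 f2 t (Pt p) by case: (PtP p).
have [v vP] : exists v : nat -> M, forall p, exists i, patch_dom (Pt (v i)) p.
  apply: (countable_subcover (V := fun p => patch_dom (Pt p)) p0).
    exact: manifold_second_countable.
  by move=> p; split; [exact: patch_open (isP p)|case: (PtP p)].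
have [w [wsurj wadj]] := covering_walk (V := fun i => patch_dom (Pt (v i)))
  (fun i => patch_open (isP (v i))) (fun i => ex_intro _ (v i) (PtP (v i)).1)
  vP (@manifold_connected _ _ M).
(* Each patch is used three times in a row: the links being disjoint, every
   point of it avoids the slits of one of the three copies. *)
pose P k := Pt (v (w (k %/ 3)%N)).
have iP k : is_patch f3 f2 t (P k) by exact: isP.
have links k : exists a, linked (fun k => patch_sheet (P k)) (fun k => patch_frame (P k))
    (fun k => patch_center (P k)) (fun k => patch_radius (P k)) k a.
  have [p [kp kp']] : exists p, patch_dom (P k) p /\ patch_dom (P k.+1) p.
    rewrite /P divnS//; case: (3 %| k.+1)%N => /=.
      by have [p [? ?]] := wadj (k %/ 3)%N; exists p.
    by exists (v (w (k %/ 3)%N)); rewrite add0n; split; case: (PtP (v (w (k %/ 3)%N))).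
  by exists (f3 p *m (patch_frame (P k))^T); exact: patch_linked.
have psC k a : patch_disc (P k) a -> {for a, continuous (patch_sheet (P k))}.
  by move=> Ba; exact: smooth_continuous (patch_sheet_smooth (iP k)) Ba.
have psK k a : patch_disc (P k) a -> patch_sheet (P k) a *m (patch_frame (P k))^T = a.
  exact: patch_sheetK (iP k) a.
have [e [eps [eps0 lk dj]]] := choose_links psC psK links.
have [S [s [idx [sE cov]]]] := glue_sheets (fun k => patch_sheet_smooth (iP k)) psK eps0 lk dj.
have oU (c : chart S) : open (img c) := @img_open _ _ S c.
have sP (c : chart S) : smooth_on (img c) (patch_sheet (P (idx c))).
  by apply: smooth_subset (patch_sheet_smooth (iP (idx c))) => x /sE[].
have lE (c : chart S) x : img c x -> local_rep s c x = patch_sheet (P (idx c)) x.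
  by case/sE.
have JE (c : chart S) x : img c x -> 'J (local_rep s c) x = 'J (patch_sheet (P (idx c))) x.
  exact: jacobian_ext (oU c) (sP c) (@lE c).
have imm : immersion s.
  move=> c; split=> [|x Ux].
    by apply: smooth_ext (sP c) => // x; rewrite inE => /lE.
  rewrite JE//; apply: (section_free (oU c) (sP c) (L := (patch_frame (P (idx c)))^T)) => // y.
  by move=> /sE[By _]; exact: psK.
have [h iso] := induced_metric imm.
exists S, h, s; split=> //.
  exists `|2%:R^-1 * t| => c x Ux; have [nu [snu unu nnu tnu]] := patch_normal (iP (idx c)).
  have Bx y : img c y -> patch_disc (P (idx c)) y by case/sE.
  rewrite (mean_curvature_shape iso (N := nu) _ _ _ Ux).
  - by rewrite /shape /coframe JE// -/(coframe _ x) -/(shape _ nu x) tnu//; exact: Bx.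
  - exact: smooth_subset Bx snu.
  - by move=> y /Bx; exact: unu.
  - by move=> y Uy; rewrite JE// nnu//; exact: Bx.
have orth := splitting_orth B3B B2B BB3 BB2.
have orth' : B2 *m B3^T = 0 by rewrite -[LHS]trmxK trmx_mul trmxK orth trmx0.
pose W : set (S * 'rV[R]_(n - 2)) :=
  [set x | exists2 c, dom c x.1 & patch_fiber (P (idx c)) x.2].
exists (col_mx B3 B2), W; split.
- by rewrite tr_col_mx mul_col_row BB3 BB2 orth orth' -scalar_mx_block.
- rewrite openE => -[x y] [c /= cx cy].
  exists (dom c, patch_fiber (P (idx c))); last by move=> -[x' y'] [/= ? ?]; exists c.
  split; apply: open_nbhs_nbhs; split=> //=; first exact: dom_open.
  exact: ball_open.
have fE q : f q = row_mx (f3 q) (f2 q) *m col_mx B3 B2.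
  by rewrite mul_row_col /f3 /f2 -!mulmxA -mulmxDr B3B B2B subrK mulmx1.
apply/seteqP; split=> [_ [p _ <-]|_ [[x y] [c /= cx cy] <-]]; last first.
  have Ux : img c (coord c x) by exists x.
  have [Bx sx] := sE _ _ Ux; rewrite coordK// in sx.
  have [q [_ q3 q2]] := patch_onto (iP (idx c)) Bx cy.
  by exists q => //; rewrite fE q3 q2 /cylinder /= sx.
have [i ip] := vP p; have [k0 k0i] := wsurj i; pose k := (k0 * 3)%N.
have Pk j : (k <= j <= k.+2)%N -> P j = Pt (v i).
  move=> /andP[kj jk]; rewrite /P -(subnKC kj) divnMDl// divn_small ?addn0 ?k0i//.
  by rewrite ltnS leq_subLR addn2.
have kk : (k <= k <= k.+2)%N by rewrite leqnn -addn2 leq_addr.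
have kp : patch_dom (P k) p by rewrite Pk.
have [Ba bp aE] := patch_graph (iP k) kp.
have [|c [ca ck]] := cov k _ Ba.
  by move=> j /andP[/ltnW kj jk]; rewrite !Pk// ?kj.
exists (param c (f3 p *m (patch_frame (P k))^T), f2 p).
  exists c => /=; first by case: (param_img ca).
  by rewrite Pk// -(Pk k).
by rewrite fE /cylinder /= (sE _ _ ca).2 (Pk _ ck) -(Pk k)// aE.
Qed.
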